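(* Let $K \subset \mathbb{R}^2$ be a compact convex centrally symmetric set with nonempty interior whose boundary $\partial K$ is transverse to the unit circle $S^1$. Let $\zeta_1,\dots,\zeta_{4n}$ be the points of intersection of $\partial K$ and $S^1$, cyclically ordered along $S^1$. Then $K$ is in MI position if and only if $$\sum_{j\ \mathrm{odd}} \zeta_j^2 = \sum_{j\ \mathrm{even}} \zeta_j^2,$$ where $\mathbb{R}^2$ is identified with $\mathbb{C}$ in the usual way and the sums are over $j\in\{1,\dots,4n\}$.
   Context: $K$ is centrally symmetric if $K=-K$. $|\cdot|$ denotes area. Two Jordan curves in the plane are transverse if at every point $p$ of intersection each curve admits a (regular) $C^1$ parametrization near $p$, and the two tangent vectors at $p$ are linearly independent; if $K \subset \mathbb{R}^2$ is a compact convex centrally symmetric set with nonempty interior whose boundary $\partial K$ is transverse to the unit circle $S^1$, then the number of intersection points of $\partial K$ and $S^1$ is finite and a multiple of $4$. An ellipse means the closed filled region, i.e. an image of the closed unit disk under an invertible affine map (arbitrary center). An ellipse $E$ is a maximal intersection (MI) ellipse for $K$ if among all ellipses with the same area as $E$ it maximizes $|E\cap K|$. $K$ is in maximum intersection (MI) position if the closed euclidean unit disk is an MI ellipse for $K$. *)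

(* Defs.v *)
From HB Require Import structures.
From mathcomp Require Import all_boot all_order all_algebra.
From mathcomp Require Import all_classical all_reals all_analysis.
From mathcomp Require Import complex.

Set Implicit Arguments.
Unset Strict Implicit.
Unset Printing Implicit Defensive.

Import Order.TTheory GRing.Theory Num.Theory.
Import numFieldNormedType.Exports.

Local Open Scope classical_set_scope.
Local Open Scope ring_scope.

Definition centrally_symmetric (R : realType) (K : set (R * R)) : Prop :=
  K = [set - x | x in K].

Definition boundary (R : realType) (K : set (R * R)) : set (R * R) :=
  closure K `\` interior K.

Definition area (R : realType) (A : set (R * R)) : \bar R :=
  (lebesgue_measure \x lebesgue_measure)%E A.

(* Written with coordinates because the norm of the library on [R * R] is the
   sup norm. *)
Definition unit_disk (R : realType) : set (R * R) :=
  [set p | p.1 ^+ 2 + p.2 ^+ 2 <= 1].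

Definition unit_circle (R : realType) : set (R * R) :=
  [set p | p.1 ^+ 2 + p.2 ^+ 2 = 1].

(* [g], restricted to some interval ]-e, e[, is an injective regular C^1
   parametrization of the part of [C] lying in an open neighborhood of
   [p = g 0]. *)
Definition regular_C1_param (R : realType) (C : set (R * R)) (p : R * R)
    (g : R -> R * R) : Prop :=
  g 0 = p /\
  exists e : R, 0 < e /\
  [/\ {in `]- e, e[ &, injective g},
      exists2 U : set (R * R), open_nbhs p U &
        [set g t | t in `]- e, e[ ] = C `&` U,
      forall t : R, t \in `]- e, e[ -> derivable g t 1,
      {in `]- e, e[, continuous (derive1 g)} &
      forall t : R, t \in `]- e, e[ -> derive1 g t != 0].

Definition transverse (R : realType) (C D : set (R * R)) : Prop :=
  forall p : R * R, C p -> D p ->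
  exists g h : R -> R * R,
    [/\ regular_C1_param C p g,
        regular_C1_param D p h &
        free [:: derive1 g 0; derive1 h 0]].

Definition ellipse (R : realType) (E : set (R * R)) : Prop :=
  exists (f : {linear (R * R)%type -> (R * R)%type}) (b : R * R),
    bijective f /\ E = [set f x + b | x in @unit_disk R].

Definition MI_ellipse (R : realType) (K E : set (R * R)) : Prop :=
  ellipse E /\
  forall E' : set (R * R), ellipse E' -> area E' = area E ->
    (area (E' `&` K) <= area (E `&` K))%E.

Definition MI_position (R : realType) (K : set (R * R)) : Prop :=
  MI_ellipse K (@unit_disk R).

(* [z 1], ..., [z N] are distinct points of the unit circle met in this order
   within a single counterclockwise turn; the other values of [z] are
   irrelevant. *)
Definition counterclockwise (R : realType) (N : nat) (z : nat -> R * R) : Prop :=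
  exists theta : nat -> R,
    [/\ forall j, (1 <= j <= N)%N -> z j = (cos (theta j), sin (theta j)),
        forall i j, (1 <= i)%N -> (i < j)%N -> (j <= N)%N ->
          theta i < theta j &
        forall i j, (1 <= i <= N)%N -> (1 <= j <= N)%N ->
          theta j < theta i + 2 * pi].

(* Both orientations of the circle are allowed. *)
Definition cyclically_ordered (R : realType) (N : nat) (z : nat -> R * R) : Prop :=
  counterclockwise N z \/ counterclockwise N (fun j => z (N.+1 - j)%N).

Definition to_complex (R : realType) (p : R * R) : R[i] := Complex p.1 p.2.

(* Main.v *)
Require Import Defs.
From HB Require Import structures.
From mathcomp Require Import all_boot all_order all_algebra.
From mathcomp Require Import all_classical all_reals all_analysis.
From mathcomp Require Import complex.
From mathcomp Require Import measurable_realfun ring lra.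

Set Implicit Arguments.
Unset Strict Implicit.
Unset Printing Implicit Defensive.

Import Order.TTheory GRing.Theory Num.Theory.
Import numFieldNormedType.Exports.

Local Open Scope classical_set_scope.
Local Open Scope ring_scope.

(* Let [v] run over the poles of the chords spanned by the arcs of the unit
   circle outside [K], one for each antipodal pair, and let [Q] be the polygon
   cut out by the strips [|<x, v>| <= 1]. By convexity [D & Q] lies in [K] and
   [K \ Q] lies in the disk [D], so [|E & K| - |D & K| <= |E & Q| - |D & Q|] for
   every [E]. By Brunn-Minkowski it suffices to consider centered ellipses [E],
   which after a rotation are the images of [D] under diag(e^s, e^-s). Letting
   this flow act on the vectors [v] instead, the area of [D & Q] is that of [D]
   minus the areas of the caps cut off by the strips, as long as the caps are
   disjoint. At [s = 0] the derivative of the total cap area is a real-linear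
   functional of the difference of the two sums of squares (transversality makes
   the arcs inside and outside [K] alternate), and every direction of such
   functionals arises from some rotation. Once nonnegative, the derivative
   remains so. When two caps touch, their strips are merged into one with the
   same derivative, and when a cap shrinks to a point its strip is dropped; both
   change [Q] inside [D] only, so the comparison of areas persists for all [s].
   This gives sufficiency. Conversely, if the sums differ then some rotation
   makes the derivative negative, and since near the circle [K] agrees with [Q]
   up to thin cones, the flow increases the area of [E & K] at first order. *)

(** The sign of the derivative persists because S, the sum of the [hh], satisfies S' > S wherever S
    < 0, so that exp(-s) S has no negative minimum after time 0. A term [dhh] of S' can be negative
    only if its cap has half-angle above pi/4; disjointness allows at most one such cap and bounds
    the [rr] of the others by the inverse of its own, which compensates. Merging is forced because
    cap areas stop adding up once caps overlap. It lowers the number of strips, on which the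
    induction runs, and it preserves S because 4 [hh] equals sin(2b) - sin(2a) for a gap from angle
    a to angle b, which telescopes. If the half-angles of two touching caps add up to pi/2, no
    merged strip exists, but then the polygon lies in the disk and the comparison of areas is
    immediate. For the converse, K near the circle is controlled only up to a tolerance e: the poles
    are enlarged by the factor 1 + e, the time of the flow tends to 0 first, and the cones left over
    disappear as e tends to 0. *)

Notation plane R := ((measurableTypeR R) * (measurableTypeR R))%type.

(** The rational boxes contained in [U] cover it, and [unpickle] enumerates their parameters, so [U]
    is a countable union of measurable rectangles. *)
Lemma open_measurable2 (R : realType) (U : set (R * R)) :
  open U -> measurable (U : set (plane R)).
Proof.
move=> oU.
pose box (t : rat * rat * (rat * rat)) : set (plane R) :=
  ball (ratr t.1.1 : R) (ratr t.1.2) `*` ball (ratr t.2.1 : R) (ratr t.2.2).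
pose F n : set (plane R) :=
  if unpickle n is Some t then (if `[< box t `<=` U >] then box t else set0) else set0.
have -> : U = \bigcup_n F n.
  apply/seteqP; split=> [[x y] Uxy|p [n _]]; last first.
    rewrite /F; case: (unpickle n) => // t; case: asboolP => // tU; exact: tU.
  have [[A B] [/= Ax By] ABU] : nbhs (x, y) U by exact: open_nbhs_nbhs.
  have [|a [r [/set_mem xa aA]]] := @open_subball_rat R A° x (@open_interior _ A).
    by rewrite inE.
  have [|b [s [/set_mem yb bB]]] := @open_subball_rat R B° y (@open_interior _ B).
    by rewrite inE.
  have := pickleK (a, r, (b, s)); move: (pickle _) => k kE.
  exists k; first by [].
  rewrite /F kE; case: asboolP => [_|]; first by split.
  by case=> -[u v] [/= /aA/interior_subset Au /bB/interior_subset Bv]; exact: ABU.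
apply: bigcupT_measurable => n; rewrite /F; case: (unpickle n) => // t.
by case: asboolP => // _; apply: measurableX; apply: open_measurable; exact: ball_open.
Qed.

Lemma closed_measurable2 (R : realType) (A : set (R * R)) :
  closed A -> measurable (A : set (plane R)).
Proof. by move/closed_openC/open_measurable2/measurableC; rewrite setCK. Qed.

Lemma continuous_fst (R : realType) : continuous (fun p : R * R => p.1).
Proof. by move=> p; exact: cvg_fst. Qed.

Lemma continuous_snd (R : realType) : continuous (fun p : R * R => p.2).
Proof. by move=> p; exact: cvg_snd. Qed.

(** * Areas in the plane *)

(** By uniqueness of Lebesgue measure: |a| times its pushforward under y |-> a y + d takes the right
    values on half-open intervals. *)
Lemma lebesgue_measure_affine (R : realType) (a d : R) (B : set (measurableTypeR R)) :
  a != 0 -> measurable B ->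
  lebesgue_measure [set y : R | B (a * y + d)] = (`|a|^-1%:E * lebesgue_measure B)%E.
Proof.
move=> a0 mB.
have mf : measurable_fun setT (fun y : measurableTypeR R => a * y + d : measurableTypeR R).
  apply: measurable_funD => //; exact: measurable_funM.
pose f : measurableTypeR R -> measurableTypeR R := fun y => a * y + d.
have absa : 0 < `|a| by rewrite normr_gt0.
have E := @lebesgue_measure_unique R
  (mscale (NngNum (normr_ge0 a)) (pushforward lebesgue_measure f)) .
have {}E := E mf.
rewrite [in RHS]E //; last first.
  move=> _ [[x y]] _ <- /=; rewrite /mscale /= /pushforward /=.
  have [xy|yx] := ltP x y; last first.
    rewrite set_itv_ge ?bnd_simp -?leNgt //.
    by rewrite preimage_set0 !measure0 mule0.
  case: (ltgtP a 0) a0 => // [an _|ap _].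
    have -> : f @^-1` `]x, y]%classic = `[(y - d) / a, (x - d) / a[%classic.
      apply/seteqP; split => z /=; rewrite !in_itv /= ler_ndivrMr // ltr_ndivlMr // /f;
       move=> /andP[h1 h2]; apply/andP; split; lra.
    rewrite !lebesgue_measure_itv /= !lte_fin xy ltr_nM2r ?invr_lt0 //.
    rewrite ltrD2r xy -!EFinD -EFinM; congr EFin; rewrite ltr0_norm //.
    by field; rewrite lt_eqF.
  have -> : f @^-1` `]x, y]%classic = `](x - d) / a, (y - d) / a]%classic.
    apply/seteqP; split => z /=; rewrite !in_itv /= ltr_pdivrMr // ler_pdivlMr // /f;
     move=> /andP[h1 h2]; apply/andP; split; lra.
  rewrite !lebesgue_measure_itv /= !lte_fin xy ltr_pM2r ?invr_gt0 //.
  rewrite ltrD2r xy -!EFinD -EFinM; congr EFin; rewrite gtr0_norm //.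
  by field; rewrite gt_eqF.
rewrite /= /mscale /= muleA -EFinM mulVf ?gt_eqF // mul1e.
by [].
Qed.

Lemma measurable_affine_preimage (R : realType) (a b e c d f : R) (A : set (plane R)) :
  measurable A ->
  measurable ([set p | A (a * p.1 + b * p.2 + e, c * p.1 + d * p.2 + f)] : set (plane R)).
Proof.
move=> mA.
have m1 (k : R) : measurable_fun setT (fun p : plane R => k * p.1 : measurableTypeR R).
  by apply: measurable_funM => //; exact: measurable_fst.
have m2 (k : R) : measurable_fun setT (fun p : plane R => k * p.2 : measurableTypeR R).
  by apply: measurable_funM => //; exact: measurable_snd.
have mf : measurable_fun setT
    (fun p : plane R => (a * p.1 + b * p.2 + e, c * p.1 + d * p.2 + f) : plane R).
  apply: measurable_fun_pair.
    exact: (measurable_funD (measurable_funD (m1 a) (m2 b)) (measurable_cst e)).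
  exact: (measurable_funD (measurable_funD (m1 c) (m2 d)) (measurable_cst f)).
by have := mf measurableT A mA; rewrite setTI.
Qed.

Lemma areaE1 (R : realType) (A : set (R * R)) :
  area A = (\int[lebesgue_measure]_x lebesgue_measure (xsection A x))%E.
Proof. by []. Qed.

Lemma areaE2 (R : realType) (A : set (R * R)) : measurable (A : set (plane R)) ->
  area A = (\int[lebesgue_measure]_y lebesgue_measure (ysection A y))%E.
Proof.
move=> mA.
have H B C : measurable B -> measurable C ->
    (@lebesgue_measure R \x^ @lebesgue_measure R)%E (B `*` C) =
    (lebesgue_measure B * lebesgue_measure C)%E.
  by move=> mB mC; exact: product_measure2E.
exact: (product_measure_unique H mA).
Qed.

Lemma area_fiber_affine (R : realType) (c d f : R) (A : set (plane R)) :
  d != 0 -> measurable A ->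
  area ([set p | A (p.1, c * p.1 + d * p.2 + f)]) = (`|d|^-1%:E * area A)%E.
Proof.
move=> d0 mA; rewrite !areaE1 -ge0_integralZl //; last first.
  exact: measurable_fun_xsection.
apply: eq_integral => x _.
rewrite -(@lebesgue_measure_affine _ d (c * x + f)) //; last exact: measurable_xsection.
congr (lebesgue_measure _); apply/seteqP; split => y /=; rewrite !xsectionE /=;
  by rewrite addrA (addrC (d * y)).
Qed.

Lemma area_swap (R : realType) (A : set (plane R)) :
  measurable A -> area [set p | A (p.2, p.1)] = area A.
Proof.
move=> mA; rewrite areaE1 areaE2 //; exact: eq_integral.
Qed.

(** The map factors into one affine along vertical lines, with coefficient d, and one affine along
    horizontal lines, with coefficient (a d - b c) / d. If d = 0, the two rows are exchanged
    first. *)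
Lemma area_affine (R : realType) (a b e c d f : R) (A : set (plane R)) :
  a * d - b * c != 0 -> measurable A ->
  area [set p | A (a * p.1 + b * p.2 + e, c * p.1 + d * p.2 + f)] =
  (`|a * d - b * c|^-1%:E * area A)%E.
Proof.
wlog d0 : a b e c d f A / d != 0.
  move=> wl; have [d0|] := eqVneq d 0; last exact: wl.
  move=> det mA; have b0 : b != 0 by apply: contraNneq det => ->; rewrite d0 mul0r mulr0 subr0.
  have := wl c d f a b e [set p | A (p.2, p.1)] b0.
  rewrite /= d0 => -> //; last 2 first.
  - by move: det; rewrite d0 mul0r mulr0 !sub0r subr0 oppr_eq0 mulrC.
  - have := @measurable_affine_preimage R 0 1 0 1 0 0 A mA.
    set B := (X in measurable X -> _); suff -> : B = [set p | A (p.2, p.1)] by [].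
    by apply/seteqP; split => p; rewrite /B /= !mul0r !mul1r !add0r !addr0.
  rewrite area_swap //; congr (_%:E * _)%E.
  by rewrite mulr0 mul0r sub0r subr0 normrN mulrC.
move=> det mA.
pose A1 : set (plane R) := [set p | A (((a * d - b * c) / d) * p.1 + (b / d) * p.2 + (e - b / d * f), p.2)].
have mA1 : measurable A1.
  have := @measurable_affine_preimage R ((a * d - b * c) / d) (b / d) (e - b / d * f) 0 1 0 A mA.
  set B := (X in measurable X -> _); suff -> : B = A1 by [].
  by apply/seteqP; split => p; rewrite /B /A1 /= mul0r mul1r add0r addr0.
transitivity (area [set p | A1 (p.1, c * p.1 + d * p.2 + f)]).
  congr area; apply/seteqP; split => -[x y]; rewrite /A1 /=;
  rewrite (_ : (a * d - b * c) / d * x + b / d * (c * x + d * y + f) + (e - b / d * f) =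
    a * x + b * y + e) //; by field.
rewrite area_fiber_affine //.
have mA2 : measurable ([set p | A (p.2, p.1)] : set (plane R)).
  have := @measurable_affine_preimage R 0 1 0 1 0 0 A mA.
  set B := (X in measurable X -> _); suff -> : B = [set p | A (p.2, p.1)] by [].
  by apply/seteqP; split => p; rewrite /B /= !mul0r !mul1r !add0r !addr0.
have -> : area A1 = area [set p | A1 (p.2, p.1)] by rewrite area_swap.
have := @area_fiber_affine R (b / d) ((a * d - b * c) / d) (e - b / d * f) _ _ mA2.
rewrite [X in (area X = _)%E](_ : _ = [set p | A1 (p.2, p.1)]); last first.
  by apply/seteqP; split => -[x y]; rewrite /A1 /= (addrC (b / d * x)).
move=> ->; last by rewrite mulf_neq0 // invr_eq0.
rewrite area_swap // muleA -EFinM; congr (_%:E * _)%E.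
by rewrite normrM normfV; field; rewrite !normr_eq0 d0 det.
Qed.

Definition ar (R : realType) (A : set (R * R)) : R := fine (area A).

(** Since [fine] sends an infinite area to 0, [ar] is monotone and additive only under this
    finiteness condition. *)
Definition fmeas (R : realType) (A : set (R * R)) : Prop :=
  measurable (A : set (plane R)) /\ (area A < +oo)%E.

Definition dot (R : realType) (u v : R * R) : R := u.1 * v.1 + u.2 * v.2.

Definition strip (R : realType) (v : R * R) : set (R * R) :=
  [set x | `|dot x v| <= 1].

Lemma arE (R : realType) (A : set (R * R)) : ar A = fine (area A).
Proof. by []. Qed.

Lemma area_ge0 (R : realType) (A : set (R * R)) : (0 <= area A)%E.
Proof. by rewrite areaE1; apply: integral_ge0 => x _; exact: measure_ge0. Qed.

Lemma le_area (R : realType) (A B : set (R * R)) :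
  measurable (A : set (plane R)) -> measurable (B : set (plane R)) ->
  A `<=` B -> (area A <= area B)%E.
Proof.
move=> mA mB AB.
apply: (@le_measure _ _ _ (@lebesgue_measure R \x @lebesgue_measure R)%E) => //;
by rewrite inE.
Qed.

Lemma area_setX (R : realType) (A B : set (measurableTypeR R)) :
  measurable A -> measurable B ->
  area (A `*` B) = (lebesgue_measure A * lebesgue_measure B)%E.
Proof. by move=> mA mB; exact: product_measure1E. Qed.

Lemma fmeas_sub (R : realType) (A B : set (R * R)) :
  measurable (A : set (plane R)) -> fmeas B -> A `<=` B -> fmeas A.
Proof. by move=> mA [mB fB] AB; split; [|exact: le_lt_trans (le_area mA mB AB) fB]. Qed.

Lemma fmeasIl (R : realType) (A B : set (R * R)) :
  fmeas A -> measurable (B : set (plane R)) -> fmeas (A `&` B).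
Proof.
by move=> fA mB; apply: (fmeas_sub (measurableI _ _ fA.1 mB) fA) => x [].
Qed.

Lemma fmeasD (R : realType) (A B : set (R * R)) :
  fmeas A -> measurable (B : set (plane R)) -> fmeas (A `\` B).
Proof.
by move=> fA mB; apply: (fmeas_sub (measurableD fA.1 mB) fA) => x [].
Qed.

Lemma areaEr (R : realType) (A : set (R * R)) : fmeas A -> area A = (ar A)%:E.
Proof.
by move=> [mA fA]; rewrite /ar fineK // ge0_fin_numE // area_ge0.
Qed.

Lemma ar_ge0 (R : realType) (A : set (R * R)) : 0 <= ar A.
Proof. exact: fine_ge0 (area_ge0 A). Qed.

Lemma ar0 (R : realType) : ar (set0 : set (R * R)) = 0.
Proof.
by rewrite /ar /area (_ : (_ \x _)%E _ = 0%E) //;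
  exact: (@measure0 _ _ _ (@lebesgue_measure R \x @lebesgue_measure R)%E).
Qed.

Lemma le_ar (R : realType) (A B : set (R * R)) :
  measurable (A : set (plane R)) -> fmeas B -> A `<=` B -> ar A <= ar B.
Proof.
move=> mA fB AB; have fA := fmeas_sub mA fB AB.
by rewrite -lee_fin -(areaEr fA) -(areaEr fB); exact: le_area mA fB.1 AB.
Qed.

Lemma ar_setD (R : realType) (A B : set (R * R)) :
  fmeas A -> measurable (B : set (plane R)) -> ar A = ar (A `&` B) + ar (A `\` B).
Proof.
move=> fA mB; apply: EFin_inj; rewrite EFinD -(areaEr fA) -(areaEr (fmeasIl fA mB)) -(areaEr (fmeasD fA mB)).
rewrite addeC.
exact: (@measureDI _ _ _ (@lebesgue_measure R \x @lebesgue_measure R)%E _ _ fA.1 mB).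
Qed.

Lemma fmeasU (R : realType) (A B : set (R * R)) :
  fmeas A -> fmeas B -> fmeas (A `|` B).
Proof.
move=> [mA fA] [mB fB]; split; first exact: measurableU.
have := @measureU2 _ _ _ (@lebesgue_measure R \x @lebesgue_measure R)%E A B mA mB.
by move=> /le_lt_trans; apply; exact: lte_add_pinfty.
Qed.

Lemma ar_setU_le (R : realType) (A B : set (R * R)) :
  fmeas A -> fmeas B -> ar (A `|` B) <= ar A + ar B.
Proof.
move=> fA fB; rewrite -lee_fin EFinD -(areaEr fA) -(areaEr fB) -(areaEr (fmeasU fA fB)).
exact: (@measureU2 _ _ _ (@lebesgue_measure R \x @lebesgue_measure R)%E A B fA.1 fB.1).
Qed.

Lemma ar_setU (R : realType) (A B : set (R * R)) :
  fmeas A -> fmeas B -> A `&` B `<=` set0 -> ar (A `|` B) = ar A + ar B.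
Proof.
move=> fA fB AB0; apply: EFin_inj; rewrite EFinD -(areaEr fA) -(areaEr fB) -(areaEr (fmeasU fA fB)).
apply: (@measureU _ _ _ (@lebesgue_measure R \x @lebesgue_measure R)%E A B fA.1 fB.1).
by apply/seteqP; split => // x /AB0.
Qed.

Lemma compact_fmeas (R : realType) (A : set (R * R)) : compact A -> fmeas A.
Proof.
move=> cA; have mA : measurable (A : set (plane R)).
  by apply: closed_measurable2; exact: compact_closed.
split => //.
have /compact_bounded/pinfty_ex_gt0[M M0 HM] := cA.
pose B : set (plane R) := `[- M, M]%classic `*` `[- M, M]%classic.
have mB : measurable B by apply: measurableX.
apply: (@le_lt_trans _ _ (area B)).
  apply: le_area => // -[x y] /HM /=; rewrite prod_normE /= => hm.
  have hx : `|x| <= M by apply: le_trans hm; rewrite le_max lexx.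
  have hy : `|y| <= M by apply: le_trans hm; rewrite le_max lexx orbT.
  by split; rewrite /= in_itv /=; rewrite -ler_norml.
rewrite /B area_setX // !lebesgue_measure_itv /= lte_fin.
by case: ifP => // _; rewrite ?mule0 -?EFinD -?EFinM ltry.
Qed.

Lemma ar_rect (R : realType) (a b c d : R) : a <= b -> c <= d ->
  ar (`]a, b]%classic `*` `[c, d]%classic) = (b - a) * (d - c).
Proof.
move=> ab cd; rewrite /ar area_setX // !lebesgue_measure_itv /= !lte_fin.
case: ltP => ab' /=; last first.
  by rewrite (_ : b = a) ?subrr ?mul0r ?mul0e //; apply/eqP; rewrite eq_le ab' ab.
by case: ltP => cd' //=; rewrite (_ : d = c) ?subrr ?mulr0 ?mule0 //; apply/eqP; rewrite eq_le cd' cd.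
Qed.

Lemma fmeas_rect (R : realType) (a b c d : R) : 
  fmeas (`]a, b]%classic `*` `[c, d]%classic).
Proof.
split; first exact: measurableX.
rewrite area_setX // !lebesgue_measure_itv /= !lte_fin.
by case: ifP => _; case: ifP => _ //=; rewrite ?mule0 ?mul0e -?EFinD -?EFinM ?ltry.
Qed.

Lemma continuous_dot (R : realType) (v : R * R) : continuous (fun x => dot x v).
Proof.
move=> x; apply: cvgD; apply: cvgM; try exact: cvg_cst.
  exact: continuous_fst.
exact: continuous_snd.
Qed.

Lemma continuous_sqnorm (R : realType) : continuous (fun x : R * R => x.1 ^+ 2 + x.2 ^+ 2).
Proof.
move=> x; apply: cvgD; rewrite !expr2; apply: cvgM;
 try exact: continuous_fst; exact: continuous_snd.
Qed.

Lemma closed_unit_disk (R : realType) : closed (@unit_disk R).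
Proof.
apply: (@preimage_closed _ _ (fun x : R * R => x.1 ^+ 2 + x.2 ^+ 2) [set t | t <= 1]).
  by move=> x _; exact: continuous_sqnorm.
exact: closed_le.
Qed.

Lemma closed_strip (R : realType) (v : R * R) : closed (strip v).
Proof.
apply: (@preimage_closed _ _ (fun x : R * R => `|dot x v|) [set t | t <= 1]).
  by move=> x _; apply: cvg_norm; exact: continuous_dot.
exact: closed_le.
Qed.

Lemma measurable_strip (R : realType) (v : R * R) : measurable (strip v : set (plane R)).
Proof. exact: closed_measurable2 (@closed_strip R v). Qed.

Lemma fmeas_unit_disk (R : realType) : fmeas (@unit_disk R).
Proof.
have mD := closed_measurable2 (@closed_unit_disk R).
apply: (fmeas_sub mD (@fmeas_rect R (-2) 1 (-1) 1)) => -[x y]; rewrite /unit_disk /= => h.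
by split; rewrite /= in_itv /=; apply/andP; split; nra.
Qed.

#[global] Opaque ar area.

Lemma measurable_linear_preimage (R : realType) (a b c d : R) (A : set (plane R)) :
  measurable A ->
  measurable ([set p | A (a * p.1 + b * p.2, c * p.1 + d * p.2)] : set (plane R)).
Proof.
move=> mA; have := @measurable_affine_preimage R a b 0 c d 0 A mA.
by congr measurable; apply/seteqP; split => p /=; rewrite !addr0.
Qed.

Lemma area_linear (R : realType) (a b c d : R) (A : set (plane R)) :
  `|a * d - b * c| = 1 -> measurable A ->
  area [set p | A (a * p.1 + b * p.2, c * p.1 + d * p.2)] = area A.
Proof.
move=> det mA; have := @area_affine R a b 0 c d 0 A _ mA.
rewrite det invr1 mul1e => <-; last by rewrite -normr_eq0 det oner_eq0.
by congr area; apply/seteqP; split => p /=; rewrite !addr0.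
Qed.

Lemma ar_linear (R : realType) (a b c d : R) (A : set (plane R)) :
  `|a * d - b * c| = 1 -> measurable A ->
  ar [set p | A (a * p.1 + b * p.2, c * p.1 + d * p.2)] = ar A.
Proof. by move=> det mA; rewrite [LHS]arE [RHS]arE area_linear. Qed.

(** * The area of a circular cap *)

Definition halfcap (R : realType) (t : R) : R :=
  ar (@unit_disk R `&` [set p | t < p.1]).

Lemma measurable_fst_gt (R : realType) (t : R) :
  measurable ([set p : R * R | t < p.1] : set (plane R)).
Proof.
apply: open_measurable2.
apply: (@open_comp _ _ (fun x : R * R => x.1) [set s | t < s]).
  by move=> x _; exact: continuous_fst.
exact: open_gt.
Qed.

(** The slab of the disk between the abscissas t and u contains the rectangle of its height at u and
    lies in the rectangle of its height at t. As [Num.sqrt] is 0 on negative numbers, the bounds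
    stay correct beyond 1. *)
Lemma halfcap_slab (R : realType) (t u : R) : 0 <= t -> t <= u ->
  2 * Num.sqrt (1 - u ^+ 2) * (u - t) <= halfcap t - halfcap u /\
  halfcap t - halfcap u <= 2 * Num.sqrt (1 - t ^+ 2) * (u - t).
Proof.
move=> t0 tu.
set S := @unit_disk R `&` [set p | t < p.1].
have fS : fmeas S := fmeasIl (fmeas_unit_disk R) (measurable_fst_gt t).
have E : halfcap t - halfcap u = ar (S `\` [set p | u < p.1]).
  rewrite [halfcap t](ar_setD fS (measurable_fst_gt u)) addrAC.
  rewrite [X in X - _](_ : _ = halfcap u) ?subrr ?add0r //.
  congr ar; apply/seteqP; split => p; rewrite /S /=; first by case=> -[].
  by move=> [Dp up]; do 2?split => //; exact: le_lt_trans up.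
have fSu := fmeasD fS (measurable_fst_gt u).
have rectE h : 0 <= h -> 2 * h * (u - t) = ar (`]t, u]%classic `*` `[- h, h]%classic).
  by move=> h0; rewrite ar_rect //; [ring | lra].
have sq_ge0 w : 0 <= Num.sqrt (1 - w ^+ 2) :> R by exact: sqrtr_ge0.
rewrite E; split.
  have [u1|/ltW u1] := leP (u ^+ 2) 1; last first.
    by rewrite ler0_sqrtr ?subr_le0 // mulr0 mul0r ar_ge0.
  rewrite rectE //; apply: le_ar fSu _; first exact: (fmeas_rect _ _ _ _).1.
  move=> -[x y] [/=]; rewrite !in_itv /= => /andP[tx xu] /andP[y1 y2].
  rewrite /S /unit_disk /=; split; last by apply/negP; rewrite -leNgt.
  split => //.
  have /sqr_sqrtr : 0 <= 1 - u ^+ 2 by rewrite subr_ge0.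
  by move: (Num.sqrt _) y1 y2 => h y1 y2 hE; nra.
rewrite rectE //; apply: le_ar fSu.1 (fmeas_rect _ _ _ _) _.
move=> -[x y] [[/= Dp tx] /negP]; rewrite -leNgt => xu.
split; rewrite /= in_itv /=; first by rewrite tx.
rewrite -ler_norml -sqrtr_sqr ler_wsqrtr //.
move: Dp; rewrite /unit_disk /=; nra.
Qed.

(** The hypothesis says that the difference quotient of [f] at [z] is at least as close to [g x] as
    [g z] is, which is what bounds by two rectangles provide. *)
Lemma is_derive_squeeze (R : realType) (f g : R -> R) (x : R) :
  {for x, continuous g} ->
  (\forall z \near x, `|f z - f x - g x * (z - x)| <= `|g z - g x| * `|z - x|) ->
  is_derive x 1 f (g x).
Proof.
move=> gx fg; apply/is_derive1_caratheodory.
pose h z := if z == x then g x else (f z - f x) / (z - x).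
exists h; split; last by rewrite /h eqxx.
  move=> z; rewrite /h; case: eqVneq => [->|zx]; first by rewrite !subrr mulr0.
  by rewrite divfK // subr_eq0.
have hx : h x = g x by rewrite /h eqxx.
suff : h z @[z --> x] --> h x by [].
rewrite hx; apply/cvgrPdist_lt => e e0.
have /cvgrPdist_lt/(_ e e0) gxe := gx.
near=> z; rewrite /h; case: eqVneq => [_|zx]; first by rewrite subrr normr0.
rewrite distrC; apply: (@le_lt_trans _ _ `|g z - g x|); last first.
  by rewrite distrC; near: z.
have zx0 : 0 < `|z - x| by rewrite normr_gt0 subr_eq0.
rewrite -(ler_pM2r zx0) -normrM mulrBl divfK ?subr_eq0 //.
by near: z.
Unshelve. all: by end_near. Qed.

(** There is no upper bound on [t]: differentiability at 1 gives the continuity of the cap areas at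
    the moment when a cap vanishes. *)
Lemma is_derive_halfcap (R : realType) (t : R) : 0 < t ->
  is_derive t 1 (@halfcap R) (- 2 * Num.sqrt (1 - t ^+ 2)).
Proof.
move=> t0; apply: (@is_derive_squeeze _ _ (fun t => - 2 * Num.sqrt (1 - t ^+ 2))).
  apply: cvgM; first exact: cvg_cst.
  apply: (@continuous_comp _ _ _ (fun t : R => 1 - t ^+ 2)); last exact: sqrt_continuous.
  by apply: cvgB; [exact: cvg_cst | rewrite expr2; apply: cvgM; exact: cvg_id].
near=> z.
have z0 : 0 < z by near: z; exact: lt_nbhsr.
have mono (a b : R) : 0 < a -> a <= b -> Num.sqrt (1 - b ^+ 2) <= Num.sqrt (1 - a ^+ 2).
  move=> a0 ab; apply: ler_wsqrtr; rewrite lerB // ler_sqr // nnegrE ?ltW //.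
  exact: lt_le_trans ab.
have [tz|/ltW zt] := leP t z.
  have [h1 h2] := halfcap_slab (ltW t0) tz.
  have := mono _ _ t0 tz.
  move: (Num.sqrt _) (Num.sqrt _) (halfcap t) (halfcap z) h1 h2 => b a ht hz h1 h2 s.
  rewrite (ger0_norm (_ : 0 <= z - t)) ?subr_ge0 //.
  rewrite (ger0_norm (_ : 0 <= - 2 * a - - 2 * b)); last by lra.
  by rewrite ler_norml; apply/andP; split; lra.
have [h1 h2] := halfcap_slab (ltW z0) zt.
have := mono _ _ z0 zt.
move: (Num.sqrt _) (Num.sqrt _) (halfcap t) (halfcap z) h1 h2 => b a ht hz h1 h2 s.
rewrite (ler0_norm (_ : z - t <= 0)); last by rewrite subr_le0.
rewrite (ler0_norm (_ : - 2 * b - - 2 * a <= 0)); last by lra.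
by rewrite ler_norml; apply/andP; split; lra.
Unshelve. all: by end_near. Qed.

Definition sqn (R : realType) (v : R * R) : R := v.1 ^+ 2 + v.2 ^+ 2.

(** Outside the strip the disk consists of two antipodal caps, and rotating [v] onto the first axis
    turns each into a cap at distance 1/|v| from the origin. *)
Lemma ar_caps (R : realType) (v : R * R) : 0 < sqn v ->
  ar (@unit_disk R `\` strip v) = 2 * halfcap (Num.sqrt (sqn v))^-1.
Proof.
move=> v0; set n := Num.sqrt (sqn v).
have n0 : 0 < n by rewrite sqrtr_gt0.
have nn : n ^+ 2 = sqn v by rewrite sqr_sqrtr ?ltW.
pose H : set (plane R) := @unit_disk R `&` [set p | n^-1 < p.1].
have fH : fmeas H := fmeasIl (fmeas_unit_disk R) (measurable_fst_gt _).
pose C (w : R * R) : set (plane R) := @unit_disk R `&` [set p | 1 < dot p w].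
have un w : sqn w = sqn v -> (w.1 / n) ^+ 2 + (w.2 / n) ^+ 2 = 1.
  move=> wv; rewrite !expr_div_n -mulrDl nn.
  by move: wv; rewrite {1}/sqn => ->; rewrite divff // gt_eqF.
have rot (a b x y : R) : (a * x + b * y) ^+ 2 + (- b * x + a * y) ^+ 2 =
    (x ^+ 2 + y ^+ 2) * (a ^+ 2 + b ^+ 2) by ring.
have half (w : R * R) x y : (n^-1 < w.1 / n * x + w.2 / n * y) = (1 < x * w.1 + y * w.2).
  rewrite mulrAC (mulrAC _ _ y) -mulrDl -{1}[n^-1]mul1r ltr_pM2r ?invr_gt0 //.
  by rewrite (mulrC x) (mulrC y).
have CE w : sqn w = sqn v -> C w =
    [set p | H (w.1 / n * p.1 + w.2 / n * p.2, - (w.2 / n) * p.1 + w.1 / n * p.2)].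
  move=> wv; apply/seteqP; split => -[x y]; rewrite /C /H /unit_disk /dot /=;
  by rewrite rot un // mulr1 half.
have det w : sqn w = sqn v -> `|w.1 / n * (w.1 / n) - w.2 / n * - (w.2 / n)| = 1.
  by move=> wv; rewrite mulrN opprK -!expr2 un // normr1.
have mC w : sqn w = sqn v -> fmeas (C w).
  move=> wv; apply: (fmeas_sub _ (fmeas_unit_disk R)); last by move=> p [].
  by rewrite CE //; apply: measurable_linear_preimage; exact: fH.1.
have vN : sqn (- v) = sqn v by rewrite /sqn /= !sqrrN.
have -> : @unit_disk R `\` strip v = C v `|` C (- v).
  apply/seteqP; split => -[x y]; rewrite /C /strip /dot /=.
    move=> [Dp /negP]; rewrite -ltNge lter_normr => /orP[h|h]; [left|right]; split => //=.
    by rewrite !mulrN -opprD.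
  move=> [[Dp h]|[Dp h]]; split => //; apply/negP; rewrite -ltNge lter_normr.
    by rewrite h.
  by move: h; rewrite !mulrN -opprD => ->; rewrite orbT.
rewrite (ar_setU (mC v erefl) (mC _ vN)).
  rewrite mulr_natl mulr2n {1}(CE v erefl) (CE _ vN).
  by rewrite (ar_linear (det _ erefl) fH.1) (ar_linear (det _ vN) fH.1).
move=> -[x y]; rewrite /C /dot /= => -[[_ h] [_]]; rewrite !mulrN; lra.
Qed.

(** * Caps and polygons *)

(* Tangent of the half-angle of the caps cut off by [strip v]. *)
Definition rr (R : realType) (v : R * R) : R := Num.sqrt (sqn v - 1).

(** For u = cis(m) / cos h and v = cis(m') / cos h', multiplying by cos h cos h' turns this into
    |cos(m - m')| <= cos(h + h'): the caps of [u], [v] and their antipodes may touch but do not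
    overlap. *)
Definition pair_ok (R : realType) : rel (R * R) :=
  fun u v => `|dot u v| + rr u * rr v <= 1.

Definition pair_lt (R : realType) : rel (R * R) :=
  fun u v => `|dot u v| + rr u * rr v < 1.

Definition polygon (R : realType) (vs : seq (R * R)) : set (R * R) :=
  [set x | forall v, v \in vs -> strip v x].

(* A quarter of the derivative of the cap area along [flow]. It is the real part
   of [rr v * v ^+ 2 / |v| ^+ 4], of which [hy] below is the imaginary part. *)
Definition hh (R : realType) (v : R * R) : R :=
  rr v * (v.1 ^+ 2 - v.2 ^+ 2) / sqn v ^+ 2.

Lemma dotC (R : realType) (u v : R * R) : dot u v = dot v u.
Proof. by rewrite /dot mulrC (mulrC u.2). Qed.

Lemma dotNr (R : realType) (u v : R * R) : dot u (- v) = - dot u v.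
Proof. by rewrite /dot /= !mulrN opprD. Qed.

Lemma sqnN (R : realType) (v : R * R) : sqn (- v) = sqn v.
Proof. by rewrite /sqn /= !sqrrN. Qed.

Lemma rrN (R : realType) (v : R * R) : rr (- v) = rr v.
Proof. by rewrite /rr sqnN. Qed.

Lemma hhN (R : realType) (v : R * R) : hh (- v) = hh v.
Proof. by rewrite /hh rrN sqnN /= !sqrrN. Qed.

Lemma stripN (R : realType) (v : R * R) : strip (- v) = strip v.
Proof. by apply/seteqP; split => x; rewrite /strip /= dotNr normrN. Qed.

Lemma rr_ge0 (R : realType) (v : R * R) : 0 <= rr v.
Proof. exact: sqrtr_ge0. Qed.

Lemma sqr_rr (R : realType) (v : R * R) : 1 <= sqn v -> rr v ^+ 2 = sqn v - 1.
Proof. by move=> v1; rewrite /rr sqr_sqrtr // subr_ge0. Qed.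

Lemma rr_gt0 (R : realType) (v : R * R) : (0 < rr v) = (1 < sqn v).
Proof. by rewrite sqrtr_gt0 subr_gt0. Qed.

Lemma pair_okC (R : realType) : symmetric (@pair_ok R).
Proof. by move=> u v; rewrite /pair_ok dotC mulrC. Qed.

Lemma pair_okNr (R : realType) (u v : R * R) : pair_ok u (- v) = pair_ok u v.
Proof. by rewrite /pair_ok dotNr normrN rrN. Qed.

Lemma cauchy2 (R : realType) (x v : R * R) (k : R) : unit_disk x -> 0 <= k ->
  sqn v <= k ^+ 2 -> dot x v <= k.
Proof.
rewrite /unit_disk /sqn /dot /= => xD k0 vk.
have h := sqr_ge0 (x.1 * v.2 - x.2 * v.1).
have [//|lt] := leP (x.1 * v.1 + x.2 * v.2) k.
have : k ^+ 2 < (x.1 * v.1 + x.2 * v.2) ^+ 2 by rewrite ltr_sqr ?nnegrE //; lra.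
have -> : (x.1 * v.1 + x.2 * v.2) ^+ 2 = (x.1 ^+ 2 + x.2 ^+ 2) * (v.1 ^+ 2 + v.2 ^+ 2)
   - (x.1 * v.2 - x.2 * v.1) ^+ 2 by ring.
have := sqr_ge0 v.1; have := sqr_ge0 v.2; nra.
Qed.

(* The functional [rr v * u + rr u * v] separates the two caps: its norm is at
   most [rr u + rr v]. *)
Lemma caps_disjoint_dir (R : realType) (u v x : R * R) :
  1 < sqn u -> 1 <= sqn v -> dot u v + rr u * rr v <= 1 ->
  unit_disk x -> 1 < dot x u -> dot x v <= 1.
Proof.
move=> u1 v1 uv Dx xu; rewrite leNgt; apply/negP => xv.
have ru : 0 < rr u by rewrite rr_gt0.
have rv := rr_ge0 v.
have ru2 := sqr_rr (ltW u1); have rv2 := sqr_rr v1.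
have := @cauchy2 _ x (rr v * u.1 + rr u * v.1, rr v * u.2 + rr u * v.2) (rr u + rr v) Dx.
have -> : sqn (rr v * u.1 + rr u * v.1, rr v * u.2 + rr u * v.2) =
  rr v ^+ 2 * sqn u + rr u ^+ 2 * sqn v + 2 * rr u * rr v * dot u v.
  by rewrite /sqn /dot /=; ring.
have -> : dot x (rr v * u.1 + rr u * v.1, rr v * u.2 + rr u * v.2) =
  rr v * dot x u + rr u * dot x v by rewrite /dot /=; ring.
move: (rr u) (rr v) (sqn u) (sqn v) ru2 rv2 ru rv uv xu xv => a b U V E1 E2 a0 b0.
have -> : U = a ^+ 2 + 1 by rewrite E1 subrK.
have -> : V = b ^+ 2 + 1 by rewrite E2 subrK.
move: (dot u v) (dot x u) (dot x v) => d p q dab p1 q1 H.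
have : b * p + a * q <= a + b.
  apply: H; first by rewrite addr_ge0 // ltW.
  have : a * b * d <= a * b * (1 - a * b).
    by apply: ler_wpM2l; [rewrite mulr_ge0 // ltW|lra].
  by move=> h; lra.
have : b <= b * p by rewrite ler_peMr // ltW.
have : a < a * q by rewrite ltr_pMr.
lra.
Qed.

Lemma unit_diskN (R : realType) (x : R * R) : unit_disk x -> unit_disk (- x).
Proof. by rewrite /unit_disk /= !sqrrN. Qed.

Lemma disk_sub_strip (R : realType) (v : R * R) : sqn v <= 1 -> @unit_disk R `<=` strip v.
Proof.
move=> v1 x Dx; rewrite /strip /= ler_norml lerNl -dotNr.
by apply/andP; split; apply: cauchy2 => //; rewrite expr1n // sqnN.
Qed.

Lemma dotNl (R : realType) (u v : R * R) : dot (- u) v = - dot u v.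
Proof. by rewrite dotC dotNr dotC. Qed.

Lemma caps_disjoint (R : realType) (u v x : R * R) :
  1 <= sqn u -> 1 <= sqn v -> pair_ok u v ->
  unit_disk x -> ~ strip u x -> strip v x.
Proof.
move=> u1 v1 uv Dx.
have [u1'|u1'] := ltP 1 (sqn u); last by case; apply: disk_sub_strip.
have uv1 : dot u v + rr u * rr v <= 1 by apply: le_trans uv; rewrite lerD2r ler_norm.
have uv2 : dot u (- v) + rr u * rr (- v) <= 1.
  by rewrite rrN dotNr; apply: le_trans uv; rewrite lerD2r -normrN ler_norm.
have main y : unit_disk y -> 1 < dot y u -> strip v y.
  move=> Dy yu; rewrite /strip /= ler_norml lerNl -dotNr.
  rewrite (caps_disjoint_dir u1' v1 uv1 Dy yu) andbT.
  by apply: caps_disjoint_dir uv2 Dy yu => //; rewrite sqnN.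
move=> /negP; rewrite -ltNge lter_normr => /orP[xu|]; first exact: main.
rewrite -dotNl => /(main _ (unit_diskN Dx)).
by rewrite /strip /= dotNl normrN.
Qed.

Lemma polygon_cons (R : realType) (v : R * R) vs :
  polygon (v :: vs) = strip v `&` polygon vs.
Proof.
apply/seteqP; split => [x H|x [xv H] w].
  by split; [apply: H; rewrite mem_head | move=> w wvs; apply: H; rewrite inE wvs orbT].
by rewrite inE => /orP[/eqP -> //|]; exact: H.
Qed.

Lemma polygon_nil (R : realType) : polygon [::] = setT :> set (R * R).
Proof. by apply/seteqP; split. Qed.

Lemma eq_polygon (R : realType) (us vs : seq (R * R)) : us =i vs -> polygon us = polygon vs.
Proof. by move=> uv; apply/seteqP; split => x H v; [rewrite -uv|rewrite uv]; exact: H. Qed.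

Lemma measurable_polygon (R : realType) (vs : seq (R * R)) :
  measurable (polygon vs : set (plane R)).
Proof.
elim: vs => [|v vs IH]; first by rewrite polygon_nil.
by rewrite polygon_cons; apply: measurableI => //; exact: measurable_strip.
Qed.

Definition caps (R : realType) (v : R * R) : R := ar (@unit_disk R `\` strip v).

Definition ok (R : realType) (vs : seq (R * R)) : bool :=
  all (fun v => 1 <= sqn v) vs && pairwise (@pair_ok R) vs.

(** By disjointness each pair of caps lies inside the polygon of the remaining strips, so the cap
    areas can be subtracted one strip at a time. *)
Lemma ar_polygon (R : realType) (vs : seq (R * R)) : ok vs ->
  ar (@unit_disk R `&` polygon vs) = ar (@unit_disk R) - \sum_(v <- vs) caps v.
Proof.
elim: vs => [|v vs IH]; first by rewrite polygon_nil setIT big_nil subr0.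
rewrite /ok /= => /andP[/andP[v1 a1] /andP[pv p]].
have fDv := fmeasIl (fmeas_unit_disk R) (measurable_polygon vs).
have := ar_setD fDv (measurable_strip v).
rewrite big_cons polygon_cons (setIC (strip v)) setIA IH; last by rewrite /ok a1 p.
have -> : (@unit_disk R `&` polygon vs) `\` strip v = @unit_disk R `\` strip v.
  apply/seteqP; split => [x [[Dx _] xv]|x [Dx xv]]; first by split.
  split; last exact: xv.
  split; first exact: Dx.
  move=> w wvs; exact: caps_disjoint v1 (allP a1 w wvs) (allP pv w wvs) Dx xv.
rewrite -/(caps v); lra.
Qed.

Lemma pairwise_rem (T : eqType) (r : rel T) (s : seq T) (x : T) :
  symmetric r -> pairwise r s -> x \in s ->
  all (r x) (rem x s) /\ pairwise r (rem x s).
Proof.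
move=> rC; elim: s => //= y s IH /andP[ys ps]; rewrite inE eq_sym.
case: eqVneq => [<- _|xy /= xs]; first by [].
have [a p] := IH ps xs.
have yr : all (r y) (rem x s) by apply/allP => z /mem_rem zs; exact: (allP ys z zs).
by rewrite /= a p yr rC (allP ys x xs).
Qed.

Lemma perm_pairwise_sym (T : eqType) (r : rel T) (s t : seq T) :
  symmetric r -> perm_eq s t -> pairwise r s = pairwise r t.
Proof.
move=> rC; suff H s' t' : perm_eq s' t' -> pairwise r s' -> pairwise r t'.
  by move=> st; apply/idP/idP; apply: H => //; rewrite perm_sym.
elim: t' s' => [|x t' IH] s' st ps; first by [].
have xs : x \in s' by rewrite (perm_mem st) mem_head.
have [a p] := pairwise_rem rC ps xs.
have st' : perm_eq (rem x s') t'.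
  by rewrite -(perm_cons x) (perm_trans _ st) // perm_sym perm_to_rem.
by rewrite /= (IH _ st' p) -(perm_all _ st') a.
Qed.

Lemma not_pairwiseP (T : eqType) (r : rel T) (s : seq T) : ~~ pairwise r s ->
  exists x y t, perm_eq s [:: x, y & t] /\ ~~ r x y.
Proof.
elim: s => //= x s IH; rewrite negb_and => /orP[/allPn[y ys nr]|/IH[y [z [t [st nr]]]]].
  by exists x, y, (rem y s); split; [rewrite perm_cons perm_to_rem|].
exists y, z, (x :: t); split => //.
rewrite (perm_trans (_ : perm_eq _ (x :: [:: y, z & t]))) ?perm_cons //.
by rewrite (perm_catCA [:: x] [:: y; z] t).
Qed.

(** The transpose of an orthogonal matrix is orthogonal. This is what allows [sqn x] to be expanded
    in an orthonormal basis V, W. *)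
Lemma orthonormal_dual (R : realType) (p q e f : R) :
  p ^+ 2 + q ^+ 2 = 1 -> e ^+ 2 + f ^+ 2 = 1 -> p * e + q * f = 0 ->
  [/\ p ^+ 2 + e ^+ 2 = 1, q ^+ 2 + f ^+ 2 = 1 & p * q + e * f = 0].
Proof.
move=> h1 h2 h3.
have pe : p ^+ 2 + e ^+ 2 = 1.
  have : (p * e) ^+ 2 = (q * f) ^+ 2 by rewrite (_ : p * e = - (q * f)) ?sqrrN //; lra.
  rewrite !exprMn (_ : q ^+ 2 = 1 - p ^+ 2); last by lra.
  rewrite (_ : f ^+ 2 = 1 - e ^+ 2); last by lra.
  lra.
split => //; first by lra.
apply/eqP; rewrite -sqrf_eq0; apply/eqP.
have -> : (p * q + e * f) ^+ 2 = p ^+ 2 * q ^+ 2 + e ^+ 2 * f ^+ 2 + 2 * (p * e) * (q * f) by ring.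
rewrite (_ : p * e = - (q * f)); last by lra.
rewrite (_ : q ^+ 2 = 1 - p ^+ 2); last by lra.
rewrite (_ : 2 * - (q * f) * (q * f) = - 2 * q ^+ 2 * f ^+ 2); last by ring.
rewrite (_ : q ^+ 2 = 1 - p ^+ 2); last by lra.
rewrite (_ : e ^+ 2 = 1 - p ^+ 2); last by lra.
rewrite (_ : f ^+ 2 = p ^+ 2); last by lra.
ring.
Qed.

(** * Merging two strips whose caps touch *)

(** The poles V + r W and V - s W belong to two chords with the common end V, where W is a unit
    tangent to the circle. The value is the pole of the chord joining their two other ends. *)
Definition merge (R : realType) (r s : R) (V W : R * R) : R * R :=
  (((1 + r * s) * V.1 + (r - s) * W.1) / (1 - r * s),
   ((1 + r * s) * V.2 + (r - s) * W.2) / (1 - r * s)).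

(** The three linear forms are the sides of a triangle inscribed in the circle. A conic through the
    vertices of a triangle is a combination of the pairwise products of its sides, and here the
    coefficients are positive. *)
Lemma merge_disk (R : realType) (a b r s : R) : 0 < r -> 0 < s -> r * s < 1 ->
  a + r * b <= 1 -> a - s * b <= 1 -> 1 - r * s <= (1 + r * s) * a + (r - s) * b ->
  a ^+ 2 + b ^+ 2 <= 1.
Proof.
move=> r0 s0 rs h1 h2 h3.
rewrite -subr_ge0 (_ : 1 - (a ^+ 2 + b ^+ 2) =
  (1 - a - r * b) * (1 - a + s * b) / (r * s) +
  (1 - a - r * b) * ((1 + r * s) * a + (r - s) * b - (1 - r * s)) / (r * (r + s)) +
  (1 - a + s * b) * ((1 + r * s) * a + (r - s) * b - (1 - r * s)) / (s * (r + s))); last first.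
  by field; rewrite !gt_eqF // addr_gt0.
have a1 : 0 <= 1 - a - r * b by lra.
have a2 : 0 <= 1 - a + s * b by lra.
have a3 : 0 <= (1 + r * s) * a + (r - s) * b - (1 - r * s) by lra.
have r1 := ltW r0; have s1 := ltW s0.
by rewrite !addr_ge0 // divr_ge0 ?mulr_ge0 // addr_ge0.
Qed.

(** The three lines meet at the outer end of the chord a + r b = 1: this chord, the merged chord and
    the tangent to the circle there. The first is the combination of the other two with weights r /
    (r + s) and s / (r + s). *)
Lemma merge_cap (R : realType) (a b r s : R) : 0 < r -> 0 < s -> r * s < 1 ->
  a ^+ 2 + b ^+ 2 <= 1 -> (1 + r * s) * a + (r - s) * b <= 1 - r * s ->
  a + r * b <= 1.
Proof.
move=> r0 s0 rs ab h; rewrite leNgt; apply/negP => h1.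
(* The disk lies on one side of its tangent at ((1 - r^2) / (1 + r^2), 2 r / (1 + r^2)), by
   Cauchy-Schwarz. *)
have c : (1 - r ^+ 2) * a + 2 * r * b <= 1 + r ^+ 2.
  apply: (@le_trans _ _ `|(1 - r ^+ 2) * a + 2 * r * b|); first exact: ler_norm.
  have k0 : 0 <= 1 + r ^+ 2 by rewrite addr_ge0 // sqr_ge0.
  rewrite -(ger0_norm k0) -ler_sqr ?nnegrE ?normr_ge0 // !real_normK ?num_real //.
  have := sqr_ge0 ((1 - r ^+ 2) * b - 2 * r * a).
  have : (1 + r ^+ 2) ^+ 2 * (a ^+ 2 + b ^+ 2) <= (1 + r ^+ 2) ^+ 2 * 1.
    by rewrite ler_wpM2l // sqr_ge0.
  rewrite (_ : (1 + r ^+ 2) ^+ 2 * (a ^+ 2 + b ^+ 2) =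
   ((1 - r ^+ 2) * a + 2 * r * b) ^+ 2 + ((1 - r ^+ 2) * b - 2 * r * a) ^+ 2); last by ring.
  lra.
have : (r + s) * 1 < (r + s) * (a + r * b) by rewrite ltr_pM2l // addr_gt0.
have : s * ((1 - r ^+ 2) * a + 2 * r * b) <= s * (1 + r ^+ 2) by rewrite ler_pM2l.
have : r * ((1 + r * s) * a + (r - s) * b) <= r * (1 - r * s) by rewrite ler_pM2l.
lra.
Qed.

(* With [x = 1 - a] and [S = b + t], the circle equation [a^2 + b^2 = 1 + t^2]
   makes [S] times the slack equal to [(x - r S) (S + s (2 - x))]. *)
Lemma merge_pair1 (R : realType) (a b r s t : R) : 0 < r -> 0 < s ->
  a ^+ 2 + b ^+ 2 = 1 + t ^+ 2 -> 0 < b + t ->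
  a + r * b + r * t <= 1 -> - (a - s * b) + s * t <= 1 ->
  (1 + r * s) * a + (r - s) * b + (r + s) * t <= 1 - r * s.
Proof.
move=> r0 s0 c S0 h1 h2.
have x1 : 0 <= (1 - a) - r * (b + t) by lra.
have x2 : 0 <= (b + t) + s * (2 - (1 - a)).
  have /ltW S1 := S0.
  have : s * (s * (b + t)) <= s * (2 - (1 - a)) by rewrite ler_pM2l //; lra.
  have : 0 <= s * (s * (b + t)) by rewrite !mulr_ge0 // ltW.
  lra.
have := mulr_ge0 x1 x2.
rewrite [X in 0 <= X](_ : _ = (b + t) * (1 - r * s - ((1 + r * s) * a + (r - s) * b + (r + s) * t)) +
   s * (1 + t ^+ 2 - (a ^+ 2 + b ^+ 2))); last by ring.
rewrite c subrr mulr0 addr0 pmulr_rge0 // => h; lra.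
Qed.

(** Here (a, b) are the coordinates of a third pole in the basis V, W, and t is its [rr]. Central
    symmetry disposes of the absolute value in the conclusion. *)
Lemma merge_pair (R : realType) (a b r s t : R) : 0 < r -> 0 < s -> 0 < t ->
  a ^+ 2 + b ^+ 2 = 1 + t ^+ 2 ->
  `|a + r * b| + r * t <= 1 -> `|a - s * b| + s * t <= 1 ->
  `|(1 + r * s) * a + (r - s) * b| + (r + s) * t <= 1 - r * s.
Proof.
move=> r0 s0 t0.
suff main a' b' : a' ^+ 2 + b' ^+ 2 = 1 + t ^+ 2 ->
  `|a' + r * b'| + r * t <= 1 -> `|a' - s * b'| + s * t <= 1 ->
  (1 + r * s) * a' + (r - s) * b' + (r + s) * t <= 1 - r * s.
  move=> c h1 h2; have m1 := main a b c h1 h2.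
  have := main (- a) (- b).
  rewrite !sqrrN (_ : - a + r * - b = - (a + r * b)); last by ring.
  rewrite (_ : - a - s * - b = - (a - s * b)); last by ring.
  rewrite !normrN => /(_ c h1 h2) m2.
  by rewrite -lerBrDr ler_norml; apply/andP; split; lra.
move=> c h1 h2.
have := ler_norm (a' + r * b'); have := ler_norm (- (a' + r * b')).
have := ler_norm (a' - s * b'); have := ler_norm (- (a' - s * b')).
rewrite !normrN => k1 k2 k3 k4.
have [S0|S0] := ltP 0 (b' + t); first by apply: merge_pair1 => //; lra.
(* If b' + t <= 0 then - b' + t > 0, so the reflected configuration, in which r and s are exchanged,
   satisfies the sign condition. *)
have := @merge_pair1 _ a' (- b') s r t s0 r0.
rewrite sqrrN => H.
have : (1 + s * r) * a' + (s - r) * (- b') + (s + r) * t <= 1 - s * r by apply: H => //; lra.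
lra.
Qed.

Section Merge.
Variables (R : realType) (r s : R) (V W : R * R).
Hypotheses (r0 : 0 < r) (s0 : 0 < s) (rs : r * s < 1).
Hypotheses (V1 : sqn V = 1) (W1 : sqn W = 1) (VW : dot V W = 0).

Let u : R * R := (V.1 + r * W.1, V.2 + r * W.2).
Let w : R * R := (V.1 - s * W.1, V.2 - s * W.2).
Let v := merge r s V W.
Let d0 : 0 < 1 - r * s. Proof. by rewrite subr_gt0. Qed.

Let sqn_comb a b : sqn (a * V.1 + b * W.1, a * V.2 + b * W.2) = a ^+ 2 + b ^+ 2.
Proof.
transitivity (a ^+ 2 * sqn V + b ^+ 2 * sqn W + 2 * a * b * dot V W).
  by rewrite /sqn /dot /=; ring.
by rewrite V1 W1 VW; ring.
Qed.

Let sqn_dot x : sqn x = dot x V ^+ 2 + dot x W ^+ 2.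
Proof.
have [h1 h2 h3] := orthonormal_dual V1 W1 VW.
transitivity (x.1 ^+ 2 * (V.1 ^+ 2 + W.1 ^+ 2) + x.2 ^+ 2 * (V.2 ^+ 2 + W.2 ^+ 2) +
  2 * x.1 * x.2 * (V.1 * V.2 + W.1 * W.2)).
  by rewrite h1 h2 h3 /sqn; ring.
by rewrite /dot; ring.
Qed.

Let dot_u x : dot x u = dot x V + r * dot x W.
Proof. by rewrite /dot /u /=; ring. Qed.

Let dot_w x : dot x w = dot x V - s * dot x W.
Proof. by rewrite /dot /w /=; ring. Qed.

Let dot_v x : dot x v = ((1 + r * s) * dot x V + (r - s) * dot x W) / (1 - r * s).
Proof. by rewrite /dot /v /merge /=; field; rewrite gt_eqF. Qed.

Let sqn_u : sqn u = 1 + r ^+ 2.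
Proof. by have := sqn_comb 1 r; rewrite !mul1r expr1n. Qed.

Let sqn_w : sqn w = 1 + s ^+ 2.
Proof. by have := sqn_comb 1 (- s); rewrite !mul1r expr1n sqrrN !mulNr. Qed.

Let rr_of (v' : R * R) (k : R) : 0 <= k -> sqn v' = 1 + k ^+ 2 -> rr v' = k.
Proof. by move=> k0 h; rewrite /rr h addrAC subrr add0r sqrtr_sqr ger0_norm. Qed.

Lemma sqn_merge : sqn v = 1 + ((r + s) / (1 - r * s)) ^+ 2.
Proof.
have := sqn_comb ((1 + r * s) / (1 - r * s)) ((r - s) / (1 - r * s)).
rewrite (_ : (_, _) = v); last by rewrite /v /merge; congr (_, _); field; rewrite gt_eqF.
by move=> ->; field; rewrite gt_eqF.
Qed.

(** The half-angles of the two caps add up: this is the addition formula of the tangent. *)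
Lemma rr_merge : rr v = (r + s) / (1 - r * s).
Proof.
have k0 : 0 <= (r + s) / (1 - r * s) by rewrite ltW // divr_gt0 // addr_gt0.
exact: rr_of k0 sqn_merge.
Qed.

(** Up to sign such a point lies in the triangle formed by the three chords, whose vertices are on
    the circle. *)
Lemma merge_cover x : strip u x -> strip w x -> ~ strip v x -> unit_disk x.
Proof.
suff main y : strip u y -> strip w y -> 1 < dot y v -> unit_disk y.
  move=> ux wx /negP; rewrite -ltNge lter_normr => /orP[|]; first exact: main.
  rewrite -dotNl => h; have -> : x = - - x by rewrite opprK.
  by apply: unit_diskN; apply: main h; rewrite /strip /= dotNl normrN.
rewrite /strip /= dot_u dot_w dot_v ltr_pdivlMr // mul1r => hu hw hv.
rewrite /unit_disk /= -/(sqn y) sqn_dot.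
exact: (merge_disk r0 s0 rs (le_trans (ler_norm _) hu) (le_trans (ler_norm _) hw) (ltW hv)).
Qed.

Lemma merge_inside x : unit_disk x -> strip v x -> strip u x /\ strip w x.
Proof.
suff main y : unit_disk y -> dot y v <= 1 -> dot y u <= 1 /\ dot y w <= 1.
  move=> Dx; rewrite /strip /= !ler_norml !(lerNl 1) -!dotNl => /andP[h1 h2].
  have [-> ->] := main _ (unit_diskN Dx) h1.
  by have [-> ->] := main _ Dx h2.
rewrite /unit_disk /= -/(sqn y) sqn_dot dot_u dot_w dot_v ler_pdivrMr // mul1r => Dy hv.
split; first exact: merge_cap hv.
rewrite -mulrN; apply: (@merge_cap _ _ _ s r) => //; first by rewrite mulrC.
  by rewrite sqrrN.
by rewrite mulrN; lra.
Qed.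

(** For a gap from angle a to angle b, 4 [hh] is sin(2b) - sin(2a), and the contributions of the
    common end cancel. The proof verifies the equivalent rational identity in r, s, V and W. *)
Lemma hh_merge : hh v = hh u + hh w.
Proof.
have [h1 h2 h3] := orthonormal_dual V1 W1 VW.
rewrite /hh rr_merge sqn_merge (rr_of (ltW r0) sqn_u) (rr_of (ltW s0) sqn_w) sqn_u sqn_w.
set Y := V.1 * W.1 - V.2 * W.2; set X := V.1 ^+ 2 - V.2 ^+ 2.
have WX : W.1 ^+ 2 - W.2 ^+ 2 = - X.
  by rewrite /X; move: V1 W1; rewrite /sqn => k1 k2; lra.
have E a b : (a * V.1 + b * W.1) ^+ 2 - (a * V.2 + b * W.2) ^+ 2 =
    (a ^+ 2 - b ^+ 2) * X + 2 * a * b * Y.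
  transitivity (a ^+ 2 * X + b ^+ 2 * (W.1 ^+ 2 - W.2 ^+ 2) + 2 * a * b * Y).
    by rewrite /X /Y; ring.
  by rewrite WX; ring.
have -> : u.1 ^+ 2 - u.2 ^+ 2 = (1 - r ^+ 2) * X + 2 * r * Y.
  by have := E 1 r; rewrite !mul1r expr1n mulr1.
have -> : w.1 ^+ 2 - w.2 ^+ 2 = (1 - s ^+ 2) * X - 2 * s * Y.
  by have := E 1 (- s); rewrite !mul1r expr1n mulr1 sqrrN !mulNr mulrN !mulNr.
have -> : v.1 ^+ 2 - v.2 ^+ 2 =
   (((1 + r * s) ^+ 2 - (r - s) ^+ 2) * X + 2 * (1 + r * s) * (r - s) * Y) / (1 - r * s) ^+ 2.
  by rewrite -E /v /merge /=; field; rewrite gt_eqF.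
field.
have sq (k : R) : 1 + k ^+ 2 != 0 by rewrite gt_eqF // ltr_wpDr // sqr_ge0.
have nz : (1 - r * s) ^+ 2 + (r + s) ^+ 2 != 0.
  rewrite (_ : _ + _ = (1 + r ^+ 2) * (1 + s ^+ 2)); last by ring.
  by rewrite mulf_neq0.
by rewrite ?nz ?sq ?(gt_eqF d0) /= ?nz ?sq.
Qed.

Lemma pair_ok_merge k : 1 < sqn k -> pair_ok u k -> pair_ok w k -> pair_ok v k.
Proof.
move=> k1; rewrite /pair_ok !(dotC _ k) dot_u dot_w dot_v rr_merge.
rewrite (rr_of (ltW r0) sqn_u) (rr_of (ltW s0) sqn_w) => hu hw.
rewrite normrM normfV (gtr0_norm d0) mulrAC -mulrDl ler_pdivrMr // mul1r.
apply: merge_pair => //; first by rewrite rr_gt0.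
by rewrite -sqn_dot sqr_rr ?ltW // addrC subrK.
Qed.

End Merge.

Lemma merge_exists (R : realType) (u w : R * R) :
  1 < sqn u -> 1 < sqn w -> pair_ok u w -> ~~ pair_lt u w -> rr u * rr w < 1 ->
  exists v, [/\ 1 <= sqn v,
    forall x, strip u x -> strip w x -> ~ strip v x -> unit_disk x,
    forall x, unit_disk x -> strip v x -> strip u x /\ strip w x,
    hh v = hh u + hh w &
    forall k, 1 < sqn k -> pair_ok u k -> pair_ok w k -> pair_ok v k].
Proof.
(* The poles [w] and [- w] have the same strip; the sign is chosen so that it is the caps of [u] and
   [w] themselves that touch. *)
move=> u1; wlog d0 : w / 0 <= dot u w.
  move=> wl w1 uw nuw rs; have [d0|/ltW d0] := leP 0 (dot u w); first exact: wl.
  have [|||||v [v1 v2 v3 v4 v5]] := wl (- w).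
  - by rewrite dotNr oppr_ge0.
  - by rewrite sqnN.
  - by rewrite pair_okNr.
  - by rewrite /pair_lt dotNr normrN rrN.
  - by rewrite rrN.
  exists v; split => //.
  - by move=> x; rewrite -(stripN w); exact: v2.
  - by move=> x; rewrite -(stripN w); exact: v3.
  - by rewrite -(hhN w).
  - by move=> k k1 uk wk; apply: v5 => //; rewrite pair_okC pair_okNr pair_okC.
move=> w1; rewrite /pair_ok /pair_lt (ger0_norm d0) -leNgt => h1 h2 rs.
have r0 : 0 < rr u by rewrite rr_gt0.
have s0 : 0 < rr w by rewrite rr_gt0.
have ru := sqr_rr (ltW u1); have rw := sqr_rr (ltW w1).
set r := rr u in r0 rs ru h1 h2; set s := rr w in s0 rs rw h1 h2.
have dE : dot u w = 1 - r * s by lra.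
have uE : sqn u = 1 + r ^+ 2 by rewrite ru addrC subrK.
have wE : sqn w = 1 + s ^+ 2 by rewrite rw addrC subrK.
have rsn : r + s != 0 by rewrite gt_eqF // addr_gt0.
(* [V] and [W] solve u = V + r W and w = V - s W; they are orthonormal exactly because dot u w = 1 -
   r s. *)
pose V := ((s * u.1 + r * w.1) / (r + s), (s * u.2 + r * w.2) / (r + s)).
pose W := ((u.1 - w.1) / (r + s), (u.2 - w.2) / (r + s)).
have V1 : sqn V = 1.
  transitivity ((s ^+ 2 * sqn u + r ^+ 2 * sqn w + 2 * r * s * dot u w) / (r + s) ^+ 2).
    by rewrite /V /sqn /dot /=; field.
  by rewrite dE uE wE; field.
have W1 : sqn W = 1.
  transitivity ((sqn u + sqn w - 2 * dot u w) / (r + s) ^+ 2).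
    by rewrite /W /sqn /dot /=; field.
  by rewrite dE uE wE; field.
have VW : dot V W = 0.
  transitivity ((s * sqn u - r * sqn w + (r - s) * dot u w) / (r + s) ^+ 2).
    by rewrite /V /W /sqn /dot /=; field.
  by rewrite dE uE wE; field.
have uVW : u = (V.1 + r * W.1, V.2 + r * W.2).
  by rewrite [LHS]surjective_pairing; congr (_, _); rewrite /V /W /=; field.
have wVW : w = (V.1 - s * W.1, V.2 - s * W.2).
  by rewrite [LHS]surjective_pairing; congr (_, _); rewrite /V /W /=; field.
exists (merge r s V W); split.
- by rewrite (sqn_merge rs V1 W1 VW) lerDl sqr_ge0.
- by rewrite uVW wVW => x; exact: (merge_cover r0 s0 rs V1 W1 VW).
- by rewrite uVW wVW => x; exact: (merge_inside r0 s0 rs V1 W1 VW).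
- by rewrite uVW wVW; exact: (hh_merge r0 s0 rs V1 W1 VW).
- by rewrite uVW wVW => k; exact: (pair_ok_merge r0 s0 rs V1 W1 VW).
Qed.

(** * The area of the polygon along the hyperbolic flow *)

Definition flow (R : realType) (s : R) (v : R * R) : R * R :=
  (expR s * v.1, expR (- s) * v.2).

Lemma flow0 (R : realType) (v : R * R) : flow 0 v = v.
Proof. by rewrite /flow oppr0 expR0 !mul1r -surjective_pairing. Qed.

Lemma flowD (R : realType) (s t : R) (v : R * R) : flow (s + t) v = flow s (flow t v).
Proof. by rewrite /flow opprD !expRD /= !mulrA. Qed.

Lemma map_flow0 (R : realType) (vs : seq (R * R)) : map (flow 0) vs = vs.
Proof. by rewrite -[RHS]map_id; apply: eq_map => v; exact: flow0. Qed.

Lemma map_flowD (R : realType) (s t : R) (vs : seq (R * R)) :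
  map (flow (s + t)) vs = map (flow s) (map (flow t) vs).
Proof. by rewrite -map_comp; apply: eq_map => v; exact: flowD. Qed.

(** The matrix of the flow is symmetric, so moving the poles amounts to pulling back the polygon. *)
Lemma dot_flow (R : realType) (s : R) (x v : R * R) : dot x (flow s v) = dot (flow s x) v.
Proof. by rewrite /dot /flow /=; ring. Qed.

Lemma polygon_flow (R : realType) (s : R) (vs : seq (R * R)) :
  polygon (map (flow s) vs) = [set x | polygon vs (flow s x)].
Proof.
apply/seteqP; split => x H.
  by move=> v vvs; have := H (flow s v) (map_f _ vvs); rewrite /strip /= dot_flow.
by move=> _ /mapP[v vvs ->]; have := H v vvs; rewrite /strip /= dot_flow.
Qed.

Lemma expR_invol (R : realType) (s : R) : expR s * expR (- s) = 1.
Proof. by rewrite -expRD subrr expR0. Qed.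

Lemma flow_det (R : realType) (s : R) : `|expR s * expR (- s) - 0 * 0| = 1 :> R.
Proof. by rewrite expR_invol mulr0 subr0 normr1. Qed.

Lemma measurable_flow (R : realType) (s : R) (A : set (plane R)) : measurable A ->
  measurable ([set x | A (flow s x)] : set (plane R)).
Proof.
move=> mA; have := @measurable_linear_preimage R (expR s) 0 0 (expR (- s)) A mA.
by congr measurable; apply/seteqP; split => p /=; rewrite !mul0r addr0 add0r.
Qed.

Lemma area_flow (R : realType) (s : R) (A : set (plane R)) : measurable A ->
  area [set x | A (flow s x)] = area A.
Proof.
move=> mA; rewrite -[RHS](area_linear (flow_det s) mA); congr area.
by apply/seteqP; split => p /=; rewrite !mul0r addr0 add0r.
Qed.

Lemma ar_flow (R : realType) (s : R) (A : set (plane R)) : measurable A ->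
  ar [set x | A (flow s x)] = ar A.
Proof. by move=> mA; rewrite !arE area_flow. Qed.

(** As the flow preserves area, this is also the area in which the ellipse [flow s] D meets the
    fixed polygon of [vs]. *)
Definition FF (R : realType) (vs : seq (R * R)) (s : R) : R :=
  ar (@unit_disk R `&` polygon (map (flow s) vs)).

Lemma FF_0 (R : realType) (vs : seq (R * R)) : FF vs 0 = ar (@unit_disk R `&` polygon vs).
Proof. by rewrite /FF map_flow0. Qed.

Lemma fmeas_FF (R : realType) (vs : seq (R * R)) (s : R) :
  fmeas (@unit_disk R `&` polygon (map (flow s) vs)).
Proof. exact: fmeasIl (fmeas_unit_disk R) (measurable_polygon _). Qed.

(** The part of the larger polygon outside the smaller one lies in the disk, so it counts fully at
    time 0. Later it has the same total area, but some of it may leave the disk. *)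
Lemma FF_replace (R : realType) (us vs : seq (R * R)) (s : R) :
  polygon us `\` polygon vs `<=` @unit_disk R ->
  @unit_disk R `&` polygon vs `<=` polygon us ->
  FF us s - FF us 0 <= FF vs s - FF vs 0.
Proof.
move=> h1 h2; rewrite !FF_0.
have fU := fmeasIl (fmeas_unit_disk R) (measurable_polygon us).
have mus := measurable_polygon us; have mvs := measurable_polygon vs.
have fD : fmeas (polygon us `\` polygon vs).
  by apply: fmeas_sub (fmeas_unit_disk R) h1; exact: measurableD.
have -> : ar (@unit_disk R `&` polygon us) =
   ar (@unit_disk R `&` polygon vs) + ar (polygon us `\` polygon vs).
  rewrite (ar_setD fU mvs); congr (ar _ + ar _); apply/seteqP; split => x.
  - by case=> -[].
  - by move=> [Dx vx]; split => //; split => //; exact: h2.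
  - by case=> -[].
  - by move=> [ux vx]; split => //; split => //; exact: h1.
suff : FF us s <= FF vs s + ar (polygon us `\` polygon vs) by lra.
have fD' : fmeas [set x | (polygon us `\` polygon vs) (flow s x)].
  split; first exact: measurable_flow fD.1.
  by rewrite area_flow; [exact: fD.2|exact: fD.1].
rewrite -(ar_flow s fD.1); apply: le_trans (ar_setU_le (fmeas_FF vs s) fD').
apply: le_ar; [exact: (fmeas_FF _ _).1|exact: fmeasU (fmeas_FF vs s) fD'|].
rewrite !polygon_flow => x [Dx ux].
by have [vx|vx] := pselect (polygon vs (flow s x)); [left|right].
Qed.

Lemma FF_perm (R : realType) (us vs : seq (R * R)) s : perm_eq us vs -> FF us s = FF vs s.
Proof.
by move=> p; rewrite /FF (@eq_polygon _ (map (flow s) us) (map (flow s) vs)) //;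
  exact: perm_mem (perm_map _ p).
Qed.

Lemma ok_perm (R : realType) (us vs : seq (R * R)) : perm_eq us vs -> ok us = ok vs.
Proof.
by move=> p; rewrite /ok (perm_all _ p) (perm_pairwise_sym (@pair_okC R) p).
Qed.

(** * Derivatives along the flow *)

Definition XX (R : realType) (v : R * R) : R := v.1 ^+ 2 - v.2 ^+ 2.

Lemma is_derive_flow1 (R : realType) (v : R * R) (s : R) :
  is_derive s 1 (fun s => (flow s v).1) (flow s v).1.
Proof.
apply: (is_derive_eq (is_deriveM (is_derive_expR s) (is_derive_cst v.1 s 1))).
by rewrite scaler0 add0r /= /GRing.scale /= mulrC.
Qed.

Lemma is_derive_flow2 (R : realType) (v : R * R) (s : R) :
  is_derive s 1 (fun s => (flow s v).2) (- (flow s v).2).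
Proof.
have h := @is_derive1_comp R expR -%R s _ _ (is_derive_expR (- s)) (is_deriveNid s 1).
apply: (is_derive_eq (is_deriveM h (is_derive_cst v.2 s 1))).
by rewrite scaler0 add0r /= /GRing.scale /=; ring.
Qed.

Lemma is_derive_sqn (R : realType) (v : R * R) (s : R) :
  is_derive s 1 (fun s => sqn (flow s v)) (2 * XX (flow s v)).
Proof.
have h1 := is_derive_flow1 v s; have h2 := is_derive_flow2 v s.
apply: (is_derive_eq (is_deriveD (is_deriveX 2 h1) (is_deriveX 2 h2))).
by rewrite /XX /GRing.scale /=; ring.
Qed.

(** [sqn] and [XX] are the sum and the difference of terms proportional to exp(2s) and exp(-2s), so
    each is half the derivative of the other. *)
Lemma is_derive_XX (R : realType) (v : R * R) (s : R) :
  is_derive s 1 (fun s => XX (flow s v)) (2 * sqn (flow s v)).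
Proof.
have h1 := is_derive_flow1 v s; have h2 := is_derive_flow2 v s.
apply: (is_derive_eq (is_deriveB (is_deriveX 2 h1) (is_deriveX 2 h2))).
by rewrite /sqn /GRing.scale /=; ring.
Qed.

Lemma is_derive_rr (R : realType) (v : R * R) (s : R) : 1 < sqn (flow s v) ->
  is_derive s 1 (fun s => rr (flow s v)) (XX (flow s v) / rr (flow s v)).
Proof.
move=> h; have h0 : 0 < sqn (flow s v) - 1 by rewrite subr_gt0.
have h1 : is_derive s 1 (fun s => sqn (flow s v) - 1) (2 * XX (flow s v)).
  apply: (is_derive_eq (is_deriveB (is_derive_sqn v s) (is_derive_cst (1 : R) s 1))).
  by rewrite subr0.
apply: (is_derive_eq (@is_derive1_comp R Num.sqrt _ s _ _ (is_derive1_sqrt h0) h1)).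
rewrite -/(rr (flow s v)).
have : rr (flow s v) != 0 by rewrite gt_eqF // rr_gt0.
by move=> r0; field.
Qed.

(** The quotient XX / sqn is the cosine of twice the argument of [v]. Only the last term can be
    negative, and only if [rr v] > 1. *)
Definition dhh (R : realType) (v : R * R) : R :=
  2 * rr v / sqn v * (1 - (XX v / sqn v) ^+ 2) +
  (XX v / sqn v) ^+ 2 * (1 - rr v ^+ 2) / (rr v * sqn v).

Lemma is_derive_hh (R : realType) (v : R * R) (s : R) : 1 < sqn (flow s v) ->
  is_derive s 1 (fun s => hh (flow s v)) (dhh (flow s v)).
Proof.
move=> h; have n0 : sqn (flow s v) != 0 by rewrite gt_eqF // (lt_trans ltr01).
have r0 : rr (flow s v) != 0 by rewrite gt_eqF // rr_gt0.
have hn := is_deriveX 2 (is_derive_sqn v s).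
have n2 : sqn (flow s v) ^+ 2 != 0 by rewrite expf_neq0.
have hv := @is_deriveV R (fun s => sqn (flow s v) ^+ 2) s _ 1 n2 hn.
apply: (is_derive_eq (is_deriveM (is_deriveM (is_derive_rr h) (is_derive_XX v s)) hv)).
have := sqr_rr (ltW h); rewrite /dhh /GRing.scale /=.
rewrite -[((fun t : R => rr (flow t v)) * (fun t : R => XX (flow t v))) s]
  /(rr (flow s v) * XX (flow s v)).
move: (rr _) (sqn _) (XX _) r0 n0 => r n X r0 n0 E.
have -> : n = 1 + r ^+ 2 by rewrite E addrC subrK.
have n1 : 1 + r ^+ 2 != 0 by rewrite E addrC subrK.
by field; rewrite n1 r0.
Qed.

Lemma is_derive_caps (R : realType) (v : R * R) (s : R) : 1 < sqn (flow s v) ->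
  is_derive s 1 (fun s => 2 * halfcap (Num.sqrt (sqn (flow s v)))^-1) (4 * hh (flow s v)).
Proof.
move=> h; have h0 : 0 < sqn (flow s v) by exact: lt_trans ltr01 h.
set n := Num.sqrt (sqn (flow s v)).
have n0 : 0 < n by rewrite sqrtr_gt0.
have hs := @is_derive1_comp R Num.sqrt _ s _ _ (is_derive1_sqrt h0) (is_derive_sqn v s).
have hv := @is_deriveV R (Num.sqrt \o (fun s => sqn (flow s v))) s _ 1 (lt0r_neq0 n0) hs.
have ni0 : 0 < n^-1 by rewrite invr_gt0.
have hc := @is_derive1_comp R (@halfcap R) (fun y => ((Num.sqrt \o (fun s => sqn (flow s v))) y)^-1)
  s _ _ (is_derive_halfcap ni0) hv.
apply: (is_derive_eq (is_deriveM (is_derive_cst (2 : R) s 1) hc)).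
rewrite scaler0 addr0 /GRing.scale /= -/n /hh.
have -> : Num.sqrt (1 - n^-1 ^+ 2) = rr (flow s v) / n.
  have -> : 1 - n^-1 ^+ 2 = (sqn (flow s v) - 1) * (n^-1) ^+ 2.
    by rewrite -(sqr_sqrtr (ltW h0)) -/n; field; rewrite gt_eqF.
  by rewrite sqrtrM ?subr_ge0 ?ltW // sqrtr_sqr gtr0_norm.
rewrite -(sqr_sqrtr (ltW h0)) -/n /XX; field.
by rewrite gt_eqF.
Qed.

Lemma XX_le (R : realType) (v : R * R) : 1 < sqn v -> `|XX v / sqn v| <= 1.
Proof.
move=> v1; have v0 : 0 < sqn v by exact: lt_trans ltr01 v1.
rewrite normrM normfV (gtr0_norm v0) ler_pdivrMr // mul1r /XX /sqn.
by have := sqr_ge0 v.1; have := sqr_ge0 v.2; rewrite ler_norml => *; apply/andP; split; lra.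
Qed.

Lemma hhE (R : realType) (v : R * R) : 1 < sqn v ->
  hh v = rr v / sqn v * (XX v / sqn v).
Proof.
move=> v1; have v0 : 0 < sqn v by exact: lt_trans ltr01 v1.
by rewrite /hh -/(XX v); field; rewrite gt_eqF.
Qed.

Lemma dhhE (R : realType) (v : R * R) : 1 < sqn v ->
  dhh v = rr v / sqn v * (2 * (1 - (XX v / sqn v) ^+ 2) +
    (XX v / sqn v) ^+ 2 * ((1 - rr v ^+ 2) / rr v ^+ 2)).
Proof.
move=> v1; have v0 : 0 < sqn v by exact: lt_trans ltr01 v1.
rewrite /dhh; field; rewrite (gt_eqF v0) /= gt_eqF // rr_gt0 //.
Qed.

(** Divide by rr / sqn and let z = |XX / sqn| <= 1. Since (1 - rr^2) / rr^2 >= 1 - q, what remains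
    is at least 2 (1 - z^2) + (1 - q) (z^2 - z), which has the factor 1 - z. *)
Lemma dhh_hh_ge0 (R : realType) (v : R * R) (q l : R) : 1 < sqn v ->
  0 < q -> q <= 1 -> rr v ^+ 2 <= q -> `|l| <= 1 - q -> 0 <= dhh v + l * hh v.
Proof.
move=> v1 q0 q1 rq lq; rewrite (dhhE v1) (hhE v1).
have v0 : 0 < sqn v by exact: lt_trans ltr01 v1.
have r0 : 0 < rr v by rewrite rr_gt0.
have := XX_le v1; set y := XX v / sqn v => y1.
rewrite (mulrCA l) -mulrDr; apply: mulr_ge0; first by rewrite divr_ge0 ?ltW.
have r2 : 0 < rr v ^+ 2 by rewrite exprn_gt0.
have k1 : 1 - q <= (1 - rr v ^+ 2) / rr v ^+ 2.
  rewrite ler_pdivlMr //; have : (1 - q) * rr v ^+ 2 <= (1 - q) * 1.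
    by rewrite ler_wpM2l ?subr_ge0 // (le_trans rq).
  lra.
have k2 : y ^+ 2 * (1 - q) <= y ^+ 2 * ((1 - rr v ^+ 2) / rr v ^+ 2).
  by rewrite ler_wpM2l // sqr_ge0.
have k3 : - ((1 - q) * `|y|) <= l * y.
  have : `|l * y| <= (1 - q) * `|y| by rewrite normrM ler_wpM2r.
  by rewrite ler_norml => /andP[].
have yy : y ^+ 2 = `|y| ^+ 2 by rewrite real_normK ?num_real.
rewrite yy in k2 *; move: `|y| (normr_ge0 y) y1 k2 k3 => z z0 z1 k2 k3.
have : 0 <= (1 - z) * (2 + 2 * z - (1 - q) * z).
  rewrite mulr_ge0 ?subr_ge0 //.
  have : (1 - q) * z <= 1 * 1 by apply: ler_pM => //; lra.
  lra.
rewrite [X in 0 <= X](_ : _ = 2 * (1 - z ^+ 2) + z ^+ 2 * (1 - q) - (1 - q) * z); last by ring.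
lra.
Qed.

(** The multiplier of [hh] is chosen to cancel the last term of [dhh] exactly, leaving a multiple of
    1 - (XX / sqn)^2. *)
Lemma dhh_big (R : realType) (v : R * R) : 1 < sqn v -> 
  0 <= dhh v + XX v / sqn v * (1 - (rr v ^+ 2)^-1) * hh v.
Proof.
move=> v1; rewrite (dhhE v1) (hhE v1).
have v0 : 0 < sqn v by exact: lt_trans ltr01 v1.
have r0 : 0 < rr v by rewrite rr_gt0.
have := XX_le v1; set y := XX v / sqn v => y1.
rewrite (_ : _ + _ = rr v / sqn v * (2 * (1 - y ^+ 2))); last first.
  by field; rewrite (gt_eqF v0) gt_eqF.
apply: mulr_ge0; first by rewrite divr_ge0 ?ltW.
rewrite mulr_ge0 // subr_ge0.
by rewrite -real_normK ?num_real // exprn_ile1.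
Qed.

(* When some [rr v > 1], all the other values are at most [(rr v)^-1] by
   disjointness of the caps, and [dhh + l * hh] is nonnegative termwise for
   [l] of absolute value less than 1. *)
Lemma sum_dhh_gt (R : realType) (vs : seq (R * R)) :
  all (fun v => 1 < sqn v) vs -> pairwise (@pair_ok R) vs ->
  \sum_(v <- vs) hh v < 0 -> \sum_(v <- vs) hh v < \sum_(v <- vs) dhh v.
Proof.
move=> v1 p h0.
have [l l1 H] : exists2 l : R, `|l| < 1 &
    forall v, v \in vs -> 0 <= dhh v + l * hh v.
  have [small|] := boolP (all (fun v => rr v <= 1) vs).
    exists 0; first by rewrite normr0.
    move=> v vvs; apply: (dhh_hh_ge0 (q := 1)) => //; first exact: (allP v1).
      by rewrite exprn_ile1 ?rr_ge0 //; exact: (allP small).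
    by rewrite subrr normr0.
  move=> /allPn[w wvs]; rewrite -ltNge => r1.
  have [a _] := pairwise_rem (@pair_okC R) p wvs.
  have w1 := allP v1 w wvs.
  have r0 : 0 < rr w by exact: lt_trans ltr01 r1.
  have q1 : (rr w ^+ 2)^-1 < 1 by rewrite invf_lt1 ?exprn_gt0 // exprn_egt1.
  have q0 : 0 < (rr w ^+ 2)^-1 by rewrite invr_gt0 exprn_gt0.
  have lq : `|XX w / sqn w * (1 - (rr w ^+ 2)^-1)| <= 1 - (rr w ^+ 2)^-1.
    have q2 : 0 <= 1 - (rr w ^+ 2)^-1 by rewrite subr_ge0 ltW.
    by rewrite normrM (ger0_norm q2) ler_piMl //; exact: XX_le.
  exists (XX w / sqn w * (1 - (rr w ^+ 2)^-1)).
    by apply: le_lt_trans lq _; rewrite ltrBlDr ltrDl.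
  move=> v; rewrite (perm_mem (perm_to_rem wvs)) inE => /orP[/eqP ->|vr].
    exact: dhh_big.
  have vvs := mem_rem vr.
  apply: dhh_hh_ge0 q0 (ltW q1) _ lq; first exact: (allP v1 v vvs).
  have : rr w * rr v <= 1.
    by have := allP a v vr; rewrite /pair_ok; apply: le_trans; rewrite lerDr.
  rewrite mulrC -ler_pdivlMr // mul1r => rv.
  by rewrite -exprVn lerXn2r // nnegrE ?rr_ge0 // invr_ge0 ltW.
(* With S the sum of the [hh] and D that of the [dhh], D >= - l S together with S < 0 and |l| < 1
   gives D > S. *)
have : 0 <= \sum_(v <- vs) dhh v + l * \sum_(v <- vs) hh v.
  by rewrite mulr_sumr -big_split /= big_seq; apply: sumr_ge0 => v; exact: H.
move: (\sum_(v <- vs) hh v) (\sum_(v <- vs) dhh v) h0 => S D S0 h.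
have : - `|l| <= l by rewrite lerNl -normrN ler_norm.
have : l <= `|l| by exact: ler_norm.
move: `|l| l1 => a a1 h1 h2.
have : l * S <= - (a * S) by rewrite -mulNr; apply: ler_wnM2r => //; exact: ltW.
have : 0 < (1 - a) * - S by rewrite mulr_gt0 ?subr_gt0 ?oppr_gt0.
lra.
Qed.

(** * Continuity along the flow and propagation of the sign *)

Lemma is_derive_continuous (R : realType) (f : R -> R) (x d : R) :
  is_derive x 1 f d -> {for x, continuous f}.
Proof.
by move=> h; apply: differentiable_continuous; apply/derivable1_diffP; exact: ex_derive.
Qed.

Lemma continuous_sqn_flow (R : realType) (v : R * R) : continuous (fun s => sqn (flow s v)).
Proof. by move=> s; exact: is_derive_continuous (is_derive_sqn v s). Qed.

Lemma continuous_rr_flow (R : realType) (v : R * R) : continuous (fun s => rr (flow s v)).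
Proof.
move=> s; apply: (@continuous_comp _ _ _ (fun s => sqn (flow s v) - 1) Num.sqrt);
  last exact: sqrt_continuous.
by apply: cvgB; [exact: continuous_sqn_flow|exact: cvg_cst].
Qed.

Lemma continuous_dot_flow (R : realType) (u v : R * R) :
  continuous (fun s => dot (flow s u) (flow s v)).
Proof.
move=> s; apply: cvgD; apply: cvgM.
- exact: is_derive_continuous (is_derive_flow1 u s).
- exact: is_derive_continuous (is_derive_flow1 v s).
- exact: is_derive_continuous (is_derive_flow2 u s).
- exact: is_derive_continuous (is_derive_flow2 v s).
Qed.

Lemma continuous_hh_flow (R : realType) (v : R * R) (s : R) : sqn (flow s v) != 0 ->
  {for s, continuous (fun s => hh (flow s v))}.
Proof.
move=> n0; apply: cvgM.
  apply: cvgM; first exact: continuous_rr_flow.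
  exact: is_derive_continuous (is_derive_XX v s).
apply: cvgV; first by rewrite expf_neq0.
by rewrite expr2; apply: cvgM; exact: continuous_sqn_flow.
Qed.

Lemma continuous_halfcap (R : realType) (t : R) : 0 < t -> {for t, continuous (@halfcap R)}.
Proof. by move=> t0; exact: is_derive_continuous (is_derive_halfcap t0). Qed.

Lemma continuous_caps_flow (R : realType) (v : R * R) (s : R) : 0 < sqn (flow s v) ->
  {for s, continuous (fun s => 2 * halfcap (Num.sqrt (sqn (flow s v)))^-1)}.
Proof.
move=> n0; apply: cvgM; first exact: cvg_cst.
apply: (@continuous_comp _ _ _ (fun s => (Num.sqrt (sqn (flow s v)))^-1) (@halfcap R)).
  apply: cvgV; first by rewrite gt_eqF // sqrtr_gt0.
  by apply: (@continuous_comp _ _ _ (fun s => sqn (flow s v)) Num.sqrt);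
    [exact: continuous_sqn_flow|exact: sqrt_continuous].
by apply: continuous_halfcap; rewrite invr_gt0 sqrtr_gt0.
Qed.

Lemma continuous_sum_seq (R : realType) (T : eqType) (f : T -> R -> R) (vs : seq T) (s : R) :
  (forall v, v \in vs -> {for s, continuous (f v)}) ->
  {for s, continuous (fun s => \sum_(v <- vs) f v s)}.
Proof.
elim: vs => [|v vs IH] H.
  rewrite (_ : (fun s => _) = cst 0); first exact: cvg_cst.
  by apply/funext => t; rewrite big_nil.
rewrite (_ : (fun s => _) = (fun s => f v s + \sum_(v <- vs) f v s)); last first.
  by apply/funext => t; rewrite big_cons.
apply: cvgD; first by apply: H; rewrite mem_head.
by apply: IH => w wvs; apply: H; rewrite inE wvs orbT.
Qed.

Lemma is_derive_sum_seq (R : realType) (T : eqType) (f : T -> R -> R) (d : T -> R)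
    (vs : seq T) (s : R) : (forall v, v \in vs -> is_derive s 1 (f v) (d v)) ->
  is_derive s 1 (fun s => \sum_(v <- vs) f v s) (\sum_(v <- vs) d v).
Proof.
elim: vs => [|v vs IH] H.
  rewrite (_ : (fun s => _) = cst 0); first by rewrite big_nil; exact: is_derive_cst.
  by apply/funext => t; rewrite big_nil.
rewrite (_ : (fun s => _) = (fun s => f v s + \sum_(v <- vs) f v s)); last first.
  by apply/funext => t; rewrite big_cons.
rewrite big_cons; apply: is_deriveD; first by apply: H; rewrite mem_head.
by apply: IH => w wvs; apply: H; rewrite inE wvs orbT.
Qed.

Lemma continuous_within_segment (R : realType) (f : R -> R) (a b : R) :
  (forall x, a <= x <= b -> {for x, continuous f}) -> {within `[a, b], continuous f}.
Proof.
by move=> H; apply: continuous_in_subspaceT => x; rewrite inE /= in_itv /= => /H.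
Qed.

(** Suppose exp(-s) H(s) has a negative minimum at c, necessarily with c > 0. Just to the left of c
    it is still negative, so its derivative exp(-s) (H' - H) is positive there, and by the mean
    value theorem a smaller value occurs before c. *)
Lemma nonneg_of_growth (R : realType) (H dH : R -> R) (b : R) : 0 <= b ->
  (forall s : R, 0 <= s <= b -> {for s, continuous H}) ->
  (forall s : R, 0 < s < b -> is_derive s 1 H (dH s)) ->
  (forall s : R, 0 < s < b -> H s < 0 -> H s < dH s) ->
  0 <= H 0 -> forall s : R, 0 <= s <= b -> 0 <= H s.
Proof.
move=> b0 cH dHE grow H0.
pose k (s : R) := expR (- s) * H s.
have dexp (s : R) : is_derive s 1 (fun s : R => expR (- s)) (- expR (- s)).
  apply: (is_derive_eq (@is_derive1_comp R expR -%R s _ _ (is_derive_expR (- s)) (is_deriveNid s 1))).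
  by rewrite mulrN1.
have ck (s : R) : 0 <= s <= b -> {for s, continuous k}.
  move=> sb; apply: cvgM; last exact: cH.
  exact: is_derive_continuous (dexp s).
have dk (s : R) : 0 < s < b -> is_derive s 1 k (expR (- s) * (dH s - H s)).
  move=> sb; apply: (is_derive_eq (is_deriveM (dexp s) (dHE s sb))).
  by rewrite /GRing.scale /=; ring.
have kH (s : R) : (0 <= k s) = (0 <= H s) by rewrite /k pmulr_rge0 // expR_gt0.
have [c] := EVT_min b0 (continuous_within_segment ck).
rewrite in_itv /= => cb cmin.
have [kc|kc] := leP 0 (k c).
  by move=> s sb; rewrite -kH; apply: le_trans kc _; apply: cmin; rewrite in_itv.
exfalso; have /andP[c0' cb'] := cb.
have c0 : 0 < c.
  rewrite lt_neqAle c0' andbT; apply: contraTneq kc => <-.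
  by rewrite -leNgt kH.
have [e e0 He] : exists2 e : R, 0 < e & forall t, `|c - t| < e -> k t < 0.
  have := ck c cb => /cvgrPdist_lt/(_ (- k c)); rewrite oppr_gt0 => /(_ kc).
  move=> /nbhs_ballP[e /= e0 He]; exists e => // t ct.
  have := He t ct; rewrite /= distrC ltr_norml opprK => /andP[_]; rewrite ltrBlDr; lra.
pose d := c - Num.min (c / 2) (e / 2).
have m0 : 0 < Num.min (c / 2) (e / 2) by rewrite lt_min !divr_gt0.
have m1 : Num.min (c / 2) (e / 2) <= c / 2 by rewrite ge_min lexx.
have m2 : Num.min (c / 2) (e / 2) <= e / 2 by rewrite ge_min lexx orbT.
have dc : d < c by rewrite /d; lra.
have d0 : 0 <= d by rewrite /d; lra.
have [| |x xdc E] := @MVT R k (fun s => expR (- s) * (dH s - H s)) d c dc.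
- move=> x; rewrite in_itv /= => /andP[x1 x2]; apply: dk.
  by rewrite (le_lt_trans d0 x1) (lt_le_trans x2 cb').
- by apply: continuous_within_segment => x /andP[x1 x2]; apply: ck; rewrite (le_trans d0 x1) (le_trans x2 cb').
have := cmin d; rewrite in_itv /= d0 (le_trans (ltW dc) cb') => /(_ isT) kcd.
move: xdc; rewrite in_itv /= => /andP[x1 x2].
have xb : 0 < x < b by rewrite (le_lt_trans d0 x1) (lt_le_trans x2 cb').
have Hx : H x < 0.
  have : k x < 0 by apply: He; rewrite ger0_norm; move: x1; rewrite /d; lra.
  by rewrite ltNge kH -ltNge.
have : 0 < expR (- x) * (dH x - H x) * (c - d).
  by rewrite mulr_gt0 ?subr_gt0 // mulr_gt0 ?expR_gt0 // subr_gt0; exact: grow.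
lra.
Qed.

(** The open counterpart of [ok]: no cap is degenerate and no two caps touch. Being open it persists
    for a short time, and in the limit it degrades only to [ok]. *)
Definition strict (R : realType) (vs : seq (R * R)) : bool :=
  all (fun v => 1 < sqn v) vs && pairwise (@pair_lt R) vs.

Lemma strict_ok (R : realType) (vs : seq (R * R)) : strict vs -> ok vs.
Proof.
move=> /andP[a p]; apply/andP; split.
  by apply: sub_all a => v; exact: ltW.
by apply: sub_pairwise p => u v; exact: ltW.
Qed.

Lemma near_all (T : eqType) (R : realType) (P : R -> T -> bool) (vs : seq T) (s : R) :
  (forall v, v \in vs -> \forall t \near s, P t v) -> \forall t \near s, all (P t) vs.
Proof.
elim: vs => [|v vs IH] H; first by near=> t.
near=> t => /=; apply/andP; split; first by near: t; apply: H; rewrite mem_head.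
near: t; apply: IH => w wvs; apply: H; rewrite inE wvs orbT //.
Unshelve. all: by end_near. Qed.

Lemma near_pairwise (T : eqType) (R : realType) (P : R -> rel T) (vs : seq T) (s : R) :
  (forall u v, P s u v -> \forall t \near s, P t u v) ->
  pairwise (P s) vs -> \forall t \near s, pairwise (P t) vs.
Proof.
move=> H; elim: vs => [|v vs IH]; first by move=> _; near=> t.
move=> /= /andP[a p]; near=> t; apply/andP; split.
  by near: t; apply: near_all => w wvs; apply: H; exact: (allP a).
by near: t; exact: IH.
Unshelve. all: by end_near. Qed.

Lemma strict_near (R : realType) (vs : seq (R * R)) (s : R) :
  strict (map (flow s) vs) -> \forall t \near s, strict (map (flow t) vs).
Proof.
rewrite /strict all_map pairwise_map => /andP[a p]; near=> t.
rewrite all_map pairwise_map; apply/andP; split; near: t.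
  apply: near_all => v vvs; have /= v1 := allP a v vvs.
  have := @continuous_sqn_flow R v s => /cvgrPdist_lt/(_ (sqn (flow s v) - 1)).
  rewrite subr_gt0 => /(_ v1); apply: filterS => t.
  by rewrite ltr_norml => /andP[_]; rewrite /=; lra.
apply: (near_pairwise (P := fun t => relpre (flow t) (@pair_lt R)) _ p) => u v /=.
rewrite /pair_lt => h.
have c : {for s, continuous (fun t => `|dot (flow t u) (flow t v)| + rr (flow t u) * rr (flow t v))}.
  apply: cvgD; first by apply: cvg_norm; exact: continuous_dot_flow.
  by apply: cvgM; exact: continuous_rr_flow.
move: c => /cvgrPdist_lt/(_ (1 - (`|dot (flow s u) (flow s v)| + rr (flow s u) * rr (flow s v)))).
rewrite subr_gt0 => /(_ h); apply: filterS => t.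
by rewrite ltr_norml => /andP[]; rewrite /=; lra.
Unshelve. all: by end_near. Qed.

Lemma le_left_limit (R : realType) (f : R -> R) (b c : R) : 0 < b ->
  {for b, continuous f} -> (forall s : R, 0 <= s < b -> f s <= c) -> f b <= c.
Proof.
move=> b0 cf H; rewrite leNgt; apply/negP => cb.
have := cf => /cvgrPdist_lt/(_ (f b - c)); rewrite subr_gt0 => /(_ cb) /nbhs_ballP[e /= e0 He].
pose s := b - Num.min (b / 2) (e / 2).
have m0 : 0 < Num.min (b / 2) (e / 2) by rewrite lt_min !divr_gt0.
have m1 : Num.min (b / 2) (e / 2) <= b / 2 by rewrite ge_min lexx.
have m2 : Num.min (b / 2) (e / 2) <= e / 2 by rewrite ge_min lexx orbT.
have sb : 0 <= s < b by rewrite /s; apply/andP; split; lra.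
have : `|f b - f s| < f b - c.
  by apply: He; rewrite /ball /= gtr0_norm /s; lra.
rewrite ltr_norml => /andP[_]; have := H s sb; lra.
Qed.

Lemma strict_limit_ok (R : realType) (vs : seq (R * R)) (b : R) : 0 < b ->
  (forall s : R, 0 <= s < b -> strict (map (flow s) vs)) -> ok (map (flow b) vs).
Proof.
move=> b0 H; rewrite /ok all_map pairwise_map; apply/andP; split.
  apply/allP => v vvs /=; rewrite -lerN2.
  apply: (@le_left_limit _ (fun s => - sqn (flow s v)) _ _ b0).
    by apply: cvgN; exact: continuous_sqn_flow.
  move=> s /H; rewrite /strict all_map => /andP[/allP/(_ v vvs) /= h _].
  by rewrite lerN2 ltW.
have HP (s : R) : 0 <= s < b -> pairwise (relpre (flow s) (@pair_lt R)) vs.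
  by move=> /H; rewrite /strict pairwise_map => /andP[].
elim: vs {H} HP => //= v vs IH HP; apply/andP; split; last first.
  by apply: IH => s /HP /andP[].
apply/allP => w wvs /=; rewrite /pair_ok.
apply: (@le_left_limit _ (fun s => `|dot (flow s v) (flow s w)| + rr (flow s v) * rr (flow s w)) _ _ b0).
  apply: cvgD; first by apply: cvg_norm; exact: continuous_dot_flow.
  by apply: cvgM; exact: continuous_rr_flow.
by move=> s /HP /andP[/allP/(_ w wvs) /ltW].
Qed.

Lemma caps_halfcap (R : realType) (v : R * R) : 0 < sqn v ->
  caps v = 2 * halfcap (Num.sqrt (sqn v))^-1.
Proof. exact: ar_caps. Qed.

(** While the configuration is strict, the lost area is the sum of the cap areas, with derivative
    four times the sum of the [hh]. At [b] only continuity is used, because [rr] is not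
    differentiable along the flow where a cap may vanish. *)
Lemma flow_phase (R : realType) (vs : seq (R * R)) (b : R) : 0 < b ->
  (forall s : R, 0 <= s < b -> strict (map (flow s) vs)) ->
  0 <= \sum_(v <- vs) hh v ->
  0 <= \sum_(v <- map (flow b) vs) hh v /\ FF vs b <= FF vs 0.
Proof.
move=> b0 st H0.
have okb := strict_limit_ok b0 st.
have sq1 (s : R) v : 0 <= s <= b -> v \in vs -> 1 <= sqn (flow s v).
  move=> /andP[s0]; rewrite le_eqVlt => /orP[/eqP ->|sb] vvs.
    by have := okb; rewrite /ok all_map => /andP[/allP/(_ v vvs)].
  have := st s; rewrite s0 sb => /(_ isT); rewrite /strict all_map => /andP[/allP/(_ v vvs) h _].
  exact: ltW.
have sq0 (s : R) v : 0 <= s <= b -> v \in vs -> 0 < sqn (flow s v).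
  by move=> sb vvs; apply: lt_le_trans (sq1 s v sb vvs).
have st1 (s : R) v : 0 < s < b -> v \in vs -> 1 < sqn (flow s v).
  move=> /andP[s0 sb] vvs; have := st s; rewrite (ltW s0) sb => /(_ isT).
  by rewrite /strict all_map => /andP[/allP/(_ v vvs)].
have cH (s : R) : 0 <= s <= b -> {for s, continuous (fun s => \sum_(v <- vs) hh (flow s v))}.
  move=> sb; apply: (continuous_sum_seq (f := fun v s => hh (flow s v))) => v vvs.
  by apply: continuous_hh_flow; rewrite gt_eqF // sq0.
have dH (s : R) : 0 < s < b -> is_derive s 1 (fun s => \sum_(v <- vs) hh (flow s v))
    (\sum_(v <- vs) dhh (flow s v)).
  move=> sb; apply: (is_derive_sum_seq (f := fun v s => hh (flow s v))
    (d := fun v => dhh (flow s v))) => v vvs.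
  by apply: is_derive_hh; exact: st1.
have HH : forall s : R, 0 <= s <= b -> 0 <= \sum_(v <- vs) hh (flow s v).
  apply: nonneg_of_growth cH dH _ _; first exact: ltW.
    move=> s /andP[s0 sb] hs; have := st s; rewrite (ltW s0) sb => /(_ isT) sts.
    have := @sum_dhh_gt R (map (flow s) vs); rewrite !big_map; apply => //.
      by case/andP: sts.
    by case/andP: (strict_ok sts).
  by under eq_bigr do rewrite flow0.
split; first by rewrite big_map; apply: HH; rewrite ltW // lexx.
rewrite /FF (ar_polygon okb).
have ok0 : ok (map (flow 0) vs) by apply: strict_ok; apply: st; rewrite lexx.
rewrite (ar_polygon ok0) lerD2l lerN2 !big_map.
pose C (s : R) := \sum_(v <- vs) 2 * halfcap (Num.sqrt (sqn (flow s v)))^-1.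
have CE (s : R) : 0 <= s <= b -> \sum_(v <- vs) caps (flow s v) = C s.
  by move=> sb; apply: eq_big_seq => v vvs; apply: caps_halfcap; exact: sq0.
have h0 : 0 <= (0 : R) <= b by rewrite lexx ltW.
have hb : 0 <= b <= b by rewrite lexx ltW.
suff : C 0 <= C b by rewrite -(CE 0 h0) -(CE b hb).
have [| |x xb E] := @MVT R C (fun s => \sum_(v <- vs) 4 * hh (flow s v)) 0 b b0.
- move=> x; rewrite in_itv /= => xb.
  apply: (is_derive_sum_seq (f := fun v s => 2 * halfcap (Num.sqrt (sqn (flow s v)))^-1)
    (d := fun v => 4 * hh (flow x v))) => v vvs.
  by apply: is_derive_caps; exact: st1.
- apply: continuous_within_segment => x xb.
  apply: (continuous_sum_seq (f := fun v s => 2 * halfcap (Num.sqrt (sqn (flow s v)))^-1)) => v vvs.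
  by apply: continuous_caps_flow; exact: sq0.
rewrite -subr_ge0 E mulr_ge0 ?subr0 ?(ltW b0) // -mulr_sumr mulr_ge0 //.
by apply: HH; move: xb; rewrite in_itv /= => /andP[x0 x1]; rewrite !ltW.
Qed.

Lemma hh_eq0 (R : realType) (v : R * R) : sqn v <= 1 -> hh v = 0.
Proof. by move=> v1; rewrite /hh /rr ler0_sqrtr ?subr_le0 // !mul0r. Qed.

Lemma flow_mono_step (R : realType) (n : nat) (us : seq (R * R)) :
  (forall vs : seq (R * R), (size vs <= n)%N -> ok vs -> 0 <= \sum_(v <- vs) hh v ->
     forall s : R, 0 <= s -> FF vs s <= FF vs 0) ->
  (size us <= n.+1)%N -> ok us -> 0 <= \sum_(v <- us) hh v -> ~~ strict us ->
  forall s : R, 0 <= s -> FF us s <= FF us 0.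
Proof.
move=> IH sz oku H0 ns s s0; rewrite -subr_le0.
have [a1|] := boolP (all (fun v => 1 < sqn v) us); last first.
  move=> /allPn[v vus]; rewrite -leNgt => v1.
  have p := perm_to_rem vus.
  move: H0 sz oku; rewrite (perm_big _ p) (perm_size p) (ok_perm p) !(FF_perm _ p) /= big_cons.
  move: (rem v us) => t {p}.
  rewrite (hh_eq0 v1) add0r => H0 szt okt.
  have okt' : ok t.
    by move: okt; rewrite /ok /= => /andP[/andP[_ ->] /andP[_ ->]].
  apply: le_trans (@FF_replace R (v :: t) t s _ _) _.
  - by rewrite polygon_cons => x [[_ tx]] /(_ tx).
  - by rewrite polygon_cons => x [Dx tx]; split => //; exact: disk_sub_strip v1 x Dx.
  - by rewrite subr_le0; exact: IH.
have : ~~ pairwise (@pair_lt R) us by move: ns; rewrite /strict a1.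
move=> /not_pairwiseP[u [w [t [p nuw]]]].
move: H0 sz oku a1; rewrite (perm_big _ p) (perm_size p) (ok_perm p) (perm_all _ p) !(FF_perm _ p).
rewrite /= !big_cons /ok /= => H0 szt /andP[/and3P[_ _ a] /and3P[/andP[uw ut] wt tt]] /and3P[u1 w1 t1].
have rs1 : rr u * rr w <= 1 by move: uw; rewrite /pair_ok; apply: le_trans; rewrite lerDr.
have [rs|] := ltP (rr u * rr w) 1.
  have [v [v1 cov ins hv pv]] := merge_exists u1 w1 uw nuw rs.
  apply: le_trans (@FF_replace R [:: u, w & t] (v :: t) s _ _) _.
  - rewrite !polygon_cons => x [[ux [wx tx]] nx]; apply: cov ux wx _ => vx.
    exact: nx.
  - by rewrite !polygon_cons => x [Dx [/(ins x Dx)[ux wx] tx]].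
  - rewrite subr_le0; apply: IH s0 => //.
      rewrite /ok /= v1 a tt /= andbT; apply/allP => k kt.
      by apply: pv; [exact: (allP t1)|exact: (allP ut)|exact: (allP wt)].
    by rewrite big_cons hv -addrA.
(* The half-angles add up to pi/2: the two strips are orthogonal and bound a rectangle inscribed in
   the circle, so the polygon lies in the disk. *)
move=> rs; have rsE : rr u * rr w = 1 by apply/eqP; rewrite eq_le rs1.
have d0 : dot u w = 0.
  apply/eqP; rewrite -normr_le0; move: uw; rewrite /pair_ok rsE; lra.
have PD : polygon [:: u, w & t] `<=` @unit_disk R.
  rewrite !polygon_cons => x [ux [wx _]].
  have r0 : 0 < rr u by rewrite rr_gt0.
  have q0 : 0 < rr w by rewrite rr_gt0.
  have nu := sqr_rr (ltW u1); have nw := sqr_rr (ltW w1).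
  have [U0 W0] : 0 < sqn u /\ 0 < sqn w by split; apply: lt_trans ltr01 _.
  have E1 : sqn u * sqn w = sqn u + sqn w.
    have : rr u ^+ 2 * rr w ^+ 2 = 1 by rewrite -exprMn rsE expr1n.
    by rewrite nu nw; lra.
  have E2 : sqn x * (sqn u * sqn w) = dot x u ^+ 2 * sqn w + dot x w ^+ 2 * sqn u
     - 2 * dot x u * dot x w * dot u w + sqn x * dot u w ^+ 2.
    by rewrite /sqn /dot; ring.
  have xu : dot x u ^+ 2 <= 1 by rewrite -real_normK ?num_real // exprn_ile1.
  have xw : dot x w ^+ 2 <= 1 by rewrite -real_normK ?num_real // exprn_ile1.
  rewrite d0 mulr0 subr0 expr0n mulr0 addr0 in E2.
  rewrite /unit_disk /= -/(sqn x).
  rewrite -(ler_pM2r (mulr_gt0 U0 W0)) E2 mul1r E1 addrC lerD // ler_piMl // ltW //.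
(* At time 0 the value is the whole area of the polygon, which the flow preserves; later values
   count only its part in the disk. *)
rewrite subr_le0 FF_0 (_ : _ `&` _ = polygon [:: u, w & t]); last first.
  by apply/seteqP; split => [x []|x Px] //; split => //; exact: PD.
have mP := measurable_polygon [:: u, w & t].
have fP : fmeas (polygon [:: u, w & t]) := fmeas_sub mP (fmeas_unit_disk R) PD.
rewrite -(ar_flow s mP) /FF polygon_flow; apply: le_ar => [||x []//].
  exact: measurableI (fmeas_unit_disk R).1 (measurable_flow s mP).
by split; [exact: measurable_flow|rewrite area_flow //; exact: fP.2].
Qed.

(* The path [s |-> flow s vs] is followed until two caps touch or one of them
   vanishes; the strips are then merged, respectively dropped. *)
Theorem flow_mono (R : realType) (vs : seq (R * R)) : ok vs ->
  0 <= \sum_(v <- vs) hh v -> forall s : R, 0 <= s -> FF vs s <= FF vs 0.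
Proof.
move: {2}(size vs) (leqnn (size vs)) => n.
elim: n vs.
  by move=> vs; rewrite leqn0 => /nilP -> _ _ s _; rewrite /FF /=.
move=> n IHn vs.
move=> sz okv H0 S.
rewrite le_eqVlt => /orP[/eqP <- //|S0].
have step := flow_mono_step IHn.
have [st0|ns] := boolP (strict vs); last by apply: (step vs) => //; exact: ltW.
(* The infimum of [B] is the end of the current phase. It belongs to [B] because strictness is an
   open condition, so [step] applies there with the remaining time. *)
pose B := [set s : R | 0 <= s <= S /\ ~~ strict (map (flow s) vs)].
have [B0|/set0P Bne] := eqVneq B set0.
  apply: (flow_phase S0 _ H0).2 => s /andP[s0 sS].
  apply: contrapT => ns; have : B s by split; [rewrite s0 ltW|exact/negP].
  by rewrite B0.
have lB : has_lbound B by exists 0 => x [/andP[]].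
pose b := inf B.
have b0 : 0 <= b by apply: lb_le_inf => // x [/andP[]].
have bS : b <= S by case: Bne => x Bx; apply: le_trans (ge_inf lB Bx) _; case: Bx => /andP[].
have stb (s : R) : 0 <= s < b -> strict (map (flow s) vs).
  move=> /andP[s0 sb]; apply: contrapT => ns.
  have : B s by split; [rewrite s0 (le_trans (ltW sb))|exact/negP].
  by move=> /(ge_inf lB); rewrite leNgt sb.
have nsb : ~~ strict (map (flow b) vs).
  apply/negP => /strict_near/nbhs_ballP[e /= e0 He].
  have [x Bx xb] := inf_adherent e0 (conj Bne lB).
  have bx := ge_inf lB Bx.
  case: (Bx) => _ /negP; apply; apply: He; rewrite /ball /= ler0_norm ?subr_le0 //.
  by move: xb; rewrite -/b; lra.
have bp : 0 < b.
  rewrite lt_neqAle b0 andbT; apply: contraNneq nsb => <-.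
  by rewrite map_flow0.
have [Hb Fb] := flow_phase bp stb H0.
apply: le_trans Fb.
have := step (map (flow b) vs) _ (strict_limit_ok bp stb) Hb nsb (S - b).
rewrite size_map subr_ge0 => /(_ sz bS).
by rewrite /FF -!map_flowD subrK add0r.
Qed.

(** * Convex bodies and their gaps *)

Lemma convex_setE (R : realType) (K : set (R * R)) (x y : R * R) (t : R) :
  convex_set K -> K x -> K y -> 0 <= t <= 1 ->
  K (t * x.1 + (1 - t) * y.1, t * x.2 + (1 - t) * y.2).
Proof.
move=> cK Kx Ky t01.
have h := cK x y (Itv01 (andP t01).1 (andP t01).2).
have := h (mem_set Kx) (mem_set Ky); rewrite inE; congr K.
Qed.

Lemma convex_cone_comb (R : realType) (K : set (R * R)) (x y : R * R) (a b : R) :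
  convex_set K -> K (0, 0) -> K x -> K y -> 0 <= a -> 0 <= b -> a + b <= 1 ->
  K (a * x.1 + b * y.1, a * x.2 + b * y.2).
Proof.
move=> cK K0 Kx Ky a0 b0 ab.
have [ab0|abn] := eqVneq (a + b) 0.
  have -> : a = 0 by lra.
  have -> : b = 0 by lra.
  by rewrite !mul0r !addr0.
have abp : 0 < a + b by rewrite lt_neqAle eq_sym abn addr_ge0.
have h1 : 0 <= a / (a + b) <= 1.
  by rewrite divr_ge0 ?(ltW abp) //= ler_pdivrMr // mul1r lerDl.
have := convex_setE cK (convex_setE cK Kx Ky h1) K0 (_ : 0 <= a + b <= 1).
rewrite (ltW abp) ab => /(_ isT) /=; congr K; congr (_, _); by field.
Qed.

Lemma convex_scale (R : realType) (K : set (R * R)) (x : R * R) (a : R) :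
  convex_set K -> K (0, 0) -> K x -> 0 <= a <= 1 -> K (a * x.1, a * x.2).
Proof.
move=> cK K0 Kx a01; have := convex_setE cK Kx K0 a01.
by rewrite /= !mulr0 !addr0.
Qed.

Lemma nbhs_box (R : realType) (K : set (R * R)) (x : R * R) : nbhs x K <->
  exists2 e : R, 0 < e & forall y : R * R, `|x.1 - y.1| < e -> `|x.2 - y.2| < e -> K y.
Proof.
split => [/nbhs_ballP[e /= e0 He]|[e e0 He]].
  by exists e => // y h1 h2; apply: He; split.
by apply/nbhs_ballP; exists e => //= y [h1 h2]; exact: He.
Qed.

(** A point near a x is the convex combination of x, with weight a, and of a point of the box around
    the origin contained in [K]. *)
Lemma interior_scale (R : realType) (K : set (R * R)) (x : R * R) (a : R) :
  convex_set K -> interior K (0, 0) -> K x -> 0 <= a < 1 -> interior K (a * x.1, a * x.2).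
Proof.
move=> cK /nbhs_box[/= e e0 He] Kx /andP[a0 a1]; apply/nbhs_box => /=.
have a1' : 0 < 1 - a by rewrite subr_gt0.
exists (e * (1 - a)); first by rewrite mulr_gt0.
move=> y h1 h2.
have Kw : K ((y.1 - a * x.1) / (1 - a), (y.2 - a * x.2) / (1 - a)).
  by apply: He => /=; rewrite sub0r normrN normrM normfV (gtr0_norm a1') ltr_pdivrMr // distrC.
have := convex_setE cK Kx Kw (_ : 0 <= a <= 1); rewrite a0 (ltW a1) => /(_ isT) /=.
rewrite (surjective_pairing y); congr K; congr (_, _); by field; rewrite gt_eqF.
Qed.

Lemma symmetricN (R : realType) (K : set (R * R)) (x : R * R) :
  centrally_symmetric K -> K x -> K (- x).
Proof. by rewrite /centrally_symmetric => E Kx; rewrite E; exists x. Qed.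

(** If [x] is interior and [y] is small, then [y] is the midpoint of x + y and -(x - y), both in
    [K]. *)
Lemma symmetric_interior0 (R : realType) (K : set (R * R)) :
  centrally_symmetric K -> convex_set K -> interior K !=set0 -> interior K (0, 0).
Proof.
move=> sK cK [x /nbhs_box[e e0 He]]; apply/nbhs_box; exists e => //= y h1 h2.
have K1 : K (x.1 + y.1, x.2 + y.2).
  by apply: He => /=; rewrite opprD addNKr normrN; move: h1 h2; rewrite !sub0r !normrN.
have K2 : K (- x).
  by apply: (symmetricN sK); apply: He; rewrite subrr normr0.
have K3 : K (x.1 - y.1, x.2 - y.2).
  by apply: He => /=; rewrite opprB addrC subrK; move: h1 h2; rewrite !sub0r !normrN.
have K4 := symmetricN sK K3.
have := convex_setE cK K1 K4 (_ : 0 <= 2^-1 <= 1).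
rewrite invr_ge0 ler0n invf_le1 ?ltr0n // ler1n => /(_ isT) /=.
rewrite (surjective_pairing y); congr K; congr (_, _); by field.
Qed.

(* The arcs [|dot u v| > 1] of the unit circle are the gaps, i.e. the parts of
   the circle outside [K]. *)
Definition gap_system (R : realType) (K : set (R * R)) (vs : seq (R * R)) : Prop :=
  [/\ strict vs,
    forall u, unit_circle u -> (forall v, v \in vs -> `|dot u v| < 1) -> interior K u,
    forall u v, unit_circle u -> v \in vs -> 1 < `|dot u v| -> ~ K u &
    forall u v, unit_circle u -> v \in vs -> `|dot u v| = 1 -> K u /\ ~ interior K u].

Lemma gap_systemNi (R : realType) (K : set (R * R)) vs u v : gap_system K vs ->
  unit_circle u -> v \in vs -> 1 <= `|dot u v| -> ~ interior K u.
Proof.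
move=> [_ _ g3 g4] cu vvs; rewrite le_eqVlt => /orP[/eqP/esym h|h].
  by case: (g4 u v cu vvs h).
by move=> /interior_subset; exact: g3 h.
Qed.

Lemma dot_perp (R : realType) (x v : R * R) :
  dot x v ^+ 2 + dot x (- v.2, v.1) ^+ 2 = sqn x * sqn v.
Proof. by rewrite /dot /sqn /=; ring. Qed.

Lemma perp_coord (R : realType) (x v : R * R) : sqn v != 0 ->
  x = ((dot x v * v.1 - dot x (- v.2, v.1) * v.2) / sqn v,
       (dot x v * v.2 + dot x (- v.2, v.1) * v.1) / sqn v).
Proof.
move=> v0; rewrite [LHS]surjective_pairing; congr (_, _); rewrite /dot /=;
  move: v0; rewrite /sqn => v0; by field.
Qed.

Lemma dot_unit (R : realType) (x v : R * R) (c : R) : dot (x.1 / c, x.2 / c) v = dot x v / c.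
Proof. by rewrite /dot /=; ring. Qed.

Lemma unit_circle_normalize (R : realType) (x : R * R) : 0 < sqn x ->
  unit_circle (x.1 / Num.sqrt (sqn x), x.2 / Num.sqrt (sqn x)).
Proof.
move=> x0; rewrite /unit_circle /= !expr_div_n -mulrDl sqr_sqrtr ?ltW //.
by rewrite -/(sqn x) divff // gt_eqF.
Qed.

(* End points of the chord cut by the line [dot x v = 1]. *)
Definition chord_end (R : realType) (v : R * R) (r : R) : R * R :=
  ((v.1 - r * v.2) / sqn v, (v.2 + r * v.1) / sqn v).

Section Hull.
Variables (R : realType) (K : set (R * R)) (vs : seq (R * R)).
Hypotheses (cK : convex_set K) (sK : centrally_symmetric K).
Hypotheses (i0 : interior K (0, 0)) (gK : gap_system K vs).

Let K0 : K (0, 0). Proof. exact: interior_subset. Qed.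

Let sqn1 v : v \in vs -> 1 < sqn v.
Proof. by case: gK => /andP[/allP a _] _ _ _; exact: a. Qed.

Let chord_endK v r : v \in vs -> r ^+ 2 = sqn v - 1 ->
  K (chord_end v r) /\ ~ interior K (chord_end v r).
Proof.
move=> vvs rE; have v0 : sqn v != 0 by rewrite gt_eqF // (lt_trans ltr01) // sqn1.
case: gK => _ _ _ g4; apply: (g4 _ v) => //.
  rewrite /unit_circle /chord_end /=.
  transitivity ((1 + r ^+ 2) * sqn v / sqn v ^+ 2).
    by move: v0; rewrite /sqn => v0; field.
  by rewrite rE addrC subrK; field.
rewrite (_ : dot _ v = 1) ?normr1 //.
by move: v0; rewrite /dot /chord_end /sqn /= => v0; field.
Qed.

(** Suppose a point of [K] beyond the chord of [v] lies outside the disk. If it lies in the cone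
    over the gap, its radial projection is a gap point interior to [K]. Otherwise convexity makes an
    end of the chord interior to [K]. Both are excluded. *)
Lemma outside_polygon_sub_disk : K `\` polygon vs `<=` @unit_disk R.
Proof.
have main x v r : v \in vs -> r ^+ 2 = sqn v - 1 -> K x -> 1 < dot x v ->
    0 < r * (dot x (- v.2, v.1) - r * dot x v) -> False.
  move=> vvs rE Kx; set a := dot x v; set b := dot x _ => a1 ab.
  have v0 : sqn v != 0 by rewrite gt_eqF // (lt_trans ltr01) // sqn1.
  have rN : (- r) ^+ 2 = sqn v - 1 by rewrite sqrrN.
  have [Km _] := chord_endK vvs rN.
  have [_ nP] := chord_endK vvs rE.
  have r0 : r != 0 by apply: contraTneq ab => ->; rewrite mul0r ltxx.
  have r1 : 0 < r ^+ 2 by rewrite lt_neqAle eq_sym expf_neq0 // sqr_ge0.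
  have d0 : 0 < r * (b - r * a) + 2 * r ^+ 2 by rewrite addr_gt0 // mulr_gt0.
  (* The weight at which the segment from [x] to the far end of the chord crosses the ray through
     the near end. The crossing point is the near end times a' > 1. *)
  pose l := 2 * r ^+ 2 / (r * (b - r * a) + 2 * r ^+ 2).
  have l01 : 0 <= l <= 1.
    rewrite /l; apply/andP; split; first by exact: ltW (divr_gt0 (mulr_gt0 _ r1) d0).
    rewrite ler_pdivrMr // mul1r lerDr.
    by move: ab; rewrite -/b => /ltW.
  have l0 : 0 < l by rewrite divr_gt0 // mulr_gt0.
  have := convex_setE cK Kx Km l01 => Kz.
  pose a' := 1 + l * (a - 1).
  have a'1 : 1 < a' by rewrite /a' ltrDl mulr_gt0 // subr_gt0.
  apply: nP; have := @interior_scale _ K _ a'^-1 cK i0 Kz.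
  rewrite invr_ge0 invf_lt1 ?(lt_trans ltr01) // a'1 ltW ?(lt_trans ltr01) // => /(_ isT).
  congr (interior K); rewrite (perp_coord x v0) -/a -/b /chord_end /=.
  have lE : l * (b - r * a) = 2 * r * (1 - l).
    apply: (mulfI r0); rewrite /l; field; rewrite gt_eqF //.
  have bE : l * b = r * (l * a) + 2 * r * (1 - l) by lra.
  have a'0 : a' != 0 by rewrite gt_eqF // (lt_trans ltr01).
  congr (_, _).
    transitivity (a'^-1 * ((l * a + (1 - l)) * v.1 - (l * b - r * (1 - l)) * v.2) / sqn v).
      by field; rewrite v0.
    rewrite bE (_ : l * a + (1 - l) = a'); last by rewrite /a'; ring.
    rewrite (_ : r * (l * a) + 2 * r * (1 - l) - r * (1 - l) = r * a'); last by rewrite /a'; ring.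
    by field; rewrite v0.
  transitivity (a'^-1 * ((l * a + (1 - l)) * v.2 + (l * b - r * (1 - l)) * v.1) / sqn v).
    by field; rewrite v0.
  rewrite bE (_ : l * a + (1 - l) = a'); last by rewrite /a'; ring.
  rewrite (_ : r * (l * a) + 2 * r * (1 - l) - r * (1 - l) = r * a'); last by rewrite /a'; ring.
  by field; rewrite v0.
move=> x [Kx nQ].
have [v vvs xv] : exists2 v, v \in vs & 1 < `|dot x v|.
  apply: contrapT => h; apply: nQ => v vvs; rewrite /strip /= leNgt; apply/negP => xv.
  by apply: h; exists v.
suff {nQ} side y : K y -> 1 < dot y v -> unit_disk y.
  move: xv; rewrite lter_normr => /orP[|]; first exact: side.
  rewrite -dotNl => /(side _ (symmetricN sK Kx)).
  by move=> /unit_diskN; rewrite opprK.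
move=> {x Kx xv} Kx a1; rewrite /unit_disk /= -/(sqn y) leNgt; apply/negP => y1.
have v1 := sqn1 vvs.
have y0 : 0 < sqn y by exact: lt_trans ltr01 y1.
have rE := sqr_rr (ltW v1).
have [wedge|nwedge] := leP (dot y (- v.2, v.1) ^+ 2) (rr v ^+ 2 * dot y v ^+ 2).
  have := gap_systemNi gK (unit_circle_normalize y0) vvs.
  apply.
    rewrite dot_unit normrM normfV (gtr0_norm (lt_trans ltr01 a1)) gtr0_norm ?sqrtr_gt0 //.
    rewrite ler_pdivlMr ?sqrtr_gt0 // mul1r -(ger0_norm (ltW (lt_trans ltr01 a1))) -sqrtr_sqr.
    apply: ler_wsqrtr; have := dot_perp y v.
    have v0 : 0 < sqn v by exact: lt_trans ltr01 v1.
    rewrite rE in wedge => E; rewrite -(ler_pM2r v0) -E; lra.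
  have n1 : 1 < Num.sqrt (sqn y) by rewrite -{1}sqrtr1 ltr_sqrt.
  have := @interior_scale _ K y (Num.sqrt (sqn y))^-1 cK i0 Kx.
  rewrite invr_ge0 sqrtr_ge0 invf_lt1 ?(lt_trans ltr01) // n1 => /(_ isT).
  by rewrite mulrC (mulrC _ y.2).
have r0 := rr_ge0 v.
have [b0|b0] := leP 0 (dot y (- v.2, v.1)).
  apply: (main y v (rr v) vvs rE Kx a1).
  have rp : 0 < rr v by rewrite rr_gt0.
  rewrite mulr_gt0 // subr_gt0.
  by rewrite -exprMn ltr_sqr ?nnegrE // ?mulr_ge0 ?(ltW (lt_trans ltr01 a1)) in nwedge.
apply: (main y v (- rr v) vvs _ Kx a1); first by rewrite sqrrN.
have rp : 0 < rr v by rewrite rr_gt0.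
rewrite mulNr -mulrN mulr_gt0 // opprB subr_gt0 mulNr ltrNr.
have : (rr v * dot y v) ^+ 2 < (- dot y (- v.2, v.1)) ^+ 2 by rewrite exprMn sqrrN.
rewrite ltr_sqr // nnegrE; first by rewrite mulr_ge0 // ltW // (lt_trans ltr01).
by rewrite oppr_ge0 ltW.
Qed.

(** If the direction of [x] is not in a gap, [x] is a contraction of a circle point of [K]. If it
    is, the strip condition puts [x] in the triangle spanned by the origin and the two ends of the
    chord. *)
Lemma disk_polygon_sub : @unit_disk R `&` polygon vs `<=` K.
Proof.
move=> x [Dx Qx]; have [x0|xn] := eqVneq (sqn x) 0.
  suff -> : x = (0, 0) by [].
  move: x0 => /eqP; rewrite /sqn paddr_eq0 ?sqr_ge0 // !sqrf_eq0 => /andP[/eqP h1 /eqP h2].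
  by rewrite [x]surjective_pairing h1 h2.
have xp : 0 < sqn x by rewrite lt_neqAle eq_sym xn addr_ge0 // sqr_ge0.
have [g1 g2 g3 g4] := gK.
set n := Num.sqrt (sqn x); have n0 : 0 < n by rewrite sqrtr_gt0.
have n1 : n <= 1 by rewrite -sqrtr1 ler_wsqrtr.
have uc := unit_circle_normalize xp; rewrite -/n in uc.
have scale : K (x.1 / n, x.2 / n) -> K x.
  move=> Ku; have := convex_scale cK K0 Ku (_ : 0 <= n <= 1).
  rewrite n1 (ltW n0) => /(_ isT) /=; rewrite [x in K x -> _]surjective_pairing /=.
  by rewrite (surjective_pairing x) /=; congr K; congr (_, _); field; rewrite gt_eqF.
have [small|] := pselect (forall v, v \in vs -> `|dot (x.1 / n, x.2 / n) v| < 1).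
  by apply: scale; apply: interior_subset; exact: g2.
move=> /existsNP[v /not_implyP[vvs /negP]]; rewrite -leNgt le_eqVlt => /orP[/eqP/esym e1|e1].
  by apply: scale; have [] := g4 _ _ uc vvs e1.
suff side y : sqn y = sqn x -> 0 <= dot y v -> dot y v <= 1 -> n < dot y v -> K y.
  move: e1; rewrite dot_unit normrM normfV (gtr0_norm n0) ltr_pdivlMr // mul1r lter_normr => /orP[h|h].
    apply: side => //; first exact: ltW (lt_trans n0 h).
    exact: le_trans (ler_norm _) (Qx v vvs).
  rewrite -[x]opprK; apply: (symmetricN sK); apply: side; rewrite ?sqnN ?dotNl //.
    exact: ltW (lt_trans n0 h).
  by apply: le_trans (Qx v vvs); rewrite -normrN ler_norm.
move=> yx a0 a1 na.
have v1 := sqn1 vvs; have v0 : sqn v != 0 by rewrite gt_eqF // (lt_trans ltr01).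
have rE := sqr_rr (ltW v1).
have rp : 0 < rr v by rewrite rr_gt0.
have [Kp _] := chord_endK vvs rE.
have rN : (- rr v) ^+ 2 = sqn v - 1 by rewrite sqrrN.
have [Km _] := chord_endK vvs rN.
rewrite (perp_coord y v0); set b := dot y (- v.2, v.1); set a := dot y v in a0 a1 na *.
have bb : `|b| <= rr v * a.
  rewrite -[leRHS]ger0_norm ?mulr_ge0 ?rr_ge0 // -ler_sqr ?nnegrE // !real_normK ?num_real //.
  have := dot_perp y v; rewrite -/a -/b yx exprMn rE => E.
  have : sqn x < a ^+ 2.
    by rewrite -(sqr_sqrtr (ltW xp)) ltr_sqr ?nnegrE ?sqrtr_ge0.
  have vp : 0 < sqn v by exact: lt_trans ltr01 v1.
  rewrite -(ltr_pM2r vp) -E; lra.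
(* The weights are the coordinates of the point in the basis formed by the two ends of the chord;
   their sum is a = dot y v <= 1. *)
have := convex_cone_comb (a := (a + b / rr v) / 2) (b := (a - b / rr v) / 2) cK K0 Kp Km.
have bq : `|b / rr v| <= a by rewrite normrM normfV (gtr0_norm rp) ler_pdivrMr // mulrC.
move: bq; rewrite ler_norml => /andP[bq1 bq2].
have h1 : 0 <= (a + b / rr v) / 2 by lra.
have h2 : 0 <= (a - b / rr v) / 2 by lra.
have h3 : (a + b / rr v) / 2 + (a - b / rr v) / 2 <= 1 by lra.
move=> /(_ h1 h2 h3); congr K; rewrite /chord_end /=; congr (_, _);
  by field; rewrite v0 gt_eqF.
Qed.

End Hull.

(** * Centering by Brunn-Minkowski *)

Definition subgraph (R : realType) (f : R -> R) : set (R * R) :=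
  [set p | 0 < p.2 /\ p.2 < f p.1].

Lemma integral_layers (R : realType) (f : measurableTypeR R -> measurableTypeR R) :
  measurable_fun setT f -> (forall x, 0 <= f x) ->
  measurable (subgraph f : set (plane R)) /\
  (\int[lebesgue_measure]_x (f x)%:E = area (subgraph f))%E.
Proof.
move=> mf f0; split.
  have m1 : measurable_fun setT (fun p : plane R => f p.1).
    exact: (measurableT_comp mf measurable_fst).
  have m2 : measurable_fun setT (fun p : plane R => (p.2 : measurableTypeR R)) by exact: measurable_snd.
  have h1 : measurable ((fun p : plane R => p.2 < f p.1) @^-1` [set true]).
    by rewrite -[X in measurable X]setTI; exact: (measurable_fun_ltr m2 m1).
  have h2 : measurable ((fun p : plane R => 0 < p.2) @^-1` [set true]).
    have h : measurable_fun setT (fun p : plane R => 0 < p.2).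
      by apply: measurable_fun_ltr => //; exact: m2.
    by rewrite -[X in measurable X]setTI; exact: h.
  by have := measurableI _ _ h2 h1.
rewrite areaE1; apply: eq_integral => x _.
have -> : xsection (subgraph f) x = `]0, f x[%classic.
  by apply/seteqP; split => t; rewrite xsectionE /= in_itv /=;
    [by case=> -> ->|by move=> /andP[]].
rewrite lebesgue_measure_itv /= lte_fin; case: ltP => h; first by rewrite sube0.
by congr (_%:E); apply/eqP; rewrite eq_le f0 h.
Qed.

(** Each integral is the area of a subgraph, and slicing the subgraphs horizontally reduces the
    claim to the level sets. *)
Lemma le_integral_layers (R : realType) (f g : measurableTypeR R -> measurableTypeR R) :
  measurable_fun setT f -> (forall x, 0 <= f x) ->
  measurable_fun setT g -> (forall x, 0 <= g x) ->
  (forall t : R, 0 < t -> (lebesgue_measure [set x | (t < f x)%R] <= lebesgue_measure [set x | (t < g x)%R])%E) ->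
  (\int[lebesgue_measure]_x (f x)%:E <= \int[lebesgue_measure]_x (g x)%:E)%E.
Proof.
move=> mf f0 mg g0 fg.
have [mF ->] := integral_layers mf f0; have [mG ->] := integral_layers mg g0.
rewrite (areaE2 mF) (areaE2 mG).
have my (h : measurableTypeR R -> measurableTypeR R) (t : R) : 0 < t ->
    ysection (subgraph h) t = [set x | t < h x].
  by move=> t0; apply/seteqP; split => x; rewrite ysectionE; [case|split].
have my0 (h : measurableTypeR R -> measurableTypeR R) (t : R) : t <= 0 ->
    ysection (subgraph h) t = set0.
  by move=> t0; apply/seteqP; split => x //; rewrite ysectionE; case=> /=; rewrite ltNge t0.
apply: ge0_le_integral => //.
- exact: measurable_fun_ysection.
- exact: measurable_fun_ysection.
move=> t _; have [t0|t0] := ltP 0 t; first by rewrite !my //; exact: fg.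
by rewrite !my0.
Qed.

Lemma lebesgue_small (R : realType) (S : set (measurableTypeR R)) (t : R) :
  measurable S -> has_lbound S -> 0 <= t ->
  (forall y z, S y -> S z -> z - y <= t) -> (lebesgue_measure S <= t%:E)%E.
Proof.
move=> mS lS t0 H; have [->|/set0P Sne] := eqVneq S set0; first by rewrite measure0 lee_fin.
apply: (@le_trans _ _ (lebesgue_measure `[inf S, inf S + t]%classic)).
  apply: le_measure; rewrite ?inE //= => y Sy; rewrite /= in_itv /= ge_inf //=.
  rewrite -lerBlDr; apply: lb_le_inf => // z Sz.
  by have := H z y Sz Sy; lra.
rewrite lebesgue_measure_itv /= lte_fin; case: ifP => _; last by rewrite lee_fin.
by rewrite -EFinD lee_fin; lra.
Qed.

Lemma lebesgue_large (R : realType) (S : set (measurableTypeR R)) (y z : R) :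
  measurable S -> `[y, z]%classic `<=` S -> ((z - y)%:E <= lebesgue_measure S)%E.
Proof.
move=> mS yzS; apply: (@le_trans _ _ (lebesgue_measure `[y, z]%classic)).
  rewrite lebesgue_measure_itv /= lte_fin; case: ltP => h; first by rewrite -EFinD.
  by rewrite lee_fin subr_le0.
by apply: le_measure; rewrite ?inE.
Qed.

(** If x and y lie in [I], then [J] contains the whole segment from (x - y) / 2 to (y - x) / 2, of
    length y - x; these lengths approach that of [I]. *)
Lemma half_difference_interval (R : realType) (I J : set (measurableTypeR R)) :
  measurable I -> measurable J -> is_interval I -> has_lbound I -> has_ubound I ->
  (forall x y, I x -> I y -> J ((x - y) / 2)) ->
  (lebesgue_measure I <= lebesgue_measure J)%E.
Proof.
move=> mI mJ iI lI uI H; rewrite leNgt; apply/negP => JI.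
have fI : lebesgue_measure I \is a fin_num.
  have [[l Hl] [u Hu]] := (lI, uI).
  rewrite ge0_fin_numE //; apply: (@le_lt_trans _ _ (lebesgue_measure `[l, u]%classic)).
    by apply: le_measure; rewrite ?inE //= => x Ix; rewrite /= in_itv /= Hl // Hu.
  by rewrite lebesgue_measure_itv /=; case: ifP => _; rewrite ?ltry // -EFinD ltry.
have fJ : lebesgue_measure J \is a fin_num.
  by rewrite ge0_fin_numE //; apply: lt_trans JI _; rewrite -ge0_fin_numE.
set t := fine (lebesgue_measure J).
have tJ : t%:E = lebesgue_measure J by rewrite /t fineK.
have t0 : 0 <= t by exact: fine_ge0.
have [x [y [Ix Iy xy]]] : exists x y, [/\ I x, I y & t < y - x].
  apply: contrapT => nex; move: JI; rewrite ltNge -tJ => /negP; apply.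
  apply: lebesgue_small => // x y Ix Iy; rewrite leNgt; apply/negP => h.
  by apply: nex; exists x, y.
move: xy; rewrite ltNge => /negP; apply.
rewrite -lee_fin tJ.
have -> : y - x = (y - x) / 2 - (x - y) / 2 by field.
apply: lebesgue_large => // z /=; rewrite in_itv /= => /andP[z1 z2].
have [z0|z0] := leP 0 z.
  have -> : z = (x + 2 * z - x) / 2 by field.
  by apply: H => //; apply: iI Ix Iy _ _; lra.
have -> : z = (x - (x - 2 * z)) / 2 by field.
by apply: H => //; apply: iI Ix Iy _ _; lra.
Qed.

Lemma compact_bounded_coords (R : realType) (A : set (R * R)) : compact A ->
  exists B : R, forall p, A p -> `|p.1| <= B /\ `|p.2| <= B.
Proof.
move=> /compact_bounded/pinfty_ex_gt0[B B0 HB]; exists B => p /HB /=; rewrite prod_normE /=.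
by rewrite ge_max => /andP[].
Qed.

Lemma xsection_bounded (R : realType) (A : set (R * R)) (x : R) : compact A ->
  has_lbound (xsection A x) /\ (lebesgue_measure (xsection A x : set (measurableTypeR R)) < +oo)%E.
Proof.
move=> cA; have [B HB] := compact_bounded_coords cA.
have sub : xsection A x `<=` `[- B, B]%classic.
  by move=> y; rewrite xsectionE /= in_itv /= => /HB[_] /=; rewrite ler_norml.
split; first by exists (- B) => y /sub /=; rewrite in_itv /= => /andP[].
apply: (@le_lt_trans _ _ (lebesgue_measure (`[- B, B]%classic : set (measurableTypeR R)))).
  apply: le_measure; rewrite ?inE //.
  by apply: measurable_xsection; exact: (compact_fmeas cA).1.
by rewrite lebesgue_measure_itv /=; case: ifP => _; rewrite ?ltry // -EFinD ltry.
Qed.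

(* Brunn-Minkowski for [C] and [- C]: the set of abscissas whose vertical
   section of [C] is longer than [t] is an interval, and half of its difference
   set has longer sections in [M]. *)
Lemma area_half_difference (R : realType) (C M : set (R * R)) :
  compact C -> convex_set C -> compact M -> convex_set M ->
  (forall p q, C p -> C q -> M ((p.1 - q.1) / 2, (p.2 - q.2) / 2)) ->
  (area C <= area M)%E.
Proof.
move=> kC cC kM cM H.
pose len (A : set (R * R)) : measurableTypeR R -> measurableTypeR R :=
  fun x => fine (lebesgue_measure (xsection A x : set (measurableTypeR R))).
have msec (A : set (R * R)) (x : R) : compact A -> measurable (xsection A x : set (measurableTypeR R)).
  by move=> kA; exact: (measurable_xsection x (compact_fmeas kA).1).
have lenE (A : set (R * R)) (x : R) : compact A -> lebesgue_measure (xsection A x : set (measurableTypeR R)) = (len A x)%:E.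
  by move=> kA; rewrite /len fineK // ge0_fin_numE //; exact: (xsection_bounded x kA).2.
have mlen (A : set (R * R)) : compact A -> measurable_fun setT (len A).
  move=> kA; have mA := (compact_fmeas kA).1.
  have mx := @measurable_fun_xsection _ _ _ _ R (@lebesgue_measure R) A mA.
  exact: (measurableT_comp (fine_measurable measurableT) mx).
have len0 (A : set (R * R)) (x : R) : 0 <= len A x by exact: fine_ge0.
have areaE (A : set (R * R)) : compact A -> area A = (\int[lebesgue_measure]_x (len A x)%:E)%E.
  move=> kA; rewrite areaE1; apply: (@eq_integral _ _ _ lebesgue_measure) => x _.
  exact: lenE.
have long (A : set (R * R)) (x t : R) : compact A -> 0 < t -> t < len A x ->
    exists y z, [/\ A (x, y), A (x, z) & t < z - y].
  move=> kA t0 tl; apply: contrapT => nex; move: tl; rewrite ltNge => /negP; apply.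
  rewrite -lee_fin -lenE //; apply: lebesgue_small (ltW t0) _; first exact: msec.
    exact: (xsection_bounded x kA).1.
  move=> y z; rewrite !xsectionE => Ay Az; rewrite leNgt; apply/negP => h.
  by apply: nex; exists y, z.
have seg (A : set (R * R)) (x y z : R) : compact A -> (forall w, y <= w <= z -> A (x, w)) -> z - y <= len A x.
  move=> kA h; rewrite -lee_fin -lenE //; apply: lebesgue_large; first exact: msec.
  by move=> w; rewrite /= in_itv xsectionE /= => /h.
rewrite !areaE //; apply: le_integral_layers => //; [exact: mlen|exact: mlen|].
move=> t t0.
have mlev (A : set (R * R)) : compact A -> measurable ([set x | t < len A x] : set (measurableTypeR R)).
  move=> kA; have h : measurable ((fun x : measurableTypeR R => t < len A x) @^-1` [set true]).
    have h : measurable_fun setT (fun x : measurableTypeR R => t < len A x).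
      by apply: measurable_fun_ltr => //; exact: mlen.
    by rewrite -[X in measurable X]setTI; exact: h.
  exact: h.
have vert (A : set (R * R)) (x y z w : R) : convex_set A -> A (x, y) -> A (x, z) -> y < z -> y <= w <= z -> A (x, w).
  move=> cA Ay Az yz /andP[w1 w2].
  have zy : 0 < z - y by rewrite subr_gt0.
  have := convex_setE (t := (w - y) / (z - y)) cA Az Ay _.
  rewrite divr_ge0 ?subr_ge0 ?(ltW yz) //= ler_pdivrMr // mul1r lerD2r w2 => /(_ isT).
  congr A; congr (_, _); field; rewrite gt_eqF //.
apply: half_difference_interval; [exact: mlev|exact: mlev|..].
- move=> x1 x2 /= h1 h2 x /andP[]; rewrite le_eqVlt => /orP[/eqP <- //|xx1].
  rewrite le_eqVlt => /orP[/eqP -> //|xx2].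
  have [y1 [z1 [Cy1 Cz1 t1]]] := long C x1 t kC t0 h1.
  have [y2 [z2 [Cy2 Cz2 t2]]] := long C x2 t kC t0 h2.
  have x12 : 0 < x2 - x1 by rewrite subr_gt0 (lt_trans xx1).
  pose s := (x2 - x) / (x2 - x1).
  have s01 : 0 <= s <= 1.
    by rewrite /s divr_ge0 ?(ltW x12) ?subr_ge0 ?(ltW xx2) //= ler_pdivrMr // mul1r lerD2l lerN2 ltW.
  have sE : s * x1 + (1 - s) * x2 = x by rewrite /s; field; rewrite gt_eqF.
  have := convex_setE cC Cy1 Cy2 s01; have := convex_setE cC Cz1 Cz2 s01; rewrite /= sE => Cz Cy.
  have /andP[s0 s1] := s01.
  have tyz : t < (s * z1 + (1 - s) * z2) - (s * y1 + (1 - s) * y2).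
    rewrite (_ : _ - _ = s * (z1 - y1) + (1 - s) * (z2 - y2)); last by ring.
    have [s0'|s0'] := eqVneq s 0; first by rewrite s0' mul0r add0r subr0 mul1r.
    have sp : 0 < s by rewrite lt_neqAle eq_sym s0'.
    have k1 : s * t < s * (z1 - y1) by rewrite ltr_pM2l.
    have k2 : (1 - s) * t <= (1 - s) * (z2 - y2) by rewrite ler_wpM2l ?subr_ge0 // ltW.
    lra.
  have /(lt_trans t0) yz := tyz; rewrite subr_gt0 in yz.
  apply: lt_le_trans tyz _; apply: seg => // w; exact: vert Cy Cz yz.
- have [B HB] := compact_bounded_coords kC.
  exists (- B) => x /(long C x t kC t0)[y [_ [/HB[+ _] _ _]]] /=.
  by rewrite ler_norml => /andP[].
- have [B HB] := compact_bounded_coords kC.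
  exists B => x /(long C x t kC t0)[y [_ [/HB[+ _] _ _]]] /=.
  by rewrite ler_norml => /andP[].
move=> x1 x2 /= /(long C _ _ kC t0)[y1 [z1 [Cy1 Cz1 t1]]] /(long C _ _ kC t0)[y2 [z2 [Cy2 Cz2 t2]]].
(* Pairing the upper end over one abscissa with the lower end over the other, and conversely, gives
   a vertical segment of [M] whose length is the mean of the two lengths, hence more than [t]. *)
have M1 := H _ _ Cz1 Cy2; have M2 := H _ _ Cy1 Cz2; rewrite /= in M1 M2.
apply: (@lt_le_trans _ _ ((z1 - y2) / 2 - (y1 - z2) / 2)); first lra.
by apply: seg => // w; apply: vert M2 M1 _ => //; lra.
Qed.

(** * Sufficiency *)

Definition hy (R : realType) (v : R * R) : R := rr v * (2 * v.1 * v.2) / sqn v ^+ 2.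

Definition rot (R : realType) (c s : R) (v : R * R) : R * R :=
  (c * v.1 + s * v.2, - s * v.1 + c * v.2).

Section Rotation.
Variables (R : realType) (c s : R).
Hypothesis cs : c ^+ 2 + s ^+ 2 = 1.

Lemma sqn_rot v : sqn (rot c s v) = sqn v.
Proof. by rewrite /sqn /rot /= -[RHS]mulr1 -cs; ring. Qed.

Lemma dot_rot u v : dot (rot c s u) (rot c s v) = dot u v.
Proof. by rewrite /dot /rot /= -[RHS]mulr1 -cs; ring. Qed.

Lemma rr_rot v : rr (rot c s v) = rr v.
Proof. by rewrite /rr sqn_rot. Qed.

Lemma unit_disk_rot v : unit_disk (rot c s v) = unit_disk v.
Proof. by rewrite /unit_disk /= -/(sqn (rot c s v)) sqn_rot. Qed.

(** [rot] is multiplication by c - i s, so it multiplies hh + i hy by (c - i s)^2. *)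
Lemma hh_rot v : hh (rot c s v) = (c ^+ 2 - s ^+ 2) * hh v + 2 * c * s * hy v.
Proof.
rewrite /hh /hy rr_rot sqn_rot /rot /=; ring.
Qed.

Lemma rot_det : `|c * c - s * - s| = 1.
Proof. by rewrite mulrN opprK -!expr2 cs normr1. Qed.

Lemma ar_rot (A : set (plane R)) : measurable A -> ar [set x | A (rot c s x)] = ar A.
Proof. by move=> mA; rewrite -[RHS](ar_linear rot_det mA). Qed.

Lemma measurable_rot (A : set (plane R)) : measurable A ->
  measurable ([set x | A (rot c s x)] : set (plane R)).
Proof. exact: measurable_linear_preimage. Qed.

Lemma strict_rot vs : strict (map (rot c s) vs) = strict vs.
Proof.
rewrite /strict all_map pairwise_map; congr (_ && _).
  by apply: eq_all => v; rewrite /= sqn_rot.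
by apply: eq_pairwise => u v; rewrite /= /pair_lt dot_rot !rr_rot.
Qed.

Lemma polygon_rot vs x : polygon (map (rot c s) vs) (rot c s x) = polygon vs x.
Proof.
apply/propext; split => H v vvs; last first.
  by move: vvs => /mapP[w wvs ->]; rewrite /strip /= dot_rot; exact: H.
by have := H _ (map_f (rot c s) vvs); rewrite /strip /= dot_rot.
Qed.

End Rotation.

(* [l] is the least eigenvalue of the matrix [a, b; b, d] of determinant 1. *)
Lemma diagonalize_form (R : realType) (a b d : R) : 0 < a -> a * d - b ^+ 2 = 1 ->
  exists c s l : R, [/\ c ^+ 2 + s ^+ 2 = 1, 0 < l <= 1 &
    forall x y, a * x ^+ 2 + 2 * b * x * y + d * y ^+ 2 =
      l * (c * x + s * y) ^+ 2 + l^-1 * (- s * x + c * y) ^+ 2].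
Proof.
move=> a0 det; set T := a + d.
have d0 : 0 < d.
  by rewrite -(pmulr_rgt0 _ a0); have := sqr_ge0 b; lra.
have T0 : 0 < T by rewrite addr_gt0.
have TT : 4 <= T ^+ 2.
  have := sqr_ge0 (a - d); have := sqr_ge0 b.
  rewrite (_ : T ^+ 2 = (a - d) ^+ 2 + 4 * (a * d)); last by rewrite /T; ring.
  lra.
have T2 : 2 <= T.
  rewrite -ler_sqr ?nnegrE ?(ltW T0) //.
  by rewrite (_ : 2 ^+ 2 = 4) //; ring.
pose q := Num.sqrt (T ^+ 2 - 4).
have q0 : 0 <= q by exact: sqrtr_ge0.
have qq : q ^+ 2 = T ^+ 2 - 4 by rewrite sqr_sqrtr // subr_ge0.
pose l := (T - q) / 2.
have lE : l ^+ 2 - T * l + 1 = 0.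
  rewrite (_ : _ + 1 = (q ^+ 2 - (T ^+ 2 - 4)) / 4); last by rewrite /l; field.
  by rewrite qq subrr mul0r.
have ll : l * (T - l) = 1 by move: lE; rewrite expr2 mulrBr (mulrC T); lra.
have qT : q < T by rewrite -ltr_sqr ?nnegrE ?(ltW T0) // qq; lra.
have l0 : 0 < l by rewrite /l; lra.
have l1 : l <= 1.
  rewrite leNgt; apply/negP => h.
  have : 1 < T - l by rewrite /l; move: h; rewrite /l; lra.
  move=> h'; have : 1 * 1 < l * (T - l) by apply: ltr_pM.
  by rewrite ll mul1r ltxx.
have mE : l^-1 = T - l by apply: (mulfI (lt0r_neq0 l0)); rewrite mulfV ?gt_eqF // ll.
have key : (a - l) * (d - l) = b ^+ 2.
  rewrite (_ : _ * _ = a * d - T * l + l ^+ 2); last by rewrite /T; ring.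
  lra.
have [dl|dl] := eqVneq d l.
  have b0 : b = 0 by apply/eqP; rewrite -sqrf_eq0 -key dl subrr mulr0.
  exists 0, 1, l; split; [ring|by rewrite l0|move=> x y].
  by rewrite b0 mE /T dl; ring.
have dl0 : d - l != 0 by rewrite subr_eq0.
have lm : 0 <= T - 2 * l by rewrite /l; lra.
have nE : (d - l) ^+ 2 + b ^+ 2 = (d - l) * (T - 2 * l) by rewrite -key /T; ring.
have n0 : 0 < (d - l) ^+ 2 + b ^+ 2.
  by rewrite ltr_pwDl ?sqr_ge0 // lt_neqAle eq_sym expf_neq0 // sqr_ge0.
set n := (d - l) ^+ 2 + b ^+ 2 in nE n0.
have m0 : T - 2 * l != 0 by apply: contraTneq n0 => m0; rewrite nE m0 mulr0 ltxx.
have sn : Num.sqrt n ^+ 2 = n by rewrite sqr_sqrtr // ltW.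
have sn0 : Num.sqrt n != 0 by rewrite gt_eqF // sqrtr_gt0.
(* The vector (d - l, - b) is an eigenvector for [l]; it vanishes only for d = l, the case treated
   before. *)
exists ((d - l) / Num.sqrt n), (- b / Num.sqrt n), l; split; [|by rewrite l0|].
  by rewrite !expr_div_n sn sqrrN -mulrDl divff // gt_eqF.
move=> x y.
transitivity (l * ((((d - l) * x - b * y) ^+ 2) / Num.sqrt n ^+ 2) +
   l^-1 * (((b * x + (d - l) * y) ^+ 2) / Num.sqrt n ^+ 2)).
  2: by field; rewrite ?sn0 ?(gt_eqF l0).
rewrite sn mE nE.
transitivity (l * (x ^+ 2 + y ^+ 2) + (T - 2 * l) *
  ((b * x + (d - l) * y) ^+ 2 / ((d - l) * (T - 2 * l)))).
  have bE : (b * x + (d - l) * y) ^+ 2 / ((d - l) * (T - 2 * l)) * (T - 2 * l) =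
     (a - l) * x ^+ 2 + 2 * b * x * y + (d - l) * y ^+ 2.
    transitivity ((b ^+ 2 * x ^+ 2 + 2 * b * (d - l) * x * y + (d - l) ^+ 2 * y ^+ 2) / (d - l)).
      by field; rewrite ?m0 ?dl0.
    by rewrite -key; field; rewrite ?dl0.
  by rewrite [(T - 2 * l) * _]mulrC bE; ring.
have e : ((d - l) * x - b * y) ^+ 2 + (b * x + (d - l) * y) ^+ 2 = n * (x ^+ 2 + y ^+ 2).
  by rewrite /n; ring.
rewrite nE in e.
have -> : ((d - l) * x - b * y) ^+ 2 = (d - l) * (T - 2 * l) * (x ^+ 2 + y ^+ 2) - (b * x + (d - l) * y) ^+ 2.
  by rewrite -e addrK.
by field; rewrite ?m0 ?dl0.
Qed.

Lemma convex_setP (R : realType) (A : set (R * R)) :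
  (forall x y (t : R), A x -> A y -> 0 <= t <= 1 ->
    A (t * x.1 + (1 - t) * y.1, t * x.2 + (1 - t) * y.2)) -> convex_set A.
Proof.
move=> H x y t /set_mem Ax /set_mem Ay; apply/mem_set.
by have := H x y t%:num Ax Ay; rewrite ge0 le1 => /(_ isT); congr A.
Qed.

(** Ellipses are handled as preimages of the disk: membership becomes a polynomial inequality, from
    which closedness follows directly. *)
Definition affine_disk (R : realType) (p q e r s f : R) : set (R * R) :=
  [set y | unit_disk (p * y.1 + q * y.2 + e, r * y.1 + s * y.2 + f)].

Lemma closed_affine_disk (R : realType) (p q e r s f : R) : closed (affine_disk p q e r s f).
Proof.
have lin (a b c : R) : continuous (fun y : R * R => a * y.1 + b * y.2 + c).
  move=> y; apply: cvgD; last exact: cvg_cst.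
  apply: cvgD; apply: cvgM; try exact: cvg_cst; [exact: continuous_fst|exact: continuous_snd].
apply: (@preimage_closed _ _ (fun y : R * R => (p * y.1 + q * y.2 + e) ^+ 2 +
  (r * y.1 + s * y.2 + f) ^+ 2) [set t | t <= 1]); last exact: closed_le.
move=> y _; rewrite /continuous_at; apply: cvgD; rewrite !expr2; apply: cvgM; exact: lin.
Qed.

Lemma convex_unit_disk (R : realType) (x y : R * R) (t : R) : unit_disk x -> unit_disk y ->
  0 <= t <= 1 -> unit_disk (t * x.1 + (1 - t) * y.1, t * x.2 + (1 - t) * y.2).
Proof.
rewrite /unit_disk /= => Dx Dy /andP[t0 t1].
have h := mulr_ge0 t0 (_ : 0 <= 1 - t); rewrite subr_ge0 in h.
have := mulr_ge0 (h t1) (addr_ge0 (sqr_ge0 (x.1 - y.1)) (sqr_ge0 (x.2 - y.2))).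
have k1 : t * (x.1 ^+ 2 + x.2 ^+ 2) <= t * 1 by rewrite ler_wpM2l.
have k2 : (1 - t) * (y.1 ^+ 2 + y.2 ^+ 2) <= (1 - t) * 1 by rewrite ler_wpM2l // subr_ge0.
move=> k3; rewrite -subr_ge0.
rewrite (_ : 1 - _ = t * (1 - t) * ((x.1 - y.1) ^+ 2 + (x.2 - y.2) ^+ 2) +
  (t * 1 - t * (x.1 ^+ 2 + x.2 ^+ 2)) + ((1 - t) * 1 - (1 - t) * (y.1 ^+ 2 + y.2 ^+ 2))); last by ring.
by apply: addr_ge0; [apply: addr_ge0|]; rewrite // subr_ge0.
Qed.

Lemma convex_affine_diskI (R : realType) (p q e r s f : R) (K : set (R * R)) :
  convex_set K -> convex_set (affine_disk p q e r s f `&` K).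
Proof.
move=> cK; apply: convex_setP => x y t [Dx Kx] [Dy Ky] t01; split; last exact: convex_setE.
have := convex_unit_disk Dx Dy t01; rewrite /affine_disk /=.
congr unit_disk; congr (_, _); ring.
Qed.

(* Centering: [C = E' `&` K] and [- C] have their midpoints in the centered
   intersection. *)
Lemma area_affine_disk_center (R : realType) (p q e r s f : R) (K : set (R * R)) :
  compact K -> convex_set K -> centrally_symmetric K ->
  (area (affine_disk p q e r s f `&` K) <= area (affine_disk p q 0 r s 0 `&` K))%E.
Proof.
move=> kK cK sK.
have kI e' f' : compact (affine_disk p q e' r s f' `&` K).
  rewrite setIC; apply: compact_closedI => //; exact: closed_affine_disk.
apply: area_half_difference; [exact: kI|exact: convex_affine_diskI|exact: kI|
  exact: convex_affine_diskI|].
move=> x y [Dx Kx] [Dy Ky].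
have h : 0 <= (2^-1 : R) <= 1 by apply/andP; split; lra.
split.
  have := convex_unit_disk Dx (unit_diskN Dy) h; rewrite /affine_disk /=.
  by congr unit_disk; congr (_, _); field.
rewrite (_ : (_, _) = (2^-1 * x.1 + (1 - 2^-1) * (- y).1, 2^-1 * x.2 + (1 - 2^-1) * (- y).2)).
  exact: convex_setE cK Kx (symmetricN sK Ky) h.
by congr (_, _) => /=; field.
Qed.

Section Sufficiency.
Variables (R : realType) (K : set (R * R)) (vs : seq (R * R)).
Hypotheses (kK : compact K) (cK : convex_set K) (sK : centrally_symmetric K).
Hypotheses (i0 : interior K (0, 0)) (gK : gap_system K vs).
Hypotheses (sum_hh : \sum_(v <- vs) hh v = 0) (sum_hy : \sum_(v <- vs) hy v = 0).

Lemma ar_flow_rot_le (c s l : R) : c ^+ 2 + s ^+ 2 = 1 -> 0 <= l ->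
  ar ([set y | unit_disk (flow (- l) (rot c s y))] `&` K) <= ar (@unit_disk R `&` K).
Proof.
move=> cs l0; have fK := compact_fmeas kK.
have mD := (fmeas_unit_disk R).1; have mQ := measurable_polygon vs.
set E := [set y | _].
have mE : measurable (E : set (plane R)).
  exact: (measurable_rot c s (measurable_flow (- l) mD)).
have fKQ := fmeasD fK mQ.
have fEK := fmeasIl fK mE.
have EK : ar (E `&` K) <= ar (E `&` polygon vs) + ar (K `\` polygon vs).
  rewrite setIC (ar_setD fEK mQ); apply: lerD; last first.
    by apply: le_ar => [||x [[Kx _] Qx]] //; exact: (fmeasD fEK mQ).1.
  apply: le_ar => [||x [[_ Ex] Qx]] //; first exact: (fmeasIl fEK mQ).1.
  suff : fmeas E by move=> fE; exact: fmeasIl.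
  split => //; rewrite -[E]/([set x | [set z | unit_disk (flow (- l) z)] (rot c s x)]).
  have mF := measurable_flow (- l) mD.
  rewrite (_ : area _ = area [set z | unit_disk (flow (- l) z)]); last first.
    by rewrite -(area_linear (rot_det cs) mF).
  by rewrite area_flow //; exact: (fmeas_unit_disk R).2.
apply: le_trans EK _.
have -> : ar (@unit_disk R `&` K) = ar (@unit_disk R `&` polygon vs) + ar (K `\` polygon vs).
  rewrite setIC (ar_setD (fmeasIl fK mD) mQ); congr (ar _ + ar _); apply/seteqP; split => x.
  - by case=> -[].
  - by move=> [Dx Qx]; split => //; split => //; exact: (disk_polygon_sub cK sK i0 gK).
  - by case=> -[].
  - move=> [Kx Qx]; split => //; split => //.
    exact: (outside_polygon_sub_disk cK sK i0 gK).
rewrite lerD2r.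
pose ws := map (rot c s) vs.
have mW := measurable_polygon ws.
have mB : measurable ([set x | unit_disk x /\ polygon ws (flow l x)] : set (plane R)).
  exact: measurableI mD (measurable_flow l mW).
have mA : measurable ([set z | unit_disk (flow (- l) z) /\ polygon ws z] : set (plane R)).
  exact: measurableI (measurable_flow (- l) mD) mW.
have -> : ar (E `&` polygon vs) = FF ws l.
  transitivity (ar [set x | [set z | unit_disk (flow (- l) z) /\ polygon ws z] (rot c s x)]).
    by congr ar; apply/seteqP; split => x /=; rewrite polygon_rot.
  rewrite (ar_rot cs mA) /FF polygon_flow -[RHS](ar_flow (- l) mB); congr ar.
  by apply/seteqP; split => x /=; rewrite -flowD subrr flow0.
have -> : ar (@unit_disk R `&` polygon vs) = FF ws 0.
  rewrite FF_0 -[RHS](ar_rot cs (measurableI _ _ mD mW)); congr ar.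
  by apply/seteqP; split => x /=; rewrite unit_disk_rot // polygon_rot.
apply: flow_mono l0; first by apply: strict_ok; rewrite strict_rot //; case: gK.
rewrite big_map; under eq_bigr do rewrite hh_rot //.
by rewrite big_split /= -!mulr_sumr sum_hh sum_hy !mulr0 addr0.
Qed.

Lemma area_centered_le (p q r s : R) : `|p * s - q * r| = 1 ->
  (area (affine_disk p q 0 r s 0 `&` K) <= area (@unit_disk R `&` K))%E.
Proof.
move=> det; have fK := compact_fmeas kK.
have det2 : (p * s - q * r) ^+ 2 = 1 by rewrite -real_normK ?num_real // det expr1n.
have a0 : 0 < p ^+ 2 + r ^+ 2.
  rewrite lt_neqAle addr_ge0 ?sqr_ge0 // andbT eq_sym.
  apply: contraTneq isT => h; exfalso; move/eqP: h.
  rewrite paddr_eq0 ?sqr_ge0 // !sqrf_eq0 => /andP[/eqP p0 /eqP r0].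
  by move: det2; rewrite p0 r0 mul0r mulr0 subrr expr0n /= => /eqP; rewrite eq_sym oner_eq0.
have := @diagonalize_form R (p ^+ 2 + r ^+ 2) (p * q + r * s) (q ^+ 2 + s ^+ 2) a0.
case; first by rewrite -det2; ring.
move=> c [t [l [cs /andP[l0 l1] lE]]].
(* A centered ellipse depends only on the quadratic form of its matrix. With eigenvalues [l] and 1/l
   in a rotated basis, it is the preimage of the disk under a rotation followed by the flow at time
   [- k]. *)
pose k := - ln l / 2.
have k0 : 0 <= k by rewrite divr_ge0 // oppr_ge0 ln_le0.
have e1 : expR (- k) ^+ 2 = l.
  by rewrite expr2 -expRD (_ : - k + - k = ln l) ?lnK ?posrE //; rewrite /k; field.
have e2 : expR k ^+ 2 = l^-1.
  by rewrite -e1 -exprVn -expRN opprK.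
have -> : affine_disk p q 0 r s 0 = [set y | unit_disk (flow (- k) (rot c t y))].
  apply/seteqP; split => y; rewrite /affine_disk /unit_disk /flow /rot /= opprK !exprMn e1 e2 -lE;
  by congr (_ <= _); ring.
have mD := (fmeas_unit_disk R).1.
have mE : measurable ([set y | unit_disk (flow (- k) (rot c t y))] : set (plane R)).
  exact: (measurable_rot c t (measurable_flow (- k) mD)).
have f1 : fmeas ([set y | unit_disk (flow (- k) (rot c t y))] `&` K).
  by rewrite setIC; exact: fmeasIl.
have f2 : fmeas (@unit_disk R `&` K) by exact: fmeasIl (fmeas_unit_disk R) fK.1.
by rewrite (areaEr f1) (areaEr f2) lee_fin; exact: ar_flow_rot_le.
Qed.

End Sufficiency.

(** * Ellipses as affine preimages of the disk *)

Definition lin2 (R : realType) (a b c d : R) (x : R * R) : R * R :=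
  (a * x.1 + b * x.2, c * x.1 + d * x.2).

Lemma lin2_is_linear (R : realType) (a b c d : R) : linear (@lin2 R a b c d).
Proof.
move=> k x y; rewrite /lin2; congr (_, _) => /=; rewrite /GRing.scale /=; ring.
Qed.

HB.instance Definition _ (R : realType) (a b c d : R) :=
  GRing.isLinear.Build R (R * R)%type (R * R)%type _ (@lin2 R a b c d) (@lin2_is_linear R a b c d).

Lemma ellipse_affine_disk (R : realType) (p q e r s f : R) :
  p * s - q * r != 0 -> ellipse (affine_disk p q e r s f).
Proof.
set D := p * s - q * r => D0.
pose g := lin2 (s / D) (- q / D) (- r / D) (p / D).
have gK : cancel g (lin2 p q r s).
  move=> x; rewrite [RHS]surjective_pairing /g /lin2 /=; congr (_, _); rewrite /D; field; exact: D0.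
have Kg : cancel (lin2 p q r s) g.
  move=> x; rewrite [RHS]surjective_pairing /g /lin2 /=; congr (_, _); rewrite /D; field; exact: D0.
exists g, (g (- e, - f)); split; first by exists (lin2 p q r s).
have E y : lin2 p q r s (y - g (- e, - f)) = (p * y.1 + q * y.2 + e, r * y.1 + s * y.2 + f).
  by rewrite raddfB /= gK /lin2 /=; congr (_, _); rewrite /= opprK.
apply/seteqP; split => [y Dy|_ [x Dx <-]].
  exists (lin2 p q r s (y - g (- e, - f))); first by rewrite E.
  by rewrite -[LHS]/(g (lin2 p q r s (y - g (- e, - f))) + g (- e, - f)) Kg subrK.
have xE := E (g x + g (- e, - f)); rewrite addrK gK in xE.
by rewrite xE in Dx; exact: Dx.
Qed.

Lemma affine_disk_of_ellipse (R : realType) (E : set (R * R)) : ellipse E ->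
  exists p q e r s f : R, p * s - q * r != 0 /\ E = affine_disk p q e r s f.
Proof.
move=> [g [b [bg ->]]].
have [g1 gK Kg] := bg.
pose a := (g (1, 0)).1; pose c := (g (1, 0)).2.
pose a' := (g (0, 1)).1; pose c' := (g (0, 1)).2.
have gE x : g x = (a * x.1 + a' * x.2, c * x.1 + c' * x.2).
  have -> : x = x.1 *: (1, 0) + x.2 *: (0, 1).
    rewrite [LHS]surjective_pairing; congr (_, _); rewrite /= /GRing.scale /=; ring.
  rewrite linearD !linearZ /= [LHS]surjective_pairing; congr (_, _);
    rewrite /a /c /a' /c' /= /GRing.scale /=; ring.
set D := a * c' - a' * c.
have ginj : injective g := bij_inj bg.
have D0 : D != 0.
  (* If the determinant vanished, (c', - c) and (- a', a) would be in the kernel, hence zero by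
     injectivity, and then (1, 0) would be in the kernel too. *)
  apply/eqP => D0.
  have z0 : g (0, 0) = 0 by rewrite gE /= !mulr0 addr0.
  have : (c', - c) = (0, 0) :> R * R.
    apply: ginj; rewrite z0 gE /=; congr (_, _).
      by rewrite -[RHS]D0 /D; ring.
    ring.
  have : (- a', a) = (0, 0) :> R * R.
    apply: ginj; rewrite z0 gE /=; congr (_, _); first by ring.
    by rewrite -[RHS]D0 /D; ring.
  move=> [_ a0] [_ /eqP]; rewrite oppr_eq0 => /eqP c0.
  have : (1, 0) = (0, 0) :> R * R.
    by apply: ginj; rewrite z0 gE /= a0 c0 !mulr0 !mul0r addr0.
  by move=> [/eqP]; rewrite oner_eq0.
exists (c' / D), (- a' / D), ((a' * b.2 - c' * b.1) / D), (- c / D), (a / D), ((c * b.1 - a * b.2) / D).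
split.
  rewrite (_ : _ - _ = D^-1) ?invr_eq0 // /D; field; exact: D0.
apply/seteqP; split => [_ [x Dx <-]|y Dy].
  rewrite /affine_disk /= gE /=; move: Dx; congr unit_disk; rewrite [LHS]surjective_pairing.
  by congr (_, _); rewrite /D; field.
exists (c' / D * y.1 + - a' / D * y.2 + (a' * b.2 - c' * b.1) / D,
  - c / D * y.1 + a / D * y.2 + (c * b.1 - a * b.2) / D) => //.
rewrite gE [RHS]surjective_pairing; congr (_, _); rewrite /= /D; field; exact: D0.
Qed.

Lemma area_affine_disk (R : realType) (p q e r s f : R) : p * s - q * r != 0 ->
  area (affine_disk p q e r s f) = (`|p * s - q * r|^-1%:E * area (@unit_disk R))%E.
Proof. by move=> D0; exact: (area_affine e f D0 (fmeas_unit_disk R).1). Qed.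

Lemma ar_unit_disk_gt0 (R : realType) : 0 < ar (@unit_disk R).
Proof.
have h : ar (`]0, 2^-1]%classic `*` `[0, 2^-1]%classic) <= ar (@unit_disk R).
  apply: le_ar; [exact: (fmeas_rect _ _ _ _).1|exact: fmeas_unit_disk|].
  move=> -[x y] [/=]; rewrite !in_itv /= => /andP[x0 x1] /andP[y0 y1].
  rewrite /unit_disk /=; nra.
apply: lt_le_trans h; rewrite ar_rect ?invr_ge0 // !subr0 mulr_gt0 // invr_gt0 //.
Qed.

Lemma ellipse_same_area (R : realType) (E : set (R * R)) : ellipse E ->
  area E = area (@unit_disk R) ->
  exists p q e r s f : R, `|p * s - q * r| = 1 /\ E = affine_disk p q e r s f.
Proof.
move=> /affine_disk_of_ellipse[p [q [e [r [s [f [D0 ->]]]]]]].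
rewrite (area_affine_disk e f D0) (areaEr (fmeas_unit_disk R)) -EFinM => -[h].
exists p, q, e, r, s, f; split => //.
have a0 := ar_unit_disk_gt0 R.
have := congr1 (fun x => x / ar (@unit_disk R)) h; rewrite mulfK ?gt_eqF // divff ?gt_eqF //.
by move=> /(congr1 GRing.inv); rewrite invrK invr1.
Qed.

Lemma ellipse_unit_disk (R : realType) : ellipse (@unit_disk R).
Proof.
have -> : @unit_disk R = affine_disk 1 0 0 0 1 0.
  by apply/seteqP; split => x; rewrite /affine_disk /unit_disk /= !mul1r !mul0r !addr0 add0r.
by apply: ellipse_affine_disk; rewrite mulr1 mulr0 subr0 oner_neq0.
Qed.

Lemma MI_position_gap_system (R : realType) (K : set (R * R)) (vs : seq (R * R)) :
  compact K -> convex_set K -> centrally_symmetric K -> interior K (0, 0) ->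
  gap_system K vs -> \sum_(v <- vs) hh v = 0 -> \sum_(v <- vs) hy v = 0 ->
  MI_position K.
Proof.
move=> kK cK sK i0 gK h1 h2; split; first exact: ellipse_unit_disk.
move=> E' /ellipse_same_area H /H [p [q [e [r [s [f [det ->]]]]]]].
apply: le_trans (area_affine_disk_center p q e r s f kK cK sK) _.
exact: area_centered_le gK h1 h2 _ _ _ _ det.
Qed.

Lemma MI_position_subset (R : realType) (K : set (R * R)) :
  compact K -> K `<=` @unit_disk R -> MI_position K.
Proof.
move=> kK KD; split; first exact: ellipse_unit_disk.
move=> E' /ellipse_same_area H /H [p [q [e [r [s [f [det ->]]]]]]].
have mK := (compact_fmeas kK).1.
rewrite (_ : @unit_disk R `&` K = K); last first.
  by apply/seteqP; split => [x []|x Kx] //; split => //; exact: KD.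
have mE : measurable (affine_disk p q e r s f : set (plane R)).
  by apply: closed_measurable2; exact: closed_affine_disk.
by apply: (le_area (measurableI _ _ mE mK) mK) => x [].
Qed.

(** * Necessity *)

Definition scl (R : realType) (l : R) (v : R * R) : R * R := (l * v.1, l * v.2).

Lemma sqn_scl (R : realType) (l : R) (v : R * R) : sqn (scl l v) = l ^+ 2 * sqn v.
Proof. by rewrite /sqn /scl /=; ring. Qed.

Lemma dot_sclr (R : realType) (l : R) (u v : R * R) : dot u (scl l v) = l * dot u v.
Proof. by rewrite /dot /scl /=; ring. Qed.

Lemma area_le_slices (R : realType) (A : set (plane R)) (c : R) : measurable A ->
  (forall p, A p -> -1 <= p.1 <= 1) ->
  (forall x, (lebesgue_measure (xsection A x) <= c%:E)%E) -> 0 <= c ->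
  (area A <= (2 * c)%:E)%E.
Proof.
move=> mA A1 Ac c0; rewrite areaE1.
pose I0 : set (measurableTypeR R) := `[-1, 1]%classic.
have mi : measurable_fun setT
    (fun x => (\1_I0 x)%:E : \bar R).
  by apply/measurable_EFinP; apply: measurable_indic; exact: measurable_itv.
apply: (@le_trans _ _ (\int[lebesgue_measure]_x (c%:E * (\1_I0 x)%:E))%E).
  apply: ge0_le_integral => //.
  - exact: measurable_fun_xsection.
  - exact: measurable_funeM.
  move=> x _; rewrite indicE.
  have [h|h] := pselect (I0 x).
    by rewrite mem_set // mule1.
  rewrite memNset // mule0 (_ : xsection A x = set0) ?measure0 //.
  apply/seteqP; split => y //; rewrite xsectionE /= => /A1 /= h'.
  by apply: h; rewrite /I0 /= in_itv.
rewrite ge0_integralZl //.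
have -> : (\int[lebesgue_measure]_x (\1_I0 x)%:E =
    lebesgue_measure I0)%E.
  by rewrite integral_indic ?setIT //; exact: measurable_itv.
rewrite /I0 lebesgue_measure_itv /= lte_fin (_ : (-1 < 1 :> R) = true); last by apply/idP; lra.
by rewrite -EFinD -EFinM lee_fin; lra.
Qed.

(* The cone of directions at which the circle crosses the lines [dot x v = 1]
   and [dot x v = - 1], up to the tolerance [e]. *)
Definition crossing_cone (R : realType) (e : R) (v : R * R) : set (R * R) :=
  [set x | ((1 - e) * dot x v) ^+ 2 <= sqn x /\ sqn x <= ((1 + e) * dot x v) ^+ 2].

Lemma measurable_crossing_cone (R : realType) (e : R) (v : R * R) :
  measurable (crossing_cone e v : set (plane R)).
Proof.
have cd k : continuous (fun x : R * R => (k * dot x v) ^+ 2).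
  move=> x; rewrite /continuous_at expr2; apply: cvgM; apply: cvgM;
    try exact: cvg_cst; exact: continuous_dot.
have cs : continuous (fun x : R * R => sqn x) by exact: continuous_sqnorm.
have -> : crossing_cone e v =
    [set x | 0 <= sqn x - ((1 - e) * dot x v) ^+ 2] `&`
    [set x | 0 <= ((1 + e) * dot x v) ^+ 2 - sqn x].
  by apply/seteqP; split => x; rewrite /crossing_cone /= !subr_ge0.
apply: closed_measurable2; apply: closedI.
  apply: (@preimage_closed _ _ (fun x : R * R => sqn x - ((1 - e) * dot x v) ^+ 2) [set t | 0 <= t]).
    by move=> x _; apply: cvgB; [exact: cs|exact: cd].
  exact: closed_ge.
apply: (@preimage_closed _ _ (fun x : R * R => ((1 + e) * dot x v) ^+ 2 - sqn x) [set t | 0 <= t]).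
  by move=> x _; apply: cvgB; [exact: cd|exact: cs].
exact: closed_ge.
Qed.

Lemma interval_pair_le (R : realType) (a b : R) (S : set (measurableTypeR R)) : a <= b ->
  measurable S -> (forall y, S y -> a <= `|y| <= b) ->
  (lebesgue_measure S <= (2 * (b - a))%:E)%E.
Proof.
move=> ab mS H.
pose A : set (measurableTypeR R) := `[a, b]%classic.
pose B : set (measurableTypeR R) := `[- b, - a]%classic.
have mA : measurable A by exact: measurable_itv.
have mB : measurable B by exact: measurable_itv.
have U : (lebesgue_measure (A `|` B) <= lebesgue_measure A + lebesgue_measure B)%E by exact: measureU2.
apply: (@le_trans _ _ (lebesgue_measure (A `|` B))).
  apply: le_measure; rewrite ?inE //; first exact: measurableU.
  move=> y /H; rewrite /A /B /= !in_itv /=; case: (ger0P y) => _ /andP[h1 h2].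
    by left; rewrite h1.
  by right; apply/andP; split; lra.
apply: le_trans U _; rewrite /A /B !lebesgue_measure_itv /= !lte_fin ltrN2.
by case: ifP => _; rewrite -?EFinD lee_fin; lra.
Qed.

(** With [v] rotated onto the first axis, the crossing cone consists of the points whose slope lies,
    in absolute value, between these two roots. The difference tends to 0 with e. *)
Definition cone_width (R : realType) (e : R) (v : R * R) : R :=
  Num.sqrt ((1 + e) ^+ 2 * sqn v - 1) - Num.sqrt ((1 - e) ^+ 2 * sqn v - 1).

Lemma ar_crossing_cone (R : realType) (e : R) (v : R * R) : 0 < sqn v -> 0 <= e ->
  ar (@unit_disk R `&` crossing_cone e v) <= 4 * cone_width e v.
Proof.
move=> v0 e0; set n := Num.sqrt (sqn v).
have n0 : 0 < n by rewrite sqrtr_gt0.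
have nn : n ^+ 2 = sqn v by rewrite sqr_sqrtr ?ltW.
pose w : R * R := (n, 0).
have cs : (v.1 / n) ^+ 2 + (v.2 / n) ^+ 2 = 1.
  by rewrite !expr_div_n -mulrDl -/(sqn v) -nn divff // expf_neq0 // gt_eqF.
have wE : rot (v.1 / n) (v.2 / n) v = w.
  rewrite /rot /w /=; congr (_, _); last by ring.
  rewrite (_ : _ + _ = sqn v / n); last by rewrite /sqn; ring.
  by rewrite -nn; field; rewrite gt_eqF.
have mD := (fmeas_unit_disk R).1.
have mC := measurable_crossing_cone e w.
have -> : ar (@unit_disk R `&` crossing_cone e v) = ar (@unit_disk R `&` crossing_cone e w).
  rewrite -[RHS](ar_rot cs (measurableI _ _ mD mC)); congr ar.
  apply/seteqP; split => x; rewrite /crossing_cone /= unit_disk_rot // sqn_rot // -wE dot_rot //.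
have fI := fmeasIl (fmeas_unit_disk R) mC.
have sw : sqn w = sqn v by rewrite -nn /w /sqn /= expr0n addr0.
have wdE : cone_width e v = cone_width e w by rewrite /cone_width sw.
have wd0 : 0 <= cone_width e w.
  rewrite /cone_width subr_ge0 ler_wsqrtr // lerD2r ler_wpM2r ?addr_ge0 ?sqr_ge0 //.
  rewrite -subr_ge0 (_ : _ - _ = 4 * e); last by ring.
  by rewrite mulr_ge0.
rewrite -lee_fin -(areaEr fI) wdE (_ : 4 * _ = 2 * (2 * cone_width e w)); last by ring.
apply: area_le_slices; [exact: fI.1| |move=> x|by rewrite mulr_ge0].
  move=> x [/= + _]; rewrite /unit_disk /= => Dx.
  have h1 := sqr_ge0 x.1; have h2 := sqr_ge0 x.2.
  by apply/andP; split; nra.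
have mS : measurable (xsection (@unit_disk R `&` crossing_cone e w : set (plane R)) x).
  by apply: measurable_xsection; exact: fI.1.
have [x1|x1] := leP `|x| 1; last first.
  rewrite (_ : xsection _ x = set0) ?measure0 ?lee_fin ?mulr_ge0 //.
  apply/seteqP; split => y //; rewrite xsectionE => -[/= Dx _].
  move: x1; rewrite ltNge => /negP; apply.
  rewrite -ler_sqr ?nnegrE // real_normK ?num_real // expr1n.
  by move: Dx; rewrite /unit_disk /=; have := sqr_ge0 y; lra.
have sq (a : R) : Num.sqrt a * `|x| = Num.sqrt (a * x ^+ 2).
  by rewrite mulrC -sqrtr_sqr -sqrtrM ?sqr_ge0 // mulrC.
have ww : sqn w = n ^+ 2 by rewrite /w /sqn /= expr0n addr0.
apply: (@le_trans _ _ (2 * (Num.sqrt ((1 + e) ^+ 2 * sqn w - 1) * `|x| -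
   Num.sqrt ((1 - e) ^+ 2 * sqn w - 1) * `|x|))%:E).
  apply: interval_pair_le => //.
    rewrite -subr_ge0 -mulrBl mulr_ge0 //; exact: wd0.
  move=> y; rewrite xsectionE => -[_]; rewrite /crossing_cone /dot /sqn /w /= mulr0 addr0 => -[h1 h2].
  rewrite !sq -sqrtr_sqr expr0n addr0; apply/andP; split; apply: ler_wsqrtr; rewrite mulrBl mul1r.
    by rewrite lerBlDl; apply: le_trans h1; rewrite (mulrC x) !exprMn mulrA.
  by rewrite lerBrDl; apply: le_trans h2 _; rewrite (mulrC x) !exprMn mulrA.
rewrite lee_fin ler_pM2l // -mulrBl; apply: ler_piMr => //; exact: wd0.
Qed.

Lemma crossing_cone_scl (R : realType) (e l : R) (v x : R * R) : 0 < l ->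
  crossing_cone e v (scl l x) <-> crossing_cone e v x.
Proof.
move=> l0; have l2 : 0 < l ^+ 2 by rewrite exprn_gt0.
have E k : (k * dot (scl l x) v) ^+ 2 = l ^+ 2 * (k * dot x v) ^+ 2.
  by rewrite /dot /scl /=; ring.
by rewrite /crossing_cone /= !E sqn_scl !ler_pM2l.
Qed.

(** The cone is homogeneous, so its part in the disk of radius [l] has l^2 times the area. With l =
    exp(-t), the loss in the thin annulus is of first order in t, with a coefficient that is small
    with e. *)
Lemma ar_crossing_cone_annulus (R : realType) (e l : R) (v : R * R) : 0 < l -> l <= 1 ->
  ar ((@unit_disk R `&` crossing_cone e v) `\` [set x | sqn x <= l ^+ 2]) <=
  (1 - l ^+ 2) * ar (@unit_disk R `&` crossing_cone e v).
Proof.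
move=> l0 l1; have mC := measurable_crossing_cone e v.
have mD := (fmeas_unit_disk R).1.
have fA := fmeasIl (fmeas_unit_disk R) mC.
set A := @unit_disk R `&` crossing_cone e v in fA *.
have li : 0 < l^-1 by rewrite invr_gt0.
have BE : [set x | sqn x <= l ^+ 2] = [set x | unit_disk (scl l^-1 x)] :> set (R * R).
  apply/seteqP; split => x; rewrite /unit_disk /= -/(sqn (scl l^-1 x)) sqn_scl exprVn;
  by rewrite ler_pdivrMl ?exprn_gt0 // mulr1.
have det0 : l^-1 * l^-1 - 0 * 0 != 0 by rewrite mulr0 subr0 mulf_neq0 // invr_eq0 gt_eqF.
have pre (P : set (plane R)) : [set x | P (l^-1 * x.1 + 0 * x.2 + 0, 0 * x.1 + l^-1 * x.2 + 0)] =
    [set x | P (scl l^-1 x)].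
  by apply/seteqP; split => x; rewrite /scl /= !mul0r !addr0 add0r.
have mB : measurable ([set x | sqn x <= l ^+ 2] : set (plane R)).
  by rewrite BE -pre; exact: measurable_affine_preimage.
have E : ar (A `&` [set x | sqn x <= l ^+ 2]) = l ^+ 2 * ar A.
  rewrite BE (_ : _ `&` _ = [set x | A (scl l^-1 x)]); last first.
    apply/seteqP; split => x; rewrite /A /= => -[].
      by move=> [Dx Cx] Dx'; split => //; apply/crossing_cone_scl.
    move=> Dx /crossing_cone_scl Cx; split => //; split; last exact: Cx.
    have : [set x | sqn x <= l ^+ 2] x by rewrite BE.
    rewrite /unit_disk /= -/(sqn x) => /le_trans; apply.
    by rewrite exprn_ile1 // ltW.
  rewrite -pre arE (area_affine 0 0 det0 fA.1) (areaEr fA) -EFinM /=.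
  rewrite mulr0 subr0 -expr2 normrX gtr0_norm // exprVn invrK //.
by rewrite mulrBl mul1r -E [X in X - _](ar_setD fA mB) addrAC subrr add0r.
Qed.

(** * Comparison of the body and the polygon near the circle *)

Lemma compact_unit_disk (R : realType) : compact (@unit_disk R).
Proof.
pose B : set (R * R) := `[-1, 1]%classic `*` `[-1, 1]%classic.
apply: (@subclosed_compact _ _ B).
- exact: closed_unit_disk.
- by apply: compact_setX; exact: segment_compact.
- move=> x; rewrite /unit_disk /B /= !in_itv /= => Dx.
  have h1 := sqr_ge0 x.1; have h2 := sqr_ge0 x.2.
  by split; apply/andP; split; nra.
Qed.

Lemma closed_unit_circle (R : realType) : closed (@unit_circle R).
Proof.
apply: (@preimage_closed _ _ (fun x : R * R => x.1 ^+ 2 + x.2 ^+ 2) [set t | t = 1]).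
  by move=> x _; exact: continuous_sqnorm.
exact: closed_eq.
Qed.

Lemma compact_circleI (R : realType) (A : set (R * R)) : closed A ->
  compact (@unit_circle R `&` A).
Proof.
move=> cA; apply: (@subclosed_compact _ _ (@unit_disk R)).
- by apply: closedI => //; exact: closed_unit_circle.
- exact: compact_unit_disk.
- by move=> x [Cx _]; rewrite /unit_disk /= Cx.
Qed.

(** Scaling is jointly continuous in factor and point, so compactness makes the admissible range of
    factors uniform over [A]. *)
Lemma scale_near (R : realType) (A O : set (R * R)) : compact A -> open O -> A `<=` O ->
  exists2 d : R, 0 < d & forall u t, A u -> `|1 - t| < d -> O (scl t u).
Proof.
move=> cA oO AO.
have H : \forall t \near (1 : R), A `<=` [set u | O (scl t u)].
  apply: (iffLR (compact_near_coveringP A) cA R (nbhs (1 : R)) (fun t u => O (scl t u))) => -[u1 u2] Au.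
  set u : R * R := (u1, u2).
  have f1 : (fun z : (R * R) * R => z.1) z @[z --> (u, 1 : R)] --> u by exact: cvg_fst.
  have f2 : (fun z : (R * R) * R => z.2) z @[z --> (u, 1 : R)] --> (1 : R) by exact: cvg_snd.
  have c1 : (fun z : (R * R) * R => z.2 * z.1.1) z @[z --> (u, 1 : R)] --> 1 * u.1.
    by apply: (cvgM f2); exact: (cvg_comp _ _ f1 (@continuous_fst R u)).
  have c2 : (fun z : (R * R) * R => z.2 * z.1.2) z @[z --> (u, 1 : R)] --> 1 * u.2.
    by apply: (cvgM f2); exact: (cvg_comp _ _ f1 (@continuous_snd R u)).
  have /nbhs_box[e e0 He] : nbhs u O by apply: open_nbhs_nbhs; split => //; exact: AO.
  move: c1 => /cvgrPdist_lt/(_ e e0) c1; move: c2 => /cvgrPdist_lt/(_ e e0) c2.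
  apply: filterS2 c1 c2 => -[w t] /=; rewrite !mul1r => h1 h2.
  exact: He.
move/nbhs_ballP: H => [d /= d0 Hd]; exists d => // u t Au td; exact: Hd.
Qed.

Lemma closed_dot_ge (R : realType) (v : R * R) (c : R) : closed [set x : R * R | c <= `|dot x v|].
Proof.
apply: (@preimage_closed _ _ (fun x : R * R => `|dot x v|) [set t | c <= t]).
  by move=> x _; apply: cvg_norm; exact: continuous_dot.
exact: closed_ge.
Qed.

Lemma closed_polygon (R : realType) (vs : seq (R * R)) : closed (polygon vs).
Proof.
elim: vs => [|v vs IH]; first by rewrite polygon_nil; exact: closedT.
by rewrite polygon_cons; apply: closedI => //; exact: closed_strip.
Qed.

Lemma crossing_coneP (R : realType) (e : R) (v x : R * R) : 0 <= e <= 1 ->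
  (1 - e) * `|dot x v| <= Num.sqrt (sqn x) -> Num.sqrt (sqn x) <= (1 + e) * `|dot x v| ->
  crossing_cone e v x.
Proof.
move=> /andP[e0 e1] h1 h2.
have s0 : 0 <= sqn x by rewrite addr_ge0 // sqr_ge0.
have sE := sqr_sqrtr s0.
have nE (k : R) : (k * dot x v) ^+ 2 = (k * `|dot x v|) ^+ 2.
  by rewrite !exprMn real_normK ?num_real.
split; rewrite nE -sE ler_sqr ?nnegrE ?mulr_ge0 ?sqrtr_ge0 ?subr_ge0 //.
by rewrite addr_ge0.
Qed.

(** Away from the ends of the gaps, membership of circle points in [K] is decided with a margin, and
    by compactness the decision extends radially. Poles enlarged by 1 + e give strips that stay on
    the safe side; what is missed lies in the crossing cones. *)
Lemma annulus_near (R : realType) (K : set (R * R)) (vs : seq (R * R)) (e : R) :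
  compact K -> gap_system K vs -> 0 < e < 1 ->
  exists2 d : R, 0 < d < 1 & forall x, (1 - d) ^+ 2 < sqn x < (1 + d) ^+ 2 ->
    (polygon (map (scl (1 + e)) vs) x -> K x) /\
    (K x -> ~ polygon (map (scl (1 + e)) vs) x -> unit_disk x ->
      exists2 v, v \in vs & crossing_cone e v x).
Proof.
move=> kK [_ g2 g3 _] /andP[e0 e1].
have h2 : 0 < 1 + e / 2 by lra.
have cA : closed (polygon (map (scl (1 + e / 2)) vs)) by exact: closed_polygon.
have [|d1 d10 H1] := scale_near (compact_circleI cA) (@open_interior _ K).
  move=> u [cu pu]; apply: g2 => // v vvs.
  have := pu _ (map_f _ vvs); rewrite /strip /= dot_sclr normrM gtr0_norm //.
  rewrite -ler_pdivlMl // mulr1 => /le_lt_trans; apply.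
  by rewrite invf_lt1 //; lra.
have [d2 d20 H2] : exists2 d : R, 0 < d & forall v u t, v \in vs -> unit_circle u ->
    (1 - e)^-1 <= `|dot u v| -> `|1 - t| < d -> ~ K (scl t u).
  elim: {g2 cA H1} vs g3 => [|v vs IH] g3; first by exists 1.
  have [|d d0 Hd] := IH; first by move=> u w cu wvs; apply: g3 => //; rewrite inE wvs orbT.
  have [||d' d'0 Hd'] := scale_near (compact_circleI (@closed_dot_ge R v (1 - e)^-1)) (O := ~` K).
  - by apply: closed_openC; exact: compact_closed.
  - move=> u [cu uv]; apply: g3 cu (mem_head _ _) _; apply: lt_le_trans uv.
    by rewrite invf_gt1; lra.
  exists (Num.min d d') => [|w u t]; first by rewrite lt_min d0 d'0.
  rewrite inE lt_min => /orP[/eqP ->|wvs] cu uw /andP[t1 t2]; first exact: Hd'.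
  exact: Hd uw t1.
(* The bound e / 4 ensures 1 + e / 2 <= (1 + e) (1 - d), which absorbs the normalization of a point
   of the annulus to the circle. *)
pose d := Num.min (1 / 2) (Num.min (e / 4) (Num.min d1 d2)).
have dE : [/\ d <= 1 / 2, d <= e / 4, d <= d1 & d <= d2].
  by rewrite /d !ge_min !lexx !orbT.
have [dh de dd1 dd2] := dE.
have d0 : 0 < d by rewrite /d !lt_min d10 d20 !divr_gt0.
exists d => [|x /andP[x1 x2]]; first by rewrite d0 /=; lra.
have dm : 0 < 1 - d by lra.
have x0 : 0 < sqn x by apply: le_lt_trans x1; rewrite sqr_ge0.
set t := Num.sqrt (sqn x); have t0 : 0 < t by rewrite sqrtr_gt0.
have tE : t ^+ 2 = sqn x by rewrite sqr_sqrtr // ltW.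
have td : 1 - d < t < 1 + d.
  by move: x1 x2; rewrite -tE !ltr_sqr ?nnegrE ?(ltW t0) ?(ltW dm) ?addr_ge0 ?(ltW d0) // => -> ->.
have t1 : `|1 - t| < d by move: td => /andP[a b]; rewrite ltr_norml; apply/andP; split; lra.
pose u : R * R := (x.1 / t, x.2 / t).
have cu : unit_circle u := unit_circle_normalize x0.
have xE : x = scl t u.
  by rewrite /scl /u /= [LHS]surjective_pairing; congr (_, _); field; rewrite gt_eqF.
have duv v : dot u v = dot x v / t by exact: dot_unit.
split=> [px|Kx npx Dx].
  apply: interior_subset; rewrite xE; apply: H1; last exact: lt_le_trans t1 _.
  split=> // _ /mapP[v vvs ->]; have := px _ (map_f _ vvs).
  have e1p : 0 < 1 + e by lra.
  rewrite /strip /= !dot_sclr duv !normrM (gtr0_norm e1p) (gtr0_norm h2) normfV (gtr0_norm t0).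
  move=> h; rewrite mulrA ler_pdivrMr // mul1r.
  have p0 : 0 <= `|dot x v| by [].
  have : (1 + e) * `|dot x v| * t <= t by rewrite ler_piMl // ltW.
  have : (1 + e / 2) * `|dot x v| <= (1 + e) * `|dot x v| * t; last by lra.
  rewrite mulrAC ler_wpM2r //; apply: (@le_trans _ _ ((1 + e) * (1 - d))); first by nra.
  by move: td => /andP[td1 _]; rewrite ler_wpM2l //; [lra|exact: ltW].
have [v vvs xv] : exists2 v, v \in vs & 1 < (1 + e) * `|dot x v|.
  apply: contrapT => h; apply: npx => _ /mapP[v vvs ->]; rewrite /strip /= leNgt; apply/negP.
  rewrite dot_sclr normrM gtr0_norm; last by lra.
  by move=> xv; apply: h; exists v.
exists v => //; apply: crossing_coneP; first by rewrite !ltW.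
  rewrite leNgt; apply/negP => h; apply: (H2 v u t vvs cu _ (lt_le_trans t1 dd2)); last by rewrite -xE.
  rewrite duv normrM (gtr0_norm (x := t^-1)) ?invr_gt0 // ler_pdivlMr // ler_pdivrMl; last by lra.
  exact: ltW.
apply: ltW; apply: le_lt_trans xv; rewrite -/t -sqrtr1 ler_wsqrtr //.
Qed.

Lemma sqn_flow_ge (R : realType) (t : R) (x : R * R) : 0 <= t ->
  sqn x <= expR t ^+ 2 * sqn (flow (- t) x).
Proof.
move=> t0; rewrite /sqn /flow /= opprK mulrDr -!exprMn !mulrA expR_invol mul1r lerD2l.
rewrite exprMn ler_peMl ?sqr_ge0 // exprn_ege1 // -expRD -expR0 ler_expR addr_ge0 //.
Qed.

Lemma sqn_flow_le (R : realType) (t : R) (x : R * R) : 0 <= t ->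
  expR (- t) ^+ 2 * sqn (flow (- t) x) <= sqn x.
Proof.
move=> t0; rewrite /sqn /flow /= opprK mulrDr -!exprMn !mulrA (mulrC (expR (- t)) (expR t)).
rewrite expR_invol mul1r lerD2r exprMn ler_piMl ?sqr_ge0 // exprn_ile1 //.
by rewrite -expRD -expR0 ler_expR; lra.
Qed.

Lemma ar_cover_le (R : realType) (T : eqType) (A : set (R * R)) (F : T -> set (R * R)) (s : seq T) :
  measurable (A : set (plane R)) -> (forall v, fmeas (F v)) ->
  (forall x, A x -> exists2 v, v \in s & F v x) ->
  ar A <= \sum_(v <- s) ar (F v).
Proof.
move=> mA fF; elim: s A mA => [|v s IH] A mA H.
  rewrite big_nil (_ : A = set0) ?ar0 //; apply/seteqP; split => // x /H[v].
  by rewrite in_nil.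
have h : ar (A `\` F v) <= \sum_(w <- s) ar (F w).
  apply: IH => [|x [Ax nFx]]; first exact: measurableD mA (fF v).1.
  have [w] := H x Ax; rewrite inE => /orP[/eqP -> //|ws Fw]; by exists w.
rewrite big_cons.
have fA : fmeas A.
  apply: (@fmeas_sub _ _ (\big[setU/set0]_(w <- v :: s) F w) mA).
    elim: (v :: s) {IH H} => [|w l IHl]; first by rewrite big_nil; exact: (fmeas_sub measurable0 (fF v)).
    by rewrite big_cons; exact: fmeasU.
  move=> x /H[w]; elim: (v :: s) {IH H} => [|u l IHl]; first by rewrite in_nil.
  rewrite inE big_cons => /orP[/eqP ->|wl] Fw.
    by left.
  by right; exact: IHl.
rewrite (ar_setD fA (fF v).1) lerD //; apply: le_ar (fF v) _; first exact: measurableI mA (fF v).1.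
by move=> x [].
Qed.

(** Each difference of areas is a gain outside the disk minus a loss inside it, and both happen in
    the annulus. The gain of [K] is at least that of the polygon, and its loss exceeds that of the
    polygon at most by the cones outside the radius exp(-t). *)
Lemma ar_flow_diff (R : realType) (K : set (R * R)) (vs : seq (R * R)) (c s e d t : R) :
  fmeas K -> c ^+ 2 + s ^+ 2 = 1 -> 0 <= t -> 0 < d < 1 ->
  1 - d < expR (- t) -> expR t < 1 + d ->
  (forall x, (1 - d) ^+ 2 < sqn x < (1 + d) ^+ 2 ->
    (polygon (map (scl (1 + e)) vs) x -> K x) /\
    (K x -> ~ polygon (map (scl (1 + e)) vs) x -> unit_disk x ->
      exists2 v, v \in vs & crossing_cone e v x)) ->
  FF (map (rot c s) (map (scl (1 + e)) vs)) t - FF (map (rot c s) (map (scl (1 + e)) vs)) 0 -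
    (1 - expR (- t) ^+ 2) * \sum_(v <- vs) ar (@unit_disk R `&` crossing_cone e v) <=
  ar ([set y | unit_disk (flow (- t) (rot c s y))] `&` K) - ar (@unit_disk R `&` K).
Proof.
move=> fK cs t0 /andP[d0 d1] td1 td2 near.
set us := map (scl (1 + e)) vs in near *.
set ws := map (rot c s) us; set E := [set y | _].
have mD := (fmeas_unit_disk R).1; have mQ := measurable_polygon us.
have mF := measurable_flow (- t) mD.
have mE : measurable (E : set (plane R)) := measurable_rot c s mF.
have fE : fmeas E.
  split => //; rewrite -[E]/([set x | [set z | unit_disk (flow (- t) z)] (rot c s x)]).
  rewrite (_ : area _ = area [set z | unit_disk (flow (- t) z)]); last first.
    by rewrite -(area_linear (rot_det cs) mF).
  by rewrite area_flow //; exact: (fmeas_unit_disk R).2.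
have mW := measurable_polygon ws.
have mB : measurable ([set x | unit_disk x /\ polygon ws (flow t x)] : set (plane R)).
  exact: measurableI mD (measurable_flow t mW).
have mA : measurable ([set z | unit_disk (flow (- t) z) /\ polygon ws z] : set (plane R)).
  exact: measurableI (measurable_flow (- t) mD) mW.
have -> : FF ws t = ar (E `&` polygon us).
  symmetry; transitivity (ar [set x | [set z | unit_disk (flow (- t) z) /\ polygon ws z] (rot c s x)]).
    by congr ar; apply/seteqP; split => x /=; rewrite polygon_rot.
  rewrite (ar_rot cs mA) /FF polygon_flow -[RHS](ar_flow (- t) mB); congr ar.
  by apply/seteqP; split => x /=; rewrite -flowD subrr flow0.
have -> : FF ws 0 = ar (@unit_disk R `&` polygon us).
  symmetry; rewrite FF_0 -[RHS](ar_rot cs (measurableI _ _ mD mW)); congr ar.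
  by apply/seteqP; split => x /=; rewrite unit_disk_rot // polygon_rot.
have split4 (P : set (plane R)) : measurable P -> ar (E `&` P) - ar (@unit_disk R `&` P) =
    ar ((E `&` P) `\` @unit_disk R) - ar ((@unit_disk R `&` P) `\` E).
  move=> mP; rewrite (ar_setD (fmeasIl fE mP) mD) (ar_setD (fmeasIl (fmeas_unit_disk R) mP) mE).
  have -> : @unit_disk R `&` P `&` E = E `&` P `&` @unit_disk R by rewrite -setIA setIC (setIC P).
  by rewrite opprD addrACA subrr add0r.
rewrite (split4 _ mQ) (split4 _ fK.1).
have outer x : E x -> ~ unit_disk x -> (1 - d) ^+ 2 < sqn x < (1 + d) ^+ 2.
  move=> Ex /negP; rewrite -ltNge -/(sqn x) => x1; apply/andP; split.
    by apply: lt_trans x1; rewrite expr_lt1 // ?subr_ge0 ?ltW //; lra.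
  have := sqn_flow_ge (rot c s x) t0; rewrite sqn_rot // => /le_lt_trans; apply.
  apply: (@le_lt_trans _ _ (expR t ^+ 2)).
    by rewrite ler_piMr ?sqr_ge0 //; exact: Ex.
  by rewrite ltr_sqr ?nnegrE ?expR_ge0 // addr_ge0 // ltW.
have inner x : unit_disk x -> ~ E x -> expR (- t) ^+ 2 < sqn x.
  move=> Dx /negP; rewrite -ltNge -/(sqn _) => x1.
  have := sqn_flow_le (rot c s x) t0; rewrite sqn_rot //; apply: lt_le_trans.
  by rewrite ltr_pMr // exprn_gt0 // expR_gt0.
have inner' x : unit_disk x -> ~ E x -> (1 - d) ^+ 2 < sqn x < (1 + d) ^+ 2.
  move=> Dx nEx; apply/andP; split.
    apply: lt_trans (inner x Dx nEx); rewrite ltr_sqr ?nnegrE ?expR_ge0 //; lra.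
  by apply: le_lt_trans Dx _; rewrite exprn_egt1 //; lra.
have ho : ar ((E `&` polygon us) `\` @unit_disk R) <= ar ((E `&` K) `\` @unit_disk R).
  apply: le_ar => [||x [[Ex Qx] nDx]].
  - exact: measurableD (measurableI _ _ mE mQ) mD.
  - exact: fmeasD (fmeasIl fE fK.1) mD.
  - by split => //; split => //; exact: (near x (outer x Ex nDx)).1.
pose S v : set (R * R) := (@unit_disk R `&` crossing_cone e v) `\` [set x | sqn x <= expR (- t) ^+ 2].
have ml : measurable ([set x | sqn x <= expR (- t) ^+ 2] : set (plane R)).
  apply: closed_measurable2.
  apply: (@preimage_closed _ _ (fun x : R * R => sqn x) [set k | k <= expR (- t) ^+ 2]).
    by move=> x _; exact: continuous_sqnorm.
  exact: closed_le.
have fS v : fmeas (S v).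
  exact: fmeasD (fmeasIl (fmeas_unit_disk R) (measurable_crossing_cone e v)) ml.
have fDK := fmeasD (fmeasIl (fmeas_unit_disk R) fK.1) mE.
have hi : ar ((@unit_disk R `&` K) `\` E) <= ar ((@unit_disk R `&` polygon us) `\` E) +
    \sum_(v <- vs) ar (S v).
  rewrite (ar_setD fDK mQ); apply: lerD.
    apply: le_ar => [||x [[[Dx Kx] nEx] Qx]].
    - exact: (fmeasIl fDK mQ).1.
    - exact: fmeasD (fmeasIl (fmeas_unit_disk R) mQ) mE.
    - by split.
  apply: ar_cover_le => // [|x [[[Dx Kx] nEx] nQx]]; first exact: (fmeasD fDK mQ).1.
  have [v vvs cv] := (near x (inner' x Dx nEx)).2 Kx nQx Dx.
  by exists v => //; split => //; apply/negP; rewrite -ltNge; exact: inner.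
have hs : \sum_(v <- vs) ar (S v) <=
    (1 - expR (- t) ^+ 2) * \sum_(v <- vs) ar (@unit_disk R `&` crossing_cone e v).
  rewrite mulr_sumr; apply: ler_sum => v _; apply: ar_crossing_cone_annulus.
    exact: expR_gt0.
  by rewrite -expR0 ler_expR oppr_le0.
by rewrite -addrA -opprD; apply: lerB ho (le_trans hi _); rewrite lerD2l.
Qed.

Lemma MI_position_le (R : realType) (K : set (R * R)) (c s t : R) :
  fmeas K -> MI_position K -> c ^+ 2 + s ^+ 2 = 1 ->
  ar ([set y | unit_disk (flow (- t) (rot c s y))] `&` K) <= ar (@unit_disk R `&` K).
Proof.
move=> fK [_ MI] cs; have mD := (fmeas_unit_disk R).1.
have detE : expR (- t) * c * (expR t * c) - expR (- t) * s * (expR t * - s) = 1.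
  transitivity (expR t * expR (- t) * (c ^+ 2 + s ^+ 2)); first by ring.
  by rewrite cs expR_invol mulr1.
have det0 : expR (- t) * c * (expR t * c) - expR (- t) * s * (expR t * - s) != 0.
  by rewrite detE oner_eq0.
have EE : [set y | unit_disk (flow (- t) (rot c s y))] =
    affine_disk (expR (- t) * c) (expR (- t) * s) 0 (expR t * - s) (expR t * c) 0.
  apply/seteqP; split => y; rewrite /affine_disk /flow /rot /= opprK !addr0;
  by congr unit_disk; congr (_, _); ring.
have aE := area_affine_disk 0 0 det0.
rewrite detE normr1 invr1 mul1e in aE.
have := MI _ (ellipse_affine_disk 0 0 det0) aE; rewrite -EE.
have mE : measurable ([set y | unit_disk (flow (- t) (rot c s y))] : set (plane R)).
  exact: (measurable_rot c s (measurable_flow (- t) mD)).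
have f1 : fmeas ([set y | unit_disk (flow (- t) (rot c s y))] `&` K).
  by rewrite setIC; exact: fmeasIl.
have f2 : fmeas (@unit_disk R `&` K) := fmeasIl (fmeas_unit_disk R) fK.1.
by rewrite (areaEr f1) (areaEr f2) lee_fin.
Qed.

Lemma ge0_right_limit (R : realType) (f : R -> R) (d : R) : 0 < d ->
  f x @[x --> 0^'] --> f 0 -> (forall t, 0 < t < d -> 0 <= f t) -> 0 <= f 0.
Proof.
move=> d0 cf H; rewrite leNgt; apply/negP => f0.
move: cf => /cvgrPdist_lt/(_ (- f 0)); rewrite oppr_gt0 => /(_ f0).
move=> /nbhs_ballP[e /= e0 He].
pose t := Num.min (d / 2) (e / 2).
have t0 : 0 < t by rewrite lt_min !divr_gt0.
have td : t <= d / 2 by rewrite ge_min lexx.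
have te : t <= e / 2 by rewrite ge_min lexx orbT.
have ft : `|f 0 - f t| < - f 0.
  by apply: He; [rewrite /ball /= sub0r normrN gtr0_norm //; lra|rewrite gt_eqF].
have := H t; rewrite t0 /= => /(_ (le_lt_trans td _)); rewrite ltr_pdivrMr // ltr_pMr // ltr1n.
by move: ft; rewrite ltr_norml => /andP[h1 _] /(_ isT); lra.
Qed.

Lemma is_derive_ge0_right (R : realType) (f : R -> R) (a d : R) : 0 < d ->
  is_derive (0 : R) 1 f a -> f 0 = 0 -> (forall t, 0 < t < d -> 0 <= f t) -> 0 <= a.
Proof.
move=> d0 [df E] f0 H.
have lim_a : (fun h => h^-1 *: (f (h *: 1 + 0) - f 0)) h @[h --> 0^'] --> a by rewrite -E.
pose q h := if h == 0 then a else f h / h.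
have -> : a = q 0 by rewrite /q eqxx.
apply: (ge0_right_limit d0) => [|t td]; last first.
  have t0 : 0 < t by case/andP: td.
  by rewrite /q gt_eqF // divr_ge0 ?H // ltW.
rewrite {2}/q eqxx.
apply: cvg_trans lim_a; apply: near_eq_cvg; near=> h.
have h0 : h != 0 by near: h; exact: nbhs_dnbhs_neq.
by rewrite /q (negPf h0) /= f0 subr0 addr0 /GRing.scale /= mulr1 mulrC.
Unshelve. all: by end_near. Qed.

Lemma rr_scl_continuous (R : realType) (v : R * R) : continuous (fun l : R => rr (scl l v)).
Proof.
move=> l; apply: (@continuous_comp _ _ _ (fun l : R => sqn (scl l v) - 1) Num.sqrt);
  last exact: sqrt_continuous.
rewrite (_ : (fun l : R => _) = (fun l => l ^+ 2 * sqn v - 1)); last first.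
  by apply/funext => k; rewrite sqn_scl.
apply: cvgB; last exact: cvg_cst.
by apply: cvgM; [exact: (@exprn_continuous R 2)|exact: cvg_cst].
Qed.

Lemma hh_scl_continuous (R : realType) (v : R * R) (l : R) : l != 0 -> sqn v != 0 ->
  {for l, continuous (fun l : R => hh (scl l v))}.
Proof.
move=> l0 v0; have sq : {for l, continuous (fun l : R => l ^+ 2)}.
  exact: (@exprn_continuous R 2).
rewrite (_ : (fun l : R => _) =
    (fun l => rr (scl l v) * (l ^+ 2 * (v.1 ^+ 2 - v.2 ^+ 2)) / (l ^+ 2 * sqn v) ^+ 2)); last first.
  by apply/funext => k; rewrite /hh sqn_scl /scl /=; congr (_ * _ / _); ring.
apply: cvgM.
  apply: cvgM; first exact: rr_scl_continuous.
  by apply: cvgM; [exact: sq|exact: cvg_cst].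
apply: cvgV; first by rewrite expf_neq0 // mulf_neq0 // expf_neq0.
by rewrite expr2; apply: cvgM; (apply: cvgM; [exact: sq|exact: cvg_cst]).
Qed.

Lemma strict_scl_near (R : realType) (vs : seq (R * R)) : strict vs ->
  \forall l \near (1 : R), strict (map (scl l) vs).
Proof.
have scl1 : map (scl 1) vs = vs.
  by rewrite -[RHS]map_id; apply: eq_map => v; rewrite /scl !mul1r -surjective_pairing.
have sq : continuous (fun l : R => l ^+ 2).
  exact: (@exprn_continuous R 2).
rewrite -{1}scl1 /strict all_map pairwise_map => /andP[a p]; near=> t.
rewrite all_map pairwise_map; apply/andP; split; near: t.
  apply: near_all => v vvs; have /= := allP a v vvs; rewrite sqn_scl => v1.
  have c : {for 1, continuous (fun l : R => l ^+ 2 * sqn v)}.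
    by apply: cvgM; [exact: sq|exact: cvg_cst].
  move: c => /cvgrPdist_lt/(_ (1 ^+ 2 * sqn v - 1)).
  rewrite subr_gt0 => /(_ v1); apply: filterS => t.
  by rewrite sqn_scl ltr_norml => /andP[_]; rewrite /=; lra.
apply: (near_pairwise (P := fun t => relpre (scl t) (@pair_lt R)) _ p) => u v /=.
rewrite /pair_lt => h.
have c : {for 1, continuous (fun t => `|dot (scl t u) (scl t v)| + rr (scl t u) * rr (scl t v))}.
  apply: cvgD; last by apply: cvgM; exact: rr_scl_continuous.
  have dE (k : R) : dot (scl k u) (scl k v) = k ^+ 2 * dot u v by rewrite /dot /scl /=; ring.
  have dc : {for 1, continuous (fun t : R => t ^+ 2 * dot u v)}.
    by apply: cvgM; [exact: sq|exact: cvg_cst].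
  by apply: cvg_norm; rewrite (dE 1) (funext dE).
move: c => /cvgrPdist_lt/(_ (1 - (`|dot (scl 1 u) (scl 1 v)| + rr (scl 1 u) * rr (scl 1 v)))).
rewrite subr_gt0 => /(_ h); apply: filterS => t.
by rewrite ltr_norml => /andP[]; rewrite /=; lra.
Unshelve. all: by end_near. Qed.

Section Necessity.
Variables (R : realType) (K : set (R * R)) (vs : seq (R * R)) (c s : R).
Hypotheses (kK : compact K) (gK : gap_system K vs) (MI : MI_position K).
Hypothesis cs : c ^+ 2 + s ^+ 2 = 1.

Let sqn1 v : v \in vs -> 1 < sqn v.
Proof. by case: gK => /andP[/allP a _] _ _ _; exact: a. Qed.

Let rot_scl l (v : R * R) : rot c s (scl l v) = scl l (rot c s v).
Proof. by rewrite /rot /scl /=; congr (_, _); ring. Qed.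

(** By maximality the growth of the cap areas plus (1 - exp(-2t)) k is nonnegative for small t > 0
    and zero at 0, so its derivative at 0 is nonnegative. The 8 is 2 from the exponential times 4
    from the area bound of a cone. *)
Lemma sum_hh_scl_ge0 : exists2 d : R, 0 < d & forall e, 0 < e < d ->
  0 <= 4 * (\sum_(v <- vs) hh (scl (1 + e) (rot c s v))) + 8 * \sum_(v <- vs) cone_width e v.
Proof.
have arith (A X Y c0 c1 p q : R) : X <= Y -> A - c1 - (A - c0) - p <= X - Y -> p <= q ->
    0 <= c1 - c0 + q by lra.
have [d1 /= d10 H1] : exists2 d : R, 0 < d & forall e, `|e| < d -> strict (map (scl (1 + e)) vs).
  have st : strict vs by case: gK.
  have /nbhs_ballP[d /= d0 Hd] := strict_scl_near st.
  exists d => // e ed; apply: Hd; by rewrite /ball /= opprD addNKr normrN.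
exists (Num.min d1 1) => [|e]; first by rewrite lt_min d10 /=.
rewrite lt_min => /andP[e0 /andP[ed1 e1]].
have ste := H1 e; rewrite gtr0_norm // in ste; have {}ste := ste ed1.
have e01 : 0 < e < 1 by rewrite e0.
have [d d01 near] := annulus_near kK gK e01.
have /andP[d0 d1'] := d01.
set us := map (scl (1 + e)) vs in near ste.
set ws := map (rot c s) us.
have stw : strict ws by rewrite strict_rot.
pose C (t : R) := \sum_(w <- ws) 2 * halfcap (Num.sqrt (sqn (flow t w)))^-1.
pose k := 4 * \sum_(v <- vs) cone_width e v.
pose f (t : R) := C t - C 0 + (1 - expR (- t) * expR (- t)) * k.
have sw w : w \in ws -> 1 < sqn w by move: stw => /andP[/allP a _] ; exact: a.
have dC : is_derive (0 : R) 1 C (\sum_(w <- ws) 4 * hh w).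
  apply: (is_derive_sum_seq (f := fun w t => 2 * halfcap (Num.sqrt (sqn (flow t w)))^-1)
    (d := fun w => 4 * hh w)) => w wws.
  rewrite -{2}(flow0 w); apply: is_derive_caps; rewrite flow0; exact: sw.
have dE : is_derive (0 : R) 1 (fun t : R => expR (- t) * expR (- t)) (- 2).
  have de := @is_derive1_comp R expR -%R (0 : R) _ _ (is_derive_expR (- (0 : R))) (is_deriveNid (0 : R) 1).
  apply: (is_derive_eq (is_deriveM de de)).
  by rewrite /GRing.scale /= oppr0 expR0; ring.
have df : is_derive (0 : R) 1 f (4 * (\sum_(w <- ws) hh w) + 2 * k).
  have dk := is_deriveM (is_deriveB (is_derive_cst (1 : R) (0 : R) 1) dE) (is_derive_cst k (0 : R) 1).
  have dc := is_deriveB dC (is_derive_cst (C 0) (0 : R) 1).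
  apply: (is_derive_eq (is_deriveD dc dk)).
  by rewrite /GRing.scale /= mulr_sumr; ring.
have -> : \sum_(v <- vs) hh (scl (1 + e) (rot c s v)) = \sum_(w <- ws) hh w.
  by rewrite /ws /us !big_map; apply: eq_bigr => v _; rewrite rot_scl.
rewrite (_ : 8 * _ = 2 * k); last by rewrite /k; ring.
have sqf : \forall t \near (0 : R), strict (map (flow t) ws).
  by apply: strict_near; rewrite map_flow0.
have ex1 : \forall t \near (0 : R), 1 - d < expR (- t) /\ expR t < 1 + d.
  have c1 : {for (0 : R), continuous (fun t : R => expR (- t))}.
    apply: (@continuous_comp _ _ _ (fun t : R => - t) expR); last exact: continuous_expR.
    by apply: cvgN; exact: cvg_id.
  have c2 : {for (0 : R), continuous (@expR R)} by exact: continuous_expR.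
  move: c1 => /cvgrPdist_lt/(_ d d0); move: c2 => /cvgrPdist_lt/(_ d d0).
  apply: filterS2 => t; rewrite /= oppr0 expR0 => h1 h2.
  by move: h1 h2; rewrite !ltr_norml => /andP[a b] /andP[a' b']; split; lra.
have [d2 /= d20 H2] : exists2 d' : R, 0 < d' & forall t, `|t| < d' ->
    strict (map (flow t) ws) /\ (1 - d < expR (- t) /\ expR t < 1 + d).
  have both : \forall t \near (0 : R), strict (map (flow t) ws) /\ (1 - d < expR (- t) /\ expR t < 1 + d).
    by apply: filterS2 sqf ex1.
  move/nbhs_ballP: both => [d' /= d'0 Hd'].
  by exists d' => // t td; apply: Hd'; rewrite /ball /= sub0r normrN.
apply: (is_derive_ge0_right d20 df); first by rewrite /f subrr oppr0 expR0 mulr1 subrr mul0r addr0.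
move=> t /andP[t0 td]; have [|st [td1 td2]] := H2 t; first by rewrite gtr0_norm.
have := ar_flow_diff (compact_fmeas kK) cs (ltW t0) d01 td1 td2 near.
have := MI_position_le t (compact_fmeas kK) MI cs.
have okt := ar_polygon (strict_ok st).
have ok0 := ar_polygon (strict_ok stw).
have CE (r : R) : strict (map (flow r) ws) -> \sum_(w <- map (flow r) ws) caps w = C r.
  move=> /andP[/allP a _]; rewrite big_map; apply: eq_big_seq => w wws; apply: caps_halfcap.
  by apply: lt_trans (a _ (map_f _ wws)).
rewrite FF_0 -/us -/ws ok0 /FF okt (CE t st) -{1}(map_flow0 ws) CE ?map_flow0 //.
have kE : (1 - expR (- t) ^+ 2) * \sum_(v <- vs) ar (@unit_disk R `&` crossing_cone e v) <=
    (1 - expR (- t) ^+ 2) * k.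
  apply: ler_wpM2l.
    by rewrite subr_ge0 exprn_ile1 ?expR_ge0 // -expR0 ler_expR oppr_le0 ltW.
  rewrite /k mulr_sumr big_seq [leRHS]big_seq; apply: ler_sum => v vvs.
  by apply: ar_crossing_cone; [apply: lt_trans ltr01 _; exact: sqn1|exact: ltW].
rewrite /f -expr2 => hm hd; apply: arith hm hd kE.
Qed.

(** The tolerance e tends to 0 in the preceding inequality: [hh] is continuous under scaling of the
    pole and the cone widths vanish. *)
Lemma sum_hh_rot_ge0 : 0 <= \sum_(v <- vs) hh (rot c s v).
Proof.
have [d d0 H] := sum_hh_scl_ge0.
pose G (e : R) := 4 * (\sum_(v <- vs) hh (scl (1 + e) (rot c s v))) + 8 * \sum_(v <- vs) cone_width e v.
have c1 : {for (0 : R), continuous (fun e : R => 1 + e)}.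
  by apply: cvgD; [exact: cvg_cst|exact: cvg_id].
have c2 : {for (0 : R), continuous (fun e : R => 1 - e)}.
  by apply: cvgB; [exact: cvg_cst|exact: cvg_id].
have cG : {for (0 : R), continuous G}.
  apply: cvgD; apply: cvgM; try exact: cvg_cst.
    apply: (continuous_sum_seq (f := fun v e => hh (scl (1 + e) (rot c s v)))) => v vvs.
    apply: (@continuous_comp _ _ _ (fun e : R => 1 + e) (fun l => hh (scl l (rot c s v)))) => //.
    apply: hh_scl_continuous; first by rewrite addr0 oner_eq0.
    by rewrite sqn_rot // gt_eqF // (lt_trans ltr01) // sqn1.
  apply: (continuous_sum_seq (f := fun v e => cone_width e v)) => v vvs.
  have E (e : R) : cone_width e v = rr (scl (1 + e) v) - rr (scl (1 - e) v).
    by rewrite /cone_width /rr !sqn_scl.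
  rewrite (_ : (fun e : R => _) = (fun e => rr (scl (1 + e) v) - rr (scl (1 - e) v))); last first.
    by apply/funext => e; exact: E.
  apply: cvgB.
    apply: (@continuous_comp _ _ _ (fun e : R => 1 + e) (fun l => rr (scl l v))) => //.
    exact: rr_scl_continuous.
  apply: (@continuous_comp _ _ _ (fun e : R => 1 - e) (fun l => rr (scl l v))) => //.
  exact: rr_scl_continuous.
have := ge0_right_limit d0 (cvg_trans (cvg_app G (@nbhs_dnbhs _ 0)) cG) H.
rewrite /G [X in 8 * X]big1 => [|v _]; last by rewrite /cone_width subr0 addr0 subrr.
rewrite mulr0 addr0 pmulr_rge0 //; congr (_ <= _); apply: eq_bigr => v _.
by rewrite addr0 /scl !mul1r -surjective_pairing.
Qed.

End Necessity.

(** Four rotations suffice: the identity and the quarter turn give both signs for the sum of the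
    [hh], and the rotations by pi/4 in the two directions give both signs for the sum of the
    [hy]. *)
Theorem MI_position_sums (R : realType) (K : set (R * R)) (vs : seq (R * R)) :
  compact K -> gap_system K vs -> MI_position K ->
  \sum_(v <- vs) hh v = 0 /\ \sum_(v <- vs) hy v = 0.
Proof.
move=> kK gK MI.
have H (c s : R) : c ^+ 2 + s ^+ 2 = 1 ->
    0 <= (c ^+ 2 - s ^+ 2) * (\sum_(v <- vs) hh v) + 2 * c * s * \sum_(v <- vs) hy v.
  move=> cs; have := sum_hh_rot_ge0 kK gK MI cs; under eq_bigr do rewrite hh_rot //.
  by rewrite big_split /= -!mulr_sumr.
have h1 := H 1 0; have h2 := H 0 1; rewrite !expr1n !expr0n /= in h1 h2.
have {}h1 := h1 (addr0 _); have {}h2 := h2 (add0r _).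
have r0 : Num.sqrt (2^-1) ^+ 2 = 2^-1 :> R by rewrite sqr_sqrtr // invr_ge0.
set r := Num.sqrt (2^-1) in r0.
have h3 := H r r; have h4 := H r (- r); rewrite sqrrN r0 in h3 h4.
have rr2 : 2 * r * r = 1 by rewrite -mulrA -expr2 r0 divff.
have rs : 2^-1 + 2^-1 = 1 :> R by field.
rewrite rr2 in h3; rewrite mulrN rr2 in h4.
by have {}h3 := h3 rs; have {}h4 := h4 rs; split; lra.
Qed.

(** * Crossings of the boundary with the circle *)

Definition cis (R : realType) (t : R) : R * R := (cos t, sin t).

Lemma cis_circle (R : realType) (t : R) : unit_circle (cis t).
Proof. exact: cos2Dsin2. Qed.

Lemma cisDpi (R : realType) (t : R) : cis (t + pi) = - cis t.
Proof. by rewrite /cis cosDpi sinDpi. Qed.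

Lemma continuous_cis (R : realType) : continuous (@cis R).
Proof.
move=> t; apply: (@cvg_pair _ _ _ _ (nbhs (cos t)) (nbhs (sin t))).
  exact: continuous_cos.
exact: continuous_sin.
Qed.

Lemma cis_surj0 (R : realType) (u : R * R) : unit_circle u ->
  exists2 t : R, - pi < t <= pi & u = cis t.
Proof.
case: u => x y; rewrite /unit_circle /= => xy.
have x1 : -1 <= x <= 1 by have := sqr_ge0 y; move=> h; apply/andP; split; nra.
have p0 := pi_gt0 R; have a0 := acos_ge0 x1; have ap := acos_lepi x1.
have yE : Num.sqrt (1 - x ^+ 2) = `|y|.
  by rewrite -sqrtr_sqr; congr Num.sqrt; lra.
have [y0|y0] := leP 0 y.
  exists (acos x); first by rewrite ap andbT; lra.
  by rewrite /cis acosK // sin_acos // yE ger0_norm.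
exists (- acos x); last first.
  by rewrite /cis cosN sinN acosK // sin_acos // yE ltr0_norm // opprK.
rewrite ltrN2; apply/andP; split; last by lra.
rewrite lt_neqAle ap andbT; apply/eqP => E.
have : sin (acos x) = 0 by rewrite E sinpi.
by rewrite sin_acos // yE => /eqP; rewrite normr_eq0 lt_eqF.
Qed.

Lemma cis_surj (R : realType) (a : R) (u : R * R) : unit_circle u ->
  exists2 t : R, a - pi < t <= a + pi & u = cis t.
Proof.
move=> cu; have := @cis_surj0 R (rot (cos a) (sin a) u) _ => [].
case.
  rewrite /unit_circle /= -[LHS]/(sqn (rot (cos a) (sin a) u)) sqn_rot ?cos2Dsin2 //.
move=> t /andP[t1 t2] E; exists (a + t); first by apply/andP; split; lra.
move: E; rewrite /rot /cis => -[E1 E2]; rewrite cosD sinD -E1 -E2.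
have cs := cos2Dsin2 a; rewrite [LHS]surjective_pairing; congr (_, _).
  by rewrite -[LHS]mul1r -cs; ring.
by rewrite -[LHS]mul1r -cs; ring.
Qed.

Lemma dot_cis (R : realType) (s t : R) : dot (cis s) (cis t) = cos (s - t).
Proof. by rewrite /dot /cis cosB. Qed.

(** The inner product with [cis a] is cos(t - a); once it exceeds cos d, the representative [t]
    within pi of [a] is within d of it. *)
Lemma nbhs_cis (R : realType) (a d : R) : 0 < d ->
  \forall u \near cis a, unit_circle u -> exists2 t, `|t - a| < d & u = cis t.
Proof.
move=> d0; wlog dpi : d d0 / d <= pi.
  move=> wl; have [|/ltW] := leP d pi; first exact: wl.
  move=> pd; apply: filterS (wl pi (pi_gt0 R) (lexx _)) => u h /h[t td ->].
  by exists t => //; exact: lt_le_trans pd.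
have c := @continuous_dot R (cis a) (cis a); rewrite /continuous_at dot_cis subrr cos0 in c.
have cd : cos d < 1.
  by rewrite -(cos0 R) ltr_cos ?in_itv /= ?lexx ?pi_ge0 // ltW.
move: c => /cvgrPdist_lt/(_ (1 - cos d)); rewrite subr_gt0 => /(_ cd).
apply: filterS => u; rewrite ltr_norml => /andP[_ h] cu.
have [t /andP[t1 t2] uE] := cis_surj a cu.
exists t => //; move: h; rewrite uE dot_cis => h.
have tpi : `|t - a| <= pi by rewrite ler_norml; apply/andP; split; lra.
have : cos d < cos `|t - a|.
  have -> : cos `|t - a| = cos (t - a) by case: ger0P => // _; rewrite cosN.
  lra.
by rewrite ltr_cos // in_itv /= ?tpi ?normr_ge0 // dpi ltW.
Qed.

Lemma nbhs_normalize (R : realType) (p : R * R) (U : set (R * R)) : unit_circle p -> nbhs p U ->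
  \forall x \near p, 0 < sqn x /\ U (x.1 / Num.sqrt (sqn x), x.2 / Num.sqrt (sqn x)).
Proof.
move=> cp /nbhs_box[e e0 He].
have p1 : sqn p = 1 by exact: cp.
have cs : (fun x : R * R => Num.sqrt (sqn x)) x @[x --> p] --> (1 : R).
  rewrite -[X in _ --> X](sqrtr1 R) -p1.
  apply: (@continuous_comp _ _ _ (@sqn R) Num.sqrt); last exact: sqrt_continuous.
  exact: continuous_sqnorm.
have ci : (fun x : R * R => (Num.sqrt (sqn x))^-1) x @[x --> p] --> (1 : R).
  by rewrite -[X in _ --> X]invr1; apply: cvgV; rewrite ?oner_eq0.
have c1 : (fun x : R * R => x.1 / Num.sqrt (sqn x)) x @[x --> p] --> p.1.
  rewrite -[X in _ --> X]mulr1; apply: cvgM ci; exact: continuous_fst.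
have c2 : (fun x : R * R => x.2 / Num.sqrt (sqn x)) x @[x --> p] --> p.2.
  rewrite -[X in _ --> X]mulr1; apply: cvgM ci; exact: continuous_snd.
have c3 := @continuous_sqnorm R p.
move: c1 => /cvgrPdist_lt/(_ e e0) c1; move: c2 => /cvgrPdist_lt/(_ e e0) c2.
move: c3 => /cvgrPdist_lt/(_ 1 ltr01) c3.
apply: filterS3 c1 c2 c3 => x h1 h2 h3; split; last exact: He.
by move: h3; rewrite -/(sqn p) -/(sqn x) p1 ltr_norml => /andP[_]; lra.
Qed.

Lemma is_derive_fst_snd (R : realType) (g : R -> R * R) (t : R) : derivable g t 1 ->
  is_derive t 1 (fun s => (g s).1) (derive1 g t).1 /\
  is_derive t 1 (fun s => (g s).2) (derive1 g t).2.
Proof.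
move=> dg; rewrite derive1E.
have lim_g : (fun h => h^-1 *: (g (h *: 1 + t) - g t)) h @[h --> 0^'] --> 'D_1 g t by [].
have h1 := cvg_comp _ _ lim_g (@continuous_fst R ('D_1 g t)).
have h2 := cvg_comp _ _ lim_g (@continuous_snd R ('D_1 g t)).
split; split; [exact: cvgP h1|exact: cvg_lim h1|exact: cvgP h2|exact: cvg_lim h2].
Qed.

Lemma is_derive_sqn_path (R : realType) (g : R -> R * R) (t : R) : derivable g t 1 ->
  is_derive t 1 (fun s => sqn (g s)) (2 * dot (g t) (derive1 g t)).
Proof.
move=> /is_derive_fst_snd[d1 d2].
apply: (is_derive_eq (is_deriveD (is_deriveM d1 d1) (is_deriveM d2 d2))).
by rewrite /GRing.scale /dot /=; ring.
Qed.

Lemma derivable_continuous (R : realType) (g : R -> R * R) (t : R) : derivable g t 1 ->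
  {for t, continuous g}.
Proof. by move=> dg; apply: differentiable_continuous; apply/derivable1_diffP. Qed.

Lemma is_derive_below (R : realType) (f : R -> R) (a : R) (P : R -> Prop) :
  is_derive (0 : R) 1 f a -> a != 0 -> (\forall t \near (0 : R), P t) ->
  exists2 t, P t & f t < f 0.
Proof.
move=> df a0 /nbhs_ballP[d /= d0 Hd]; apply: contrapT => nex.
have H t : `|t| < d -> 0 <= f t - f 0.
  move=> td; rewrite subr_ge0 leNgt; apply/negP => ft; apply: nex; exists t => //.
  by apply: Hd; rewrite /ball /= sub0r normrN.
have dr := is_deriveB df (is_derive_cst (f 0) (0 : R) 1).
have df' : is_derive (- (0 : R)) 1 f a by rewrite oppr0.
have dl := is_deriveB (@is_derive1_comp R f -%R (0 : R) _ _ df' (is_deriveNid (0 : R) 1))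
  (is_derive_cst (f 0) (0 : R) 1).
have a1 : 0 <= a - 0.
  apply: (is_derive_ge0_right d0 dr) => [|t /andP[t0 td]]; first exact: subrr.
  by apply: H; rewrite gtr0_norm.
have a2 := is_derive_ge0_right d0 dl.
move: a0; rewrite -(subr0 a) eq_le a1 andbT subr0 => /negP; apply.
rewrite -oppr_ge0 -mulN1r mulrC -[a * -1]subr0; apply: a2 => [|t /andP[t0 td]].
  by apply/eqP; rewrite subr_eq0 /= oppr0.
by apply: H; rewrite normrN gtr0_norm.
Qed.

(** Since |h| = 1 along the circle, h' is orthogonal to p. If g' were orthogonal to p as well, the
    two tangents would be parallel; hence |g|^2 has nonzero derivative. *)
Lemma transverse_derive (R : realType) (C : set (R * R)) (p : R * R) :
  transverse C (@unit_circle R) -> C p -> unit_circle p ->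
  exists (g : R -> R * R) (a : R), [/\ g 0 = p, {for (0 : R), continuous g},
    \forall t \near (0 : R), C (g t),
    is_derive (0 : R) 1 (fun s => sqn (g s)) a & a != 0].
Proof.
move=> tC Cp cp; have [g [h [[g0 [e [e0 [_ [U _ gU] dg _ _]]]] [h0 [e' [e'0 [_ [V _ hV] dh _ hn]]]]]]] := tC p Cp cp.
move=> fr; have z0 : (0 : R) \in `]- e, e[ by rewrite in_itv /= e0 oppr_lt0 e0.
have z0' : (0 : R) \in `]- e', e'[ by rewrite in_itv /= e'0 oppr_lt0 e'0.
have dg0 := dg 0 z0.
exists g, (2 * dot (g 0) (derive1 g 0)); split => //.
- exact: derivable_continuous.
- have : \forall t \near (0 : R), t \in `]- e, e[ by exact: near_in_itvoo.
  apply: filterS => t te; have : (C `&` U) (g t) by rewrite -gU; exists t.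
  by case.
- exact: is_derive_sqn_path.
have dhs := is_derive_sqn_path (dh 0 z0').
have hp : dot p (derive1 h 0) = 0.
  have cst1 : \forall t \near (0 : R), sqn (h t) = 1.
    have : \forall t \near (0 : R), t \in `]- e', e'[ by exact: near_in_itvoo.
    apply: filterS => t te; have : (@unit_circle R `&` V) (h t) by rewrite -hV; exists t.
    by case.
  apply/eqP; apply: contraT => n0.
  have a0 : 2 * dot (h 0) (derive1 h 0) != 0 by rewrite mulf_neq0 // h0.
  have [t ht] := is_derive_below dhs a0 cst1.
  by rewrite ht h0 /sqn cp ltxx.
rewrite g0 mulf_neq0 //; apply/eqP => gp.
have hn0 := hn 0 z0'.
move: (derive1 g 0) (derive1 h 0) hn0 gp hp fr => w z z_neq0 wp zp.
rewrite free_cons span_seq1 => /andP[/negP nw _]; apply: nw; apply/vlineP.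
have par : w.1 * z.2 = w.2 * z.1.
  move: cp wp zp; rewrite /unit_circle /dot /= => cp wp zp.
  rewrite -[LHS]mul1r -[RHS]mul1r -cp.
  have E1 : p.1 * w.1 = - (p.2 * w.2) by lra.
  have E2 : p.1 * z.1 = - (p.2 * z.2) by lra.
  transitivity (p.1 * (p.1 * w.1) * z.2 + p.2 ^+ 2 * w.1 * z.2); first by ring.
  transitivity (p.1 * (p.1 * z.1) * w.2 + p.2 ^+ 2 * z.1 * w.2); last by ring.
  rewrite E1 E2.
  transitivity (p.2 * z.2 * (- p.1 * w.2 + p.2 * w.1)); first by ring.
  transitivity (p.2 * w.2 * (- p.1 * z.2 + p.2 * z.1)); last by ring.
  have [p2|p2] := eqVneq p.2 0; first by rewrite p2; ring.
  have w2 : w.2 = - (p.1 * w.1) / p.2 by rewrite E1 opprK; field.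
  have z2 : z.2 = - (p.1 * z.1) / p.2 by rewrite E2 opprK; field.
  by rewrite w2 z2; field.
have [z1|z1] := eqVneq z.1 0.
  have z2 : z.2 != 0.
    by apply: contraNneq z_neq0 => z2; rewrite (surjective_pairing z) z1 z2.
  exists (w.2 / z.2); rewrite [LHS]surjective_pairing [RHS]surjective_pairing /= z1.
  have w1 : w.1 = 0 by apply: (mulIf z2); rewrite par z1 mul0r mulr0.
  by congr (_, _); rewrite /GRing.scale /= ?mulr0 // divfK.
exists (w.1 / z.1); rewrite [LHS]surjective_pairing [RHS]surjective_pairing /=.
congr (_, _); rewrite /GRing.scale /= ?divfK //.
by apply: (mulIf z1); rewrite -par; field.
Qed.

(** The boundary curve reaches both sides of the circle near [p]. A boundary point inside the disk
    cannot have its radial projection in [K], as it would then be interior by scaling; a boundary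
    point outside the disk has an interior projection. *)
Lemma transverse_crossing (R : realType) (K : set (R * R)) (p : R * R) (U : set (R * R)) :
  closed K -> convex_set K -> interior K (0, 0) ->
  transverse (boundary K) (@unit_circle R) -> boundary K p -> unit_circle p -> nbhs p U ->
  ~ (forall u, unit_circle u -> U u -> u != p -> interior K u) /\
  ~ (forall u, unit_circle u -> U u -> u != p -> ~ K u).
Proof.
move=> clK cK i0 tK bp cp nU.
have [g [a [g0 cg gK dg a0]]] := transverse_derive tK bp cp.
have bK x : boundary K x -> K x /\ ~ interior K x.
  by case=> h nx; split => //; rewrite ((closure_id K).1 clK).
have near0 : \forall t \near (0 : R), boundary K (g t) /\ (0 < sqn (g t) /\
    U ((g t).1 / Num.sqrt (sqn (g t)), (g t).2 / Num.sqrt (sqn (g t)))).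
  have gU : \forall t \near (0 : R), 0 < sqn (g t) /\
      U ((g t).1 / Num.sqrt (sqn (g t)), (g t).2 / Num.sqrt (sqn (g t))).
    have /cg : nbhs (g 0) [set x | 0 < sqn x /\ U (x.1 / Num.sqrt (sqn x), x.2 / Num.sqrt (sqn x))].
      by rewrite g0; exact: nbhs_normalize.
    by [].
  by apply: filterS2 gK gU.
have xE (x : R * R) : 0 < sqn x ->
    (Num.sqrt (sqn x) * (x.1 / Num.sqrt (sqn x)), Num.sqrt (sqn x) * (x.2 / Num.sqrt (sqn x))) = x.
  move=> x0; rewrite [RHS]surjective_pairing.
  by congr (_, _); rewrite mulrC divfK // gt_eqF // sqrtr_gt0.
have g01 : sqn (g 0) = 1 by rewrite g0.
split=> H.
  have [t [bt [t0 tU]]] := is_derive_below dg a0 near0; rewrite g01 => t1.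
  apply: (bK _ bt).2; rewrite -(xE _ t0).
  apply: (@interior_scale _ K ((g t).1 / Num.sqrt (sqn (g t)), (g t).2 / Num.sqrt (sqn (g t)))) => //; last first.
    by rewrite sqrtr_ge0 -[X in _ < X]sqrtr1 ltr_sqrt.
  have cu := unit_circle_normalize t0.
  have [->|np] := eqVneq ((g t).1 / Num.sqrt (sqn (g t)), (g t).2 / Num.sqrt (sqn (g t))) p.
    exact: (bK _ bp).1.
  exact: interior_subset (H _ cu tU np).
have a0' : - a != 0 by rewrite oppr_eq0.
have [t [bt [t0 tU]]] := is_derive_below (is_deriveN dg) a0' near0.
rewrite /= ltrN2 g01 => t1; have cu := unit_circle_normalize t0.
have n1 : 1 < Num.sqrt (sqn (g t)) by rewrite -[X in X < _]sqrtr1 ltr_sqrt.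
have iu : interior K ((g t).1 / Num.sqrt (sqn (g t)), (g t).2 / Num.sqrt (sqn (g t))).
  have := @interior_scale _ K (g t) (Num.sqrt (sqn (g t)))^-1 cK i0 (bK _ bt).1.
  rewrite invr_ge0 sqrtr_ge0 invf_lt1 ?(lt_trans ltr01) // n1 => /(_ isT).
  by rewrite mulrC (mulrC _ (g t).2).
have [up|np] := eqVneq ((g t).1 / Num.sqrt (sqn (g t)), (g t).2 / Num.sqrt (sqn (g t))) p.
  by apply: (bK _ bp).2; rewrite -up.
exact: H cu tU np (interior_subset iu).
Qed.

(** Without boundary points, the parameters sent into [K] form a subset that is both open and closed
    in the connected set [I]. *)
Lemma arc_constant (R : realType) (K : set (R * R)) (I : set R) : closed K -> is_interval I ->
  (forall t, I t -> ~ boundary K (cis t)) ->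
  (forall t, I t -> interior K (cis t)) \/ (forall t, I t -> ~ K (cis t)).
Proof.
move=> clK iI nb.
have intK t : I t -> K (cis t) -> interior K (cis t).
  move=> It Kt; apply: contrapT => ni; apply: (nb t It); split => //.
  exact: subset_closure.
have [[t0 [It0 Kt0]]|none] := pselect (exists t, I t /\ K (cis t)); last first.
  by right => t It Kt; apply: none; exists t.
left => t It; apply: (intK t It).
pose B := I `&` [set t | K (cis t)].
suff BI : B = I by have : I t by []; rewrite -BI => -[].
have cI : connected I by apply/connected_intervalP.
apply: cI; first by exists t0.
  exists [set t | interior K (cis t)].
    apply: (@open_comp _ _ (@cis R) (interior K)); last exact: open_interior.
    by move=> x _; exact: continuous_cis.
  apply/seteqP; split => x [Ix]; first by move=> /(intK x Ix).
  by move=> /interior_subset.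
exists [set t | K (cis t)] => //.
by apply: (@preimage_closed _ _ (@cis R) K) => // x _; exact: continuous_cis.
Qed.

(* Pole of the chord joining [cis a] and [cis b]. *)
Definition gap_vec (R : realType) (a b : R) : R * R :=
  (cos ((a + b) / 2) / cos ((b - a) / 2), sin ((a + b) / 2) / cos ((b - a) / 2)).

Section GapVec.
Variables (R : realType) (a b : R).
Hypotheses (ab : a < b) (bapi : b < a + pi).
Let h0 : 0 < (b - a) / 2.
Proof. by rewrite divr_gt0 // subr_gt0. Qed.
Let hpi : (b - a) / 2 < pi / 2.
Proof. by rewrite ltr_pM2r ?invr_gt0 // ltrBlDl. Qed.

Lemma cos_half_gap_gt0 : 0 < cos ((b - a) / 2).
Proof. by apply: cos_gt0_pihalf; rewrite hpi andbT; have := h0; have := pi_gt0 R; lra. Qed.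

Lemma dot_gap_vec (t : R) : dot (cis t) (gap_vec a b) = cos (t - (a + b) / 2) / cos ((b - a) / 2).
Proof. by rewrite /dot /cis /gap_vec /= cosB; ring. Qed.

Lemma sqn_gap_vec : sqn (gap_vec a b) = (cos ((b - a) / 2) ^+ 2)^-1.
Proof.
rewrite /sqn /gap_vec /= !expr_div_n -mulrDl cos2Dsin2 mul1r //.
Qed.

Lemma sin_half_gap_gt0 : 0 < sin ((b - a) / 2).
Proof. by apply: sin_gt0_pi; rewrite h0; have := hpi; have := pi_gt0 R; lra. Qed.

Lemma sqn_gap_vec_gt1 : 1 < sqn (gap_vec a b).
Proof.
have c0 := cos_half_gap_gt0; have s0 := sin_half_gap_gt0.
rewrite sqn_gap_vec invf_gt1 ?exprn_gt0 //.
have := cos2Dsin2 ((b - a) / 2); have : 0 < sin ((b - a) / 2) ^+ 2 by rewrite exprn_gt0.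
lra.
Qed.

Lemma rr_gap_vec : rr (gap_vec a b) = sin ((b - a) / 2) / cos ((b - a) / 2).
Proof.
have c0 := cos_half_gap_gt0; have s0 := sin_half_gap_gt0.
rewrite /rr sqn_gap_vec (_ : _ - 1 = (sin ((b - a) / 2) / cos ((b - a) / 2)) ^+ 2).
  by rewrite sqrtr_sqr gtr0_norm // divr_gt0.
rewrite expr_div_n -[X in _ - X](divff (_ : cos ((b - a) / 2) ^+ 2 != 0)); last first.
  by rewrite expf_neq0 // gt_eqF.
by rewrite -{1}[_^-1]mul1r -mulrBl; congr (_ / _); have := cos2Dsin2 ((b - a) / 2); lra.
Qed.

(** Together with [hy_gap_vec] this says (cis b)^2 - (cis a)^2 = 4 i (hh + i hy), which is how the
    squares of the crossing points enter. *)
Lemma hh_gap_vec : 4 * hh (gap_vec a b) = sin (b + b) - sin (a + a).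
Proof.
have c0 := cos_half_gap_gt0.
set h := (b - a) / 2 in c0 *; set m := (a + b) / 2.
have bE : b + b = m + m + (h + h) by rewrite /m /h; field.
have aE : a + a = m + m - (h + h) by rewrite /m /h; field.
rewrite bE aE (_ : sin _ - sin _ = 2 * cos (m + m) * sin (h + h)); last by rewrite sinB (sinD (m + m) (h + h)); ring.
rewrite /hh rr_gap_vec sqn_gap_vec /gap_vec /= -/m -/h.
rewrite cosD sinD; field; rewrite gt_eqF //; exact: c0.
Qed.

Lemma hy_gap_vec : 4 * hy (gap_vec a b) = cos (a + a) - cos (b + b).
Proof.
have c0 := cos_half_gap_gt0.
set h := (b - a) / 2 in c0 *; set m := (a + b) / 2.
have bE : b + b = m + m + (h + h) by rewrite /m /h; field.
have aE : a + a = m + m - (h + h) by rewrite /m /h; field.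
rewrite bE aE (_ : cos _ - cos _ = 2 * sin (m + m) * sin (h + h)); last by rewrite cosB (cosD (m + m) (h + h)); ring.
rewrite /hy rr_gap_vec sqn_gap_vec /gap_vec /= -/m -/h.
rewrite !sinD; field; rewrite gt_eqF //; exact: c0.
Qed.

End GapVec.

(** Clearing the cosines leaves |cos e| < cos k, where e is the distance of the midpoints and k the
    sum of the half-widths. Here b < c gives k < e, and d < a + pi, which keeps the second gap off
    the antipode of the first, gives e < pi - k. *)
Lemma pair_lt_gap_vec (R : realType) (a b c d : R) : a < b -> b < c -> c < d -> d < a + pi ->
  pair_lt (gap_vec a b) (gap_vec c d).
Proof.
move=> ab bc cd da; have p0 := pi_gt0 R.
have bapi : b < a + pi by lra.
have dcpi : d < c + pi by lra.
rewrite /pair_lt !rr_gap_vec //.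
have c1 := cos_half_gap_gt0 ab bapi; have c2 := cos_half_gap_gt0 cd dcpi.
have -> : dot (gap_vec a b) (gap_vec c d) =
    cos ((c + d) / 2 - (a + b) / 2) / (cos ((b - a) / 2) * cos ((d - c) / 2)).
  by rewrite /dot /gap_vec /= cosB; field; rewrite !gt_eqF.
rewrite normrM normfV (gtr0_norm (mulr_gt0 c1 c2)).
rewrite mulrACA -invfM -mulrDl ltr_pdivrMr ?mulr_gt0 // mul1r -ltrBrDr -cosD.
set k := (b - a) / 2 + (d - c) / 2; set e := (c + d) / 2 - (a + b) / 2.
have ke : k < e by rewrite /k /e; lra.
have ek : e < pi - k by rewrite /k /e; lra.
have k0 : 0 < k by rewrite /k; lra.
rewrite ltr_norml; apply/andP; split.
  have -> : - cos k = cos (pi - k) by rewrite addrC cosDpi cosN.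
  by rewrite ltr_cos ?in_itv /=; try apply/andP; try split; lra.
by rewrite ltr_cos ?in_itv /=; try apply/andP; try split; lra.
Qed.

(** * The gap system of a half turn *)

Lemma interiorN (R : realType) (K : set (R * R)) (u : R * R) : centrally_symmetric K ->
  interior K u -> interior K (- u).
Proof.
move=> sK /nbhs_box[e e0 He]; apply/nbhs_box; exists e => // y h1 h2.
rewrite -(opprK y); apply: (symmetricN sK); apply: He.
  by rewrite /= -normrN opprD opprK; move: h1 h2.
by rewrite /= -normrN opprD opprK; move: h1 h2.
Qed.

Lemma increasing_le (R : realType) (tau : nat -> R) (N : nat) :
  (forall k, (k < N)%N -> tau k < tau k.+1) ->
  forall i j, (i <= j <= N)%N -> tau i <= tau j.
Proof.
move=> mono i j /andP[]; elim: j => [|j IH]; first by rewrite leqn0 => /eqP ->.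
rewrite leq_eqVlt => /orP[/eqP -> //|ij] jN.
exact: le_trans (IH ij (ltnW jN)) (ltW (mono j jN)).
Qed.

Lemma increasing_lt (R : realType) (tau : nat -> R) (N : nat) :
  (forall k, (k < N)%N -> tau k < tau k.+1) ->
  forall i j, (i < j)%N -> (j <= N)%N -> tau i < tau j.
Proof.
move=> mono i j ij jN; apply: lt_le_trans (mono i (leq_trans ij jN)) _.
by apply: (increasing_le mono); rewrite jN andbT.
Qed.

Lemma increasing_locate (R : realType) (tau : nat -> R) (N : nat) (t : R) :
  tau 0%N <= t -> t < tau N -> exists k, (k < N)%N /\ tau k <= t < tau k.+1.
Proof.
move=> t0; elim: N => [|N IH] tN; first by move: tN; rewrite ltNge t0.
have [/IH[k [kN h]]|h] := ltP t (tau N); first by exists k; split => //; exact: leqW.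
by exists N; rewrite h.
Qed.

Section HalfTurn.
Variables (R : realType) (K : set (R * R)) (tau : nat -> R) (n : nat).
Hypotheses (clK : closed K) (sK : centrally_symmetric K).
Hypothesis mono : forall k, (k < n.*2)%N -> tau k < tau k.+1.
Hypothesis turn : tau n.*2 = tau 0%N + pi.
Hypothesis bd : forall k, (k <= n.*2)%N -> boundary K (cis (tau k)).
Hypothesis gaps : forall i, (i < n)%N -> forall t, tau i.*2 < t < tau i.*2.+1 -> ~ K (cis t).
Hypothesis sides : forall i, (i < n)%N -> forall t, tau i.*2.+1 < t < tau i.+1.*2 ->
  interior K (cis t).

Let dbl i : (i < n)%N -> (i.*2.+2 <= n.*2)%N.
Proof. by rewrite -doubleS leq_double. Qed.

Let lt01 i : (i < n)%N -> tau i.*2 < tau i.*2.+1.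
Proof. by move=> /dbl h; apply: mono; exact: ltnW. Qed.

Let ltpi i : (i < n)%N -> tau i.*2.+1 < tau i.*2 + pi.
Proof.
move=> /dbl h; apply: (@lt_le_trans _ _ (tau n.*2)); first exact: (increasing_lt mono h).
rewrite turn lerD2r; apply: (increasing_le mono); rewrite /=.
by rewrite ltnW // ltnW.
Qed.

(** Measured from the middle of the gap, an angle of the half turn avoids the inside of the
    antipodal gap. This removes the ambiguity of |cos| between a gap and its antipode. *)
Let far i t : (i < n)%N -> tau 0%N <= t < tau 0%N + pi ->
  [/\ - (pi - (tau i.*2.+1 - tau i.*2) / 2) <= t - (tau i.*2 + tau i.*2.+1) / 2,
      t - (tau i.*2 + tau i.*2.+1) / 2 < pi - (tau i.*2.+1 - tau i.*2) / 2 &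
      - (pi - (tau i.*2.+1 - tau i.*2) / 2) = t - (tau i.*2 + tau i.*2.+1) / 2 -> t = tau 0%N].
Proof.
move=> iN /andP[t0 t1].
have a0 : tau 0%N <= tau i.*2.
  by apply: (increasing_le mono); rewrite /= ltnW // ltnW // dbl.
have b0 : tau i.*2.+1 <= tau 0%N + pi.
  by rewrite -turn; apply: (increasing_le mono); rewrite leqnn andbT ltnW // dbl.
move: (tau i.*2) (tau i.*2.+1) (tau 0%N) a0 b0 t0 t1 => a b c a0 b0 t0 t1.
by split => [| |h]; lra.
Qed.

Let half_turn (u : R * R) : unit_circle u ->
  exists2 t, tau 0%N <= t < tau 0%N + pi & u = cis t \/ u = - cis t.
Proof.
move=> cu; have [t /andP[t1 t2] uE] := cis_surj (tau 0%N) cu; have p0 := pi_gt0 R.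
have [tt|tt] := ltP t (tau 0%N).
  exists (t + pi); last by right; rewrite cisDpi opprK.
  by rewrite -lerBlDr ltW //= ltrD2r.
have [t3|t3] := ltP t (tau 0%N + pi); first by exists t; [rewrite tt|left].
exists (tau 0%N); first by rewrite lexx ltrDl.
by right; rewrite -cisDpi uE; congr cis; apply/eqP; rewrite eq_le t2.
Qed.

Let cos_gt (x h : R) : 0 < h -> h < pi / 2 -> - (pi - h) <= x -> x < pi - h ->
  [/\ cos h < `|cos x| -> `|x| < h, `|x| <= h -> cos h <= `|cos x| &
     `|cos x| = cos h -> `|x| = h \/ - (pi - h) = x].
Proof.
move=> h0 hp x1 x2.
have xn : cos x = cos `|x| by case: (ger0P x) => // _; rewrite cosN.
have x3 : `|x| <= pi - h by rewrite ler_norml x1 ltW.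
have hpi : h \in `[0, pi]%R by rewrite in_itv /=; apply/andP; split; lra.
have xpi : `|x| \in `[0, pi]%R by rewrite in_itv /= normr_ge0 /=; lra.
have phpi : pi - h \in `[0, pi]%R by rewrite in_itv /=; apply/andP; split; lra.
have ch : cos (pi - h) = - cos h by rewrite addrC cosDpi cosN.
have le_cos (y z : R) : y \in `[0, pi]%R -> z \in `[0, pi]%R -> (cos z <= cos y) = (y <= z).
  by move=> hy hz; rewrite !leNgt ltr_cos.
have lb : - cos h <= cos x by rewrite -ch xn le_cos.
split.
- move=> H; rewrite -(ltr_cos xpi hpi) /= -xn; move: H; rewrite lter_normr => /orP[//|]; lra.
- by move=> H; rewrite lter_normr xn le_cos // H.
- case: (ger0P (cos x)) => _ E.
    by left; apply: (cos_inj xpi hpi); rewrite -xn.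
  right; have E' : `|x| = pi - h by apply: (cos_inj xpi phpi); rewrite ch -xn -E opprK.
  move: E'; case: (ger0P x) => _ E'; lra.
Qed.

Let gap_abs i (u : R * R) t : (i < n)%N -> u = cis t \/ u = - cis t ->
  `|dot u (gap_vec (tau i.*2) (tau i.*2.+1))| =
  `|cos (t - (tau i.*2 + tau i.*2.+1) / 2)| / cos ((tau i.*2.+1 - tau i.*2) / 2).
Proof.
move=> iN uE; have c0 := cos_half_gap_gt0 (lt01 iN) (ltpi iN).
have -> : `|dot u (gap_vec (tau i.*2) (tau i.*2.+1))| =
    `|dot (cis t) (gap_vec (tau i.*2) (tau i.*2.+1))|.
  by case: uE => -> //; rewrite dotNl normrN.
by rewrite dot_gap_vec normrM normfV (gtr0_norm c0).
Qed.

Let KN (u : R * R) t : u = cis t \/ u = - cis t -> (K u <-> K (cis t)) /\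
  (interior K u <-> interior K (cis t)).
Proof.
case=> ->; first by [].
split; split; [|exact: symmetricN| |exact: interiorN].
  by move/(symmetricN sK); rewrite opprK.
by move/(interiorN sK); rewrite opprK.
Qed.

Let bK k : (k <= n.*2)%N -> K (cis (tau k)) /\ ~ interior K (cis (tau k)).
Proof. by move/bd => [h nx]; split => //; rewrite ((closure_id K).1 clK). Qed.

(** Every point of the circle is, up to sign, at an angle of the half turn, and both [K] and the
    strips are symmetric. There |cos| of the distance to the middle of a gap, compared with the
    cosine of its half-width, decides membership in the gap. *)
Lemma gap_system_half_turn :
  gap_system K [seq gap_vec (tau i.*2) (tau i.*2.+1) | i <- iota 0 n].
Proof.
have hh0 i : (i < n)%N -> 0 < (tau i.*2.+1 - tau i.*2) / 2.
  by move=> iN; rewrite divr_gt0 // subr_gt0 lt01.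
have hh1 i : (i < n)%N -> (tau i.*2.+1 - tau i.*2) / 2 < pi / 2.
  by move=> iN; rewrite ltr_pM2r ?invr_gt0 // ltrBlDl ltpi.
split.
- rewrite /strict all_map; apply/andP; split.
    apply/allP => i; rewrite mem_iota add0n => /andP[_ iN] /=.
    exact: sqn_gap_vec_gt1 (lt01 iN) (ltpi iN).
  apply/(pairwiseP (0, 0)) => i j; rewrite !inE size_map size_iota => iN jN ij.
  rewrite !(nth_map 0%N) ?size_iota // !nth_iota // !add0n.
  apply: pair_lt_gap_vec; [exact: lt01| |exact: lt01|].
    apply: (increasing_lt mono); first by rewrite -doubleS leq_double.
    by rewrite ltnW // ltnW // dbl.
  apply: (@lt_le_trans _ _ (tau n.*2)); first exact: (increasing_lt mono (dbl jN)).
  rewrite turn lerD2r; apply: (increasing_le mono).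
  by rewrite /= ltnW // ltnW // dbl.
- move=> u cu small; have [t tt uE] := half_turn cu.
  apply/(KN uE).2.
  have [k [kN /andP[k1 k2]]] : exists k, (k < n.*2)%N /\ tau k <= t < tau k.+1.
    by move: tt => /andP[t0 t1]; apply: increasing_locate => //; rewrite turn.
  have iN : (k./2 < n)%N by rewrite ltn_half_double.
  have := small _ (map_f _ (_ : k./2 \in iota 0 n)); rewrite mem_iota add0n iN => /(_ isT).
  rewrite (gap_abs iN uE) ltr_pdivrMr ?mul1r ?cos_half_gap_gt0 ?lt01 ?ltpi // => hc.
  have [f1 f2 _] := far iN tt.
  have [_ H _] := cos_gt (hh0 _ iN) (hh1 _ iN) f1 f2.
  have nle : ~ `|t - (tau k./2.*2 + tau k./2.*2.+1) / 2| <= (tau k./2.*2.+1 - tau k./2.*2) / 2.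
    by move/H; rewrite leNgt hc.
  have kE := odd_double_half k; case: (odd k) kE => kE; last first.
    rewrite add0n in kE; exfalso; apply: nle.
    move: k1 k2; rewrite -{1 2}kE => k1 k2.
    by rewrite ler_norml; move: (tau _) (tau _) k1 k2 => a b; lra.
  rewrite add1n in kE; move: k1 k2; rewrite -{1 2}kE => k1 k2.
  apply: (sides iN); rewrite doubleS k2 andbT lt_neqAle k1 andbT.
  apply/eqP => E; apply: nle; have l := lt01 iN.
  by rewrite -E ler_norml; move: (tau _) (tau _) l => a b; lra.
- move=> u v cu /mapP[i +]; rewrite mem_iota add0n => /andP[_ iN] ->.
  have [t tt uE] := half_turn cu.
  rewrite (gap_abs iN uE) ltr_pdivlMr ?mul1r ?cos_half_gap_gt0 ?lt01 ?ltpi // => hc.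
  have [f1 f2 _] := far iN tt.
  have [H _ _] := cos_gt (hh0 _ iN) (hh1 _ iN) f1 f2.
  move: (H hc); rewrite ltr_norml => /andP[h1 h2] /(KN uE).1; apply: (gaps iN).
  by move: (tau _) (tau _) h1 h2 => a b; lra.
- move=> u v cu /mapP[i +]; rewrite mem_iota add0n => /andP[_ iN] ->.
  have [t tt uE] := half_turn cu.
  have c0 := cos_half_gap_gt0 (lt01 iN) (ltpi iN).
  rewrite (gap_abs iN uE) => /(congr1 ( *%R^~ (cos ((tau i.*2.+1 - tau i.*2) / 2)))).
  rewrite divfK ?gt_eqF // mul1r => hc.
  have [f1 f2 f3] := far iN tt.
  have [_ _ H] := cos_gt (hh0 _ iN) (hh1 _ iN) f1 f2.
  suff [k [kN tE]] : exists k, (k <= n.*2)%N /\ t = tau k.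
    have [h1 h2] := bK kN; have [KE IE] := KN uE; rewrite tE in KE IE.
    by split; [apply/KE|move/IE].
  case: (H hc); last first.
    by move/f3 => ->; exists 0%N.
  move: iN => /dbl/ltnW iN2; case: ger0P => _ E.
    by exists i.*2.+1; split=> //; move: E; move: (tau _) (tau _) => a b; lra.
  by exists i.*2; split; [exact: ltnW|move: E; move: (tau _) (tau _) => a b; lra].
Qed.

End HalfTurn.

(** * Antipodal indices and alternating sums *)

Lemma cis_inj (R : realType) (s t : R) : `|s - t| < 2 * pi -> cis s = cis t -> s = t.
Proof.
move=> st E; have c1 : cos `|s - t| = 1.
  have : cos (s - t) = 1 by rewrite -dot_cis E dot_cis subrr cos0.
  by case: (ger0P (s - t)) => // _; rewrite cosN.
apply/eqP; rewrite -subr_eq0 -normr_eq0; apply/eqP; have p0 := pi_gt0 R.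
have n0 : 0 <= `|s - t| by [].
move: `|s - t| n0 st c1 => x x0 xpi c1.
have z0 : (0 : R) \in `[0, pi]%R by rewrite in_itv /= lexx; lra.
have [xp|xp] := leP x pi.
  have xI : x \in `[0, pi]%R by rewrite in_itv /= x0.
  by apply: (cos_inj xI z0); rewrite c1 cos0.
have yI : 2 * pi - x \in `[0, pi]%R by rewrite in_itv /=; apply/andP; split; lra.
have : 2 * pi - x = 0.
  apply: (cos_inj yI z0); rewrite cos0 (_ : 2 * pi - x = - x + pi + pi); last by ring.
  by rewrite !cosDpi opprK cosN c1.
lra.
Qed.

Lemma lt_sorted_unique (R : realType) (s t : seq R) :
  sorted <%R s -> sorted <%R t -> s =i t -> s = t.
Proof. by apply: irr_sorted_eq; [exact: lt_trans|exact: ltxx]. Qed.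

(** Cut the sorted list of angles at [theta 1] + pi. Adding pi maps the lower part onto the upper
    one, and sorted lists with the same elements are equal, so both parts have m elements and
    correspond index by index. *)
Lemma antipodal_angles (R : realType) (theta : nat -> R) (m : nat) :
  (forall i j, (1 <= i)%N -> (i < j)%N -> (j <= m.*2)%N -> theta i < theta j) ->
  (forall i j, (1 <= i <= m.*2)%N -> (1 <= j <= m.*2)%N -> theta j < theta i + 2 * pi) ->
  (forall j, (1 <= j <= m.*2)%N ->
    exists2 k, (1 <= k <= m.*2)%N & cis (theta k) = - cis (theta j)) ->
  forall j, (1 <= j <= m)%N -> theta (j + m)%N = theta j + pi.
Proof.
move=> mono turn anti j /andP[j1 jm]; have p0 := pi_gt0 R.
have opposite i : (1 <= i <= m.*2)%N -> exists2 k, (1 <= k <= m.*2)%N &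
    theta k = theta i + pi \/ theta k = theta i - pi.
  move=> iN; have [k kN E] := anti i iN; exists k => //.
  have h1 := turn i k iN kN; have h2 := turn k i kN iN.
  have [h|h] := ltP (- pi) (theta k - theta i).
    left; apply: cis_inj; last by rewrite cisDpi.
    by rewrite ltr_norml; apply/andP; split; lra.
  right; apply: cis_inj; first by rewrite ltr_norml; apply/andP; split; lra.
  by rewrite E -{1}(subrK pi (theta i)) cisDpi opprK.
pose L := [seq theta i | i <- iota 1 m.*2].
have sL : sorted <%R L.
  rewrite sorted_pairwise; last exact: lt_trans.
  apply/(pairwiseP 0) => a b; rewrite !inE size_map size_iota => aN bN ab.
  rewrite !(nth_map 0%N) ?size_iota // !nth_iota //.
  by apply: mono; rewrite ?add1n // ltnS.
pose c := theta 1%N + pi.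
pose L1 := [seq x <- L | x < c]; pose L2 := [seq x <- L | c <= x].
have memL i : (1 <= i <= m.*2)%N -> theta i \in L.
  by move=> iN; apply: map_f; rewrite mem_iota add1n ltnS.
have LP x : x \in L -> exists2 i, (1 <= i <= m.*2)%N & x = theta i.
  by move=> /mapP[i +]; rewrite mem_iota add1n ltnS => iN ->; exists i.
have N1 : (1 <= 1 <= m.*2)%N by rewrite /= double_gt0 (leq_trans j1).
have low i : (1 <= i <= m.*2)%N -> theta 1%N <= theta i.
  move=> /andP[]; rewrite leq_eqVlt => /orP[/eqP <- //|i1] iN.
  by apply: ltW; exact: mono.
have s1 : sorted <%R L1 by apply: sorted_filter sL; exact: lt_trans.
have s2 : sorted <%R L2 by apply: sorted_filter sL; exact: lt_trans.
have L12 : [seq x + pi | x <- L1] = L2.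
  apply: lt_sorted_unique => //.
    by rewrite sorted_map; apply: sub_sorted s1 => x y; rewrite /= ltrD2r.
  move=> x; apply/mapP/idP => [[y +]|].
    rewrite mem_filter => /andP[yc /LP[i iN E]] ->; rewrite mem_filter /c lerD2r E low //=.
    have [k kN [<-|E']] := opposite i iN; first exact: memL.
    by exfalso; have := low k kN; move: yc; rewrite /c E E'; lra.
  rewrite mem_filter => /andP[cx /LP[i iN E]].
  have [k kN [E'|E']] := opposite i iN.
    by exfalso; have := turn 1%N k N1 kN; move: cx; rewrite /c E E'; lra.
  exists (theta k); last by rewrite E E' subrK.
  rewrite mem_filter memL // andbT /c E'.
  by have := turn 1%N i N1 iN; lra.
have LE : L = L1 ++ L2.
  apply: lt_sorted_unique => //.
    rewrite sorted_pairwise; last exact: lt_trans.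
    rewrite pairwise_cat -!sorted_pairwise; try exact: lt_trans.
    rewrite s1 s2 !andbT; apply/allrelP => x y.
    by rewrite !mem_filter => /andP[xc _] /andP[yc _]; exact: lt_le_trans yc.
  move=> x; rewrite mem_cat !mem_filter -andb_orl.
  by case: ltP.
have sz : size L1 = m.
  have := congr1 size LE; rewrite size_cat -L12 !size_map size_iota addnn.
  by move/double_inj.
have thE i : (i < m.*2)%N -> theta i.+1 = nth 0 L i.
  by move=> iN; rewrite (nth_map 0%N) ?size_iota // nth_iota.
case: j j1 jm => // j _ jm.
rewrite addSn thE; last by rewrite -addnn ltn_add2r.
rewrite thE; last by rewrite -addnn ltn_addr.
rewrite LE !nth_cat sz jm ltnNge leq_addl /= addnK -L12 (nth_map 0) ?sz //.
Qed.

Lemma sum_odd_nat (V : nmodType) (a : nat -> V) (m : nat) :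
  \sum_(1 <= j < m.*2.+1 | odd j) a j = \sum_(0 <= i < m) a i.*2.+1.
Proof.
elim: m => [|m IH]; first by rewrite !big_geq.
rewrite doubleS big_mkcond big_nat_recr //= big_nat_recr //= -big_mkcond /= IH odd_double /= addr0.
by rewrite [RHS]big_nat_recr.
Qed.

Lemma sum_even_nat (V : nmodType) (a : nat -> V) (m : nat) :
  \sum_(1 <= j < m.*2.+1 | ~~ odd j) a j = \sum_(0 <= i < m) a i.*2.+2.
Proof.
elim: m => [|m IH]; first by rewrite !big_geq.
rewrite doubleS big_mkcond big_nat_recr //= big_nat_recr //= -big_mkcond /= IH odd_double /= addr0.
by rewrite [RHS]big_nat_recr.
Qed.

(** By periodicity each sum is twice its half, and the factor 2 cancels. The shift by [b] exchanges
    the roles of odd and even up to one period, so it only changes the sign of the difference. *)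
Lemma alternating_period (V : numDomainType) (a : nat -> V) (n : nat) (b : bool) :
  (forall j, (1 <= j <= n.*2)%N -> a (j + n.*2)%N = a j) -> (0 < n)%N ->
  (\sum_(1 <= j < (4 * n).+1 | odd j) a j = \sum_(1 <= j < (4 * n).+1 | ~~ odd j) a j) <->
  (\sum_(0 <= i < n) (a (i.*2.+2 + b)%N - a (i.*2.+1 + b)%N) = 0).
Proof.
move=> per n0; have -> : (4 * n = n.*2.*2)%N by rewrite -!muln2 mulnC -mulnA.
rewrite sum_odd_nat sum_even_nat.
have dup (f : nat -> V) : (forall i, (i < n)%N -> f (i + n)%N = f i) ->
    \sum_(0 <= i < n.*2) f i = (\sum_(0 <= i < n) f i) *+ 2.
  move=> fE; rewrite (big_cat_nat (n := n)) //= -?addnn ?leq_addr // mulr2n; congr (_ + _).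
  rewrite -{1}[n]add0n big_addn addnK; apply: eq_big_nat => i /andP[_ iN]; exact: fE.
rewrite (dup (fun i => a i.*2.+1)); last first.
  move=> i iN; rewrite doubleD -addSn per //=.
  by rewrite ltn_double.
rewrite (dup (fun i => a i.*2.+2)); last first.
  by move=> i iN; rewrite doubleD -!addSn per //= -doubleS leq_double.
have inj2 (x y : V) : x *+ 2 = y *+ 2 <-> x = y.
  split=> [E|-> //]; apply/eqP; rewrite -subr_eq0.
  have : (x - y) *+ 2 = 0 by rewrite mulrnBl E subrr.
  by move/eqP; rewrite mulrn_eq0.
rewrite inj2 sumrB.
case: b.
  have -> : \sum_(0 <= i < n) a (i.*2.+2 + true)%N = \sum_(0 <= i < n) a i.*2.+1.
    transitivity (\sum_(0 <= i < n) a i.*2.+3); first by apply: eq_bigr => i _; rewrite addn1.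
    case: n n0 per {dup} => // n _ per.
    rewrite big_nat_recr // [RHS]big_nat_recl //= addrC; congr (_ + _).
    by have := per 1%N; rewrite add1n doubleS => <-.
  have -> : \sum_(0 <= i < n) a (i.*2.+1 + true)%N = \sum_(0 <= i < n) a i.*2.+2.
    by apply: eq_bigr => i _; rewrite addn1.
  by split=> [->|/eqP]; [rewrite subrr|rewrite subr_eq0 => /eqP].
have -> : \sum_(0 <= i < n) a (i.*2.+2 + false)%N = \sum_(0 <= i < n) a i.*2.+2.
  by apply: eq_bigr => i _; rewrite addn0.
have -> : \sum_(0 <= i < n) a (i.*2.+1 + false)%N = \sum_(0 <= i < n) a i.*2.+1.
  by apply: eq_bigr => i _; rewrite addn0.
by split=> [->|/eqP]; [rewrite subrr|rewrite subr_eq0 => /eqP].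
Qed.

Lemma to_complex_cis_sqr (R : realType) (t : R) :
  to_complex (cis t) ^+ 2 = Complex (cos (t + t)) (sin (t + t)).
Proof.
rewrite expr2 /to_complex /cis /= cosD sinD; congr Complex; ring.
Qed.

Lemma sum_complex (R : realType) (I : Type) (s : seq I) (f g : I -> R) :
  \sum_(i <- s) Complex (f i) (g i) = Complex (\sum_(i <- s) f i) (\sum_(i <- s) g i).
Proof.
by elim: s => [|i s IH]; rewrite ?big_nil // !big_cons IH.
Qed.

Lemma sum_gap_vec_eq0 (R : realType) (I : eqType) (s : seq I) (a b : I -> R) :
  (forall i, i \in s -> a i < b i < a i + pi) ->
  \sum_(i <- s) (to_complex (cis (b i)) ^+ 2 - to_complex (cis (a i)) ^+ 2) = 0 <->
  \sum_(v <- [seq gap_vec (a i) (b i) | i <- s]) hh v = 0 /\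
  \sum_(v <- [seq gap_vec (a i) (b i) | i <- s]) hy v = 0.
Proof.
move=> ab; rewrite !big_map.
have -> : \sum_(i <- s) (to_complex (cis (b i)) ^+ 2 - to_complex (cis (a i)) ^+ 2) =
    Complex (- 4 * \sum_(i <- s) hy (gap_vec (a i) (b i))) (4 * \sum_(i <- s) hh (gap_vec (a i) (b i))).
  rewrite !mulr_sumr -sum_complex; apply: eq_big_seq => i /ab/andP[h1 h2].
  rewrite !to_complex_cis_sqr mulNr hh_gap_vec // hy_gap_vec // opprB.
  by [].
split=> [/eqP|[-> ->]]; last by rewrite !mulr0.
by rewrite eq_complex /= !mulf_eq0 oppr_eq0 !pnatr_eq0 /= => /andP[/eqP -> /eqP ->].
Qed.

Lemma MI_position_iff_gap_system (R : realType) (K : set (R * R)) (vs : seq (R * R)) :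
  compact K -> convex_set K -> centrally_symmetric K -> interior K (0, 0) -> gap_system K vs ->
  MI_position K <-> \sum_(v <- vs) hh v = 0 /\ \sum_(v <- vs) hy v = 0.
Proof.
move=> kK cK sK i0 gK; split; first exact: MI_position_sums.
by case; exact: MI_position_gap_system.
Qed.

(** Either the circle is interior to [K] and the empty list of poles is a gap system, or the circle
    misses [K], which then lies in the disk. *)
Lemma MI_position_no_crossing (R : realType) (K : set (R * R)) :
  compact K -> convex_set K -> centrally_symmetric K -> interior K (0, 0) ->
  boundary K `&` @unit_circle R = set0 -> MI_position K.
Proof.
move=> kK cK sK i0 nb; have clK := compact_closed (@norm_hausdorff _ _) kK.
have [||inK|outK] := @arc_constant R K setT clK; first by [].
- move=> t _ bt; have : (boundary K `&` @unit_circle R) (cis t) by split => //; exact: cis_circle.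
  by rewrite nb.
- apply: (@MI_position_gap_system R K [::]); rewrite ?big_nil //; split => // u cu _.
  have [t _ ->] := cis_surj0 cu; exact: inK.
apply: MI_position_subset => // x Kx; rewrite /unit_disk /= -/(sqn x) leNgt; apply/negP => x1.
have x0 : 0 < sqn x by exact: lt_trans x1.
have [t _ tE] := cis_surj0 (unit_circle_normalize x0).
apply: (outK t I); rewrite -tE.
have n1 : 1 < Num.sqrt (sqn x) by rewrite -[X in X < _]sqrtr1 ltr_sqrt.
have := @convex_scale R K x (Num.sqrt (sqn x))^-1 cK (interior_subset i0) Kx.
rewrite invr_ge0 sqrtr_ge0 invf_le1 ?(lt_trans ltr01) // (ltW n1) => /(_ isT).
by rewrite mulrC (mulrC _ x.2).
Qed.

Section Crossings.
Variables (R : realType) (K : set (R * R)) (n : nat) (zeta : nat -> R * R) (theta : nat -> R).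
Hypotheses (kK : compact K) (cK : convex_set K) (sK : centrally_symmetric K).
Hypotheses (i0 : interior K (0, 0)) (tK : transverse (boundary K) (@unit_circle R)).
Hypothesis pts : [set zeta j | j in [set j : nat | (1 <= j <= 4 * n)%N]] =
  boundary K `&` @unit_circle R.
Hypothesis zetaE : forall j, (1 <= j <= 4 * n)%N -> zeta j = cis (theta j).
Hypothesis mono : forall i j, (1 <= i)%N -> (i < j)%N -> (j <= 4 * n)%N -> theta i < theta j.
Hypothesis turn : forall i j, (1 <= i <= 4 * n)%N -> (1 <= j <= 4 * n)%N ->
  theta j < theta i + 2 * pi.
Hypothesis n0 : (0 < n)%N.

Let N4 : (4 * n = n.*2.*2)%N. Proof. by rewrite -!muln2 mulnC -mulnA. Qed.

Let clK : closed K. Proof. exact: compact_closed. Qed.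

Let bd j : (1 <= j <= 4 * n)%N -> boundary K (cis (theta j)).
Proof.
move=> jN; have : [set zeta j | j in [set j : nat | (1 <= j <= 4 * n)%N]] (zeta j) by exists j.
by rewrite pts zetaE // => -[].
Qed.

Let bdP u : boundary K u -> unit_circle u -> exists2 j, (1 <= j <= 4 * n)%N & u = cis (theta j).
Proof.
move=> bu cu; have : (boundary K `&` @unit_circle R) u by [].
by rewrite -pts => -[j jN <-]; exists j => //; exact: zetaE.
Qed.

Let antipodal j : (1 <= j <= n.*2)%N -> theta (j + n.*2)%N = theta j + pi.
Proof.
move: mono turn bd bdP; rewrite N4 => mono' turn' bd' bdP'.
apply: antipodal_angles => // i iN.
have [h ni] := bd' i iN.
have Ki : K (cis (theta i)) by rewrite ((closure_id K).1 clK).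
have [||k kN ->] := bdP' (- cis (theta i)); last by exists k.
  split; first by apply: subset_closure; exact: symmetricN.
  by move/(interiorN sK); rewrite opprK.
by rewrite -cisDpi; exact: cis_circle.
Qed.

Let le_theta i j : (1 <= i)%N -> (i <= j)%N -> (j <= 4 * n)%N -> theta i <= theta j.
Proof.
move=> i1; rewrite leq_eqVlt => /orP[/eqP -> //|ij] jN.
by apply: ltW; exact: mono.
Qed.

Let arc_no_bd j t : (1 <= j)%N -> (j < 4 * n)%N -> theta j < t < theta j.+1 ->
  ~ boundary K (cis t).
Proof.
move=> j1 jN /andP[t1 t2] /bdP[|k kN E]; first exact: cis_circle.
have N1 : (1 <= 1 <= 4 * n)%N by rewrite /= (leq_trans j1) // ltnW.
have NN : (1 <= 4 * n <= 4 * n)%N by rewrite leqnn andbT; case/andP: N1.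
have lo i : (1 <= i <= 4 * n)%N -> theta 1%N <= theta i.
  by move=> /andP[i1 iN]; exact: le_theta.
have hi i : (1 <= i <= 4 * n)%N -> theta i <= theta (4 * n)%N.
  by move=> /andP[i1 iN]; exact: le_theta.
have tE : t = theta k.
  apply: cis_inj E; have := turn N1 NN; have := lo k kN; have := hi k kN.
  have := lo j; have := hi j.+1; rewrite j1 jN (ltnW jN) => /(_ isT) h1 /(_ isT) h2 h3 h4 h5.
  by rewrite ltr_norml; apply/andP; split; lra.
case/andP: kN => k1 kN; have [kj|jk] := leqP k j.
  by have := le_theta k1 kj (ltnW jN); rewrite -tE; lra.
by have := le_theta (leqW j1) jk kN; rewrite -tE; lra.
Qed.

Let inside j := `[< forall t, theta j < t < theta j.+1 -> interior K (cis t) >].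

Let insideP j : (1 <= j)%N -> (j < 4 * n)%N ->
  if inside j then forall t, theta j < t < theta j.+1 -> interior K (cis t)
  else forall t, theta j < t < theta j.+1 -> ~ K (cis t).
Proof.
move=> j1 jN; rewrite /inside; case: asboolP => // nin.
have [|t|h|h] := @arc_constant R K `]theta j, theta j.+1[%classic clK.
- exact: interval_is_interval.
- by rewrite /= in_itv /=; exact: arc_no_bd.
- by exfalso; apply: nin => t tt; apply: h; rewrite /= in_itv.
by move=> t tt; apply: h; rewrite /= in_itv.
Qed.

(** If the arcs before and after a crossing were of the same kind, so would be a punctured
    neighborhood of it on the circle, against transversality. *)
Let alternate j : (1 <= j)%N -> (j.+1 < 4 * n)%N -> inside j.+1 = ~~ inside j.
Proof.
move=> j1 jN; have jN' := ltnW jN.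
have h1 := insideP j1 jN'; have h2 := insideP (leqW j1) jN.
have l1 : theta j < theta j.+1 by apply: mono.
have l2 : theta j.+1 < theta j.+2 by apply: mono.
pose d := Num.min (theta j.+1 - theta j) (theta j.+2 - theta j.+1).
have d0 : 0 < d by rewrite lt_min !subr_gt0 l1.
have [d1 d2] : d <= theta j.+1 - theta j /\ d <= theta j.+2 - theta j.+1.
  by rewrite /d !ge_min !lexx orbT.
have [c1 c2] := transverse_crossing clK cK i0 tK (bd (j := j.+1) jN') (cis_circle _)
  (nbhs_cis (theta j.+1) d0).
have side u : unit_circle u -> (unit_circle u -> exists2 t, `|t - theta j.+1| < d & u = cis t) ->
    u != cis (theta j.+1) -> exists2 t, u = cis t &
    theta j < t < theta j.+1 \/ theta j.+1 < t < theta j.+2.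
  move=> cu /(_ cu)[t td ->] ne; exists t => //.
  move: td; rewrite ltr_norml => /andP[t1 t2].
  have [tt|tt|tt] := ltgtP t (theta j.+1); last by rewrite tt eqxx in ne.
    by left; rewrite andbT; lra.
  by right; lra.
case: (inside j) h1; case: (inside j.+1) h2 => // h2 h1; exfalso.
  apply: c1 => u cu Uu ne; have [t -> [tt|tt]] := side u cu Uu ne; [exact: h1|exact: h2].
apply: c2 => u cu Uu ne; have [t -> [tt|tt]] := side u cu Uu ne; [exact: h1|exact: h2].
Qed.

Let parity j : (1 <= j)%N -> (j < 4 * n)%N -> inside j = inside 1%N (+) ~~ odd j.
Proof.
case: j => // j _; elim: j => [|j IH] jN; first by rewrite addbF.
by rewrite alternate // IH ?(ltnW jN) //=; case: (inside 1%N); case: (odd j).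
Qed.

(** If the first arc is inside [K], the numbering starts one crossing later, so that in [tau] the
    arcs of even index are always gaps. The indices reach at most 2n + 2, which is within 4n as n >
    0. *)
Let b := inside 1%N.
Let tau k := theta (k + b).+1.

Let bound k : (k <= n.*2)%N -> ((k + b).+1 <= n.*2.+2)%N.
Proof. by move=> kn; rewrite !ltnS -addn1 leq_add // leq_b1. Qed.

Let n2_lt4 : (n.*2.+2 <= 4 * n)%N.
Proof. by rewrite N4 -doubleS leq_double -addnn -addn1 leq_add2l. Qed.

Let arc k : (k < n.*2)%N -> (1 <= (k + b).+1)%N /\ ((k + b).+1 < 4 * n)%N.
Proof. by move=> kn; split => //; apply: leq_trans n2_lt4; rewrite -addSn; exact: bound. Qed.

Let tau_mono k : (k < n.*2)%N -> tau k < tau k.+1.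
Proof. by move=> kn; rewrite /tau addSn; have [h1 h2] := arc kn; exact: mono. Qed.

Let tau_turn : tau n.*2 = tau 0%N + pi.
Proof.
rewrite /tau -addnC -addSn antipodal //=.
by rewrite (@leq_trans 2) // ?ltnS ?leq_b1 // -(doubleS 0) leq_double.
Qed.

Let gapsK : gap_system K [seq gap_vec (tau i.*2) (tau i.*2.+1) | i <- iota 0 n].
Proof.
apply: gap_system_half_turn => //.
- by move=> k kn; apply: bd; rewrite /= (leq_trans (bound kn)).
- move=> i iN t tt; have kn : (i.*2 < n.*2)%N by rewrite ltn_double.
  have [h1 h2] := arc kn; have := insideP h1 h2.
  rewrite parity //= negbK oddD odd_double /= oddb addbb; apply.
  by move: tt; rewrite /tau addSn.
- move=> i iN t tt; have kn : (i.*2.+1 < n.*2)%N by rewrite -doubleS leq_double.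
  have [h1 h2] := arc kn; have := insideP h1 h2.
  rewrite parity //= negbK oddD /= odd_double /= oddb addbN addbb; apply.
  by move: tt; rewrite /tau doubleS !addSn.
Qed.

Lemma MI_position_crossings : MI_position K <->
  \sum_(1 <= j < (4 * n).+1 | odd j) to_complex (zeta j) ^+ 2 =
  \sum_(1 <= j < (4 * n).+1 | ~~ odd j) to_complex (zeta j) ^+ 2.
Proof.
rewrite (MI_position_iff_gap_system kK cK sK i0 gapsK).
have per j : (1 <= j <= n.*2)%N -> to_complex (zeta (j + n.*2)%N) ^+ 2 = to_complex (zeta j) ^+ 2.
  move=> jn; have /andP[j1 j2] := jn.
  have jN : (1 <= j <= 4 * n)%N by rewrite j1 N4 -addnn (leq_trans j2) // leq_addr.
  rewrite !zetaE //; last by rewrite addn_gt0 j1 /= N4 -(addnn n.*2) leq_add2r.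
  by rewrite antipodal // cisDpi -[RHS]sqrrN.
rewrite (alternating_period b per n0) -sum_gap_vec_eq0 => [|i]; last first.
  rewrite mem_iota add0n => /andP[_ iN].
  have i2 : (i.*2.+2 <= n.*2)%N by rewrite -doubleS leq_double.
  rewrite tau_mono ?(ltnW i2) //=; apply: (@lt_le_trans _ _ (tau n.*2)).
    exact: (increasing_lt tau_mono i2).
  rewrite tau_turn lerD2r; apply: (increasing_le tau_mono).
  by rewrite /= ltnW // ltnW.
suff -> : \sum_(i <- iota 0 n) (to_complex (cis (tau i.*2.+1)) ^+ 2 - to_complex (cis (tau i.*2)) ^+ 2) =
    \sum_(0 <= i < n) (to_complex (zeta (i.*2.+2 + b)%N) ^+ 2 - to_complex (zeta (i.*2.+1 + b)%N) ^+ 2) by [].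
rewrite /index_iota subn0; apply: eq_big_seq => i; rewrite mem_iota add0n => /andP[_ iN].
have i2 : (i.*2.+2 <= n.*2)%N by rewrite -doubleS leq_double.
have h1 := leq_trans (bound (ltnW i2)) n2_lt4.
have h2 := leq_trans (bound (ltnW (ltnW i2))) n2_lt4.
by rewrite !addSn !zetaE.
Qed.

End Crossings.

Theorem theorem5p1 (R : realType) (K : set (R * R)) (n : nat)
    (zeta : nat -> R * R)
    (Kcompact : compact K)
    (Kconvex : convex_set K)
    (Ksym : centrally_symmetric K)
    (Kint : interior K !=set0)
    (Ktrans : transverse (boundary K) (@unit_circle R))
    (zeta_points : [set zeta j | j in [set j : nat | (1 <= j <= 4 * n)%N]] =
                   boundary K `&` @unit_circle R)
    (zeta_ordered : cyclically_ordered (4 * n) zeta) :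
  MI_position K <->
  \sum_(1 <= j < (4 * n).+1 | odd j) to_complex (zeta j) ^+ 2 =
  \sum_(1 <= j < (4 * n).+1 | ~~ odd j) to_complex (zeta j) ^+ 2.
Proof.
have i0 := symmetric_interior0 Ksym Kconvex Kint.
(* For n = 0 both sums are empty, so the MI position must be proved outright. *)
have [n0|n0] := posnP n.
  rewrite n0 muln0 in zeta_points *; rewrite !big_geq //; split=> // _.
  apply: MI_position_no_crossing => //; rewrite -zeta_points.
  by apply/seteqP; split => // u [j] /= /andP[j1]; rewrite leqNgt j1.
case: zeta_ordered => [[theta [zE mono turn]]|[theta [zE mono turn]]].
  exact: MI_position_crossings zE mono turn n0.
(* Reversing the numbering handles clockwise order. As 4n + 1 is odd, it exchanges odd and even
   indices and hence the two sides of the equation. *)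
pose rho (j : nat) := ((4 * n).+1 - j)%N.
have rho_in j : (1 <= j <= 4 * n)%N -> (1 <= rho j <= 4 * n)%N.
  by move=> /andP[j1 j2]; rewrite /rho subn_gt0 ltnS j2 leq_subLR addnC -addn1 leq_add2l.
have rhoK j : (1 <= j <= 4 * n)%N -> rho (rho j) = j.
  by move=> /andP[_ j2]; rewrite /rho subKn // leqW.
have pts : [set zeta (rho j) | j in [set j : nat | (1 <= j <= 4 * n)%N]] =
    boundary K `&` @unit_circle R.
  rewrite -zeta_points; apply/seteqP; split => u [j jN <-].
    by exists (rho j) => //; exact: rho_in.
  by exists (rho j); [exact: rho_in|rewrite rhoK].
rewrite (MI_position_crossings Kcompact Kconvex Ksym i0 Ktrans pts zE mono turn n0).
have odd_rho j : (1 <= j <= 4 * n)%N -> odd (rho j) = ~~ odd j.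
  move=> /andP[_ j2]; rewrite /rho oddB ?leqW //= oddM /=.
  by case: (odd j).
have rev_sum (P : pred nat) (a : nat -> R[i]) :
    \sum_(1 <= j < (4 * n).+1 | P j) a (rho j) = \sum_(1 <= j < (4 * n).+1 | P (rho j)) a j.
  rewrite big_nat_rev /= big_nat_cond [RHS]big_nat_cond add1n.
  by apply: eq_big => [j|j /andP[jN _]]; rewrite -?/(rho j) ?subSS ?rhoK //.
rewrite !(rev_sum _ (fun j => to_complex (zeta j) ^+ 2)).
have e1 : \sum_(1 <= j < (4 * n).+1 | odd (rho j)) to_complex (zeta j) ^+ 2 =
    \sum_(1 <= j < (4 * n).+1 | ~~ odd j) to_complex (zeta j) ^+ 2.
  rewrite big_nat_cond [RHS]big_nat_cond; apply: eq_bigl => j.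
  by case: (boolP (1 <= j < (4 * n).+1)%N) => // jN; rewrite odd_rho.
have e2 : \sum_(1 <= j < (4 * n).+1 | ~~ odd (rho j)) to_complex (zeta j) ^+ 2 =
    \sum_(1 <= j < (4 * n).+1 | odd j) to_complex (zeta j) ^+ 2.
  rewrite big_nat_cond [RHS]big_nat_cond; apply: eq_bigl => j.
  by case: (boolP (1 <= j < (4 * n).+1)%N) => // jN; rewrite odd_rho // negbK.
by rewrite e1 e2; split.
Qed.
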